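(* Let $N\ge 2$ and let $B$ be the open unit ball of $\mathbb{R}^N$. Let $f\in C^1([0,+\infty),\mathbb{R})$ be nondecreasing with $f(0)=0$, $f'(0)=\lim_{s\to0^+}\frac{f(s)}{s}=0$ and $\liminf_{s\to+\infty}\frac{f(s)}{s}>1$. Suppose moreover that there exists $u_0>0$ such that $f(u_0)=u_0$ and $f'(u_0)>\lambda_2^{rad}$. Then there exists at least one nonconstant radial solution $u$, increasing as a function of $|x|$, of the problem $$-\Delta u+u=f(u)\ \text{ in } B,\qquad u>0\ \text{ in } B,\qquad \partial_\nu u=0\ \text{ on }\partial B.$$
   Context: $\lambda_2^{rad}>1$ denotes the second radial eigenvalue of $-\Delta+1$ in $B$ with Neumann boundary conditions, i.e. the smallest $\lambda>1$ for which there is a nonzero radial function $v$ with $-\Delta v+v=\lambda v$ in $B$ and $\partial_\nu v=0$ on $\partial B$ (the first radial eigenvalue being $1$, with constant eigenfunctions). $\nu$ denotes the outer unit normal on $\partial B$. A solution is a function $u\in H^2(B)$ satisfying the equation almost everywhere in $B$ and the Neumann boundary condition in the sense of traces. *)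

(* Defs.v *)
From HB Require Import structures.
From mathcomp Require Import all_boot all_order all_algebra.
From mathcomp Require Import all_classical all_reals all_analysis.
From mathcomp Require Import measurable_realfun.

Set Implicit Arguments.
Unset Strict Implicit.
Unset Printing Implicit Defensive.

Import Order.TTheory GRing.Theory Num.Theory.
Import numFieldNormedType.Exports.

Local Open Scope classical_set_scope.
Local Open Scope ring_scope.

Section BorelRn.
Context {R : realType} (n : nat).

Definition rV_coord (i : 'I_n) (x : 'rV[R]_n) : R := x ord0 i.

Let rV_set0 : g_sigma_preimage rV_coord set0.
Proof. exact: sigma_algebra0. Qed.

Let rV_setC A : g_sigma_preimage rV_coord A -> g_sigma_preimage rV_coord (~` A).
Proof. exact: sigma_algebraC. Qed.

Let rV_bigcup (F : _^nat) : (forall i, g_sigma_preimage rV_coord (F i)) ->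
  g_sigma_preimage rV_coord (\bigcup_i (F i)).
Proof. exact: sigma_algebra_bigcup. Qed.

(* The sigma-algebra generated by the coordinates, i.e. the Borel sets. *)
HB.instance Definition _ := @isMeasurable.Build default_measure_display
  'rV[R]_n (g_sigma_preimage rV_coord) rV_set0 rV_setC rV_bigcup.

Lemma measurable_rV_coord (i : 'I_n) : measurable_fun [set: 'rV[R]_n] (rV_coord i).
Proof.
move=> _ Y mY; rewrite setTI; apply: sub_sigma_algebra => /=.
rewrite -bigcup_seq/=; exists i => /=; first by rewrite mem_index_enum.
by exists Y => //; rewrite setTI.
Qed.

Lemma measurable_fun_rVP d (T : measurableType d) (f : T -> 'rV[R]_n) :
  (forall i, measurable_fun [set: T] (fun t => f t ord0 i)) ->
  measurable_fun [set: T] f.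
Proof.
move=> mf _ A mA; rewrite setTI.
suff: g_sigma_preimage (fun i => rV_coord i \o f) `<=` measurable.
  by rewrite g_sigma_preimage_comp; apply; exists A => //; rewrite setTI.
apply: smallest_sub; first exact: sigma_algebra_measurable.
rewrite -bigcup_seq; apply: bigcup_sub => i _ B [C mC <-].
exact: mf.
Qed.

End BorelRn.

Section LebesgueRn.
Context {R : realType}.

Definition rV_cons n (p : R * 'rV[R]_n) : 'rV[R]_n.+1 :=
  \row_i oapp (p.2 ord0) p.1 (unlift ord0 i).

Definition rV_uncons n (x : 'rV[R]_n.+1) : R * 'rV[R]_n :=
  (x ord0 ord0, \row_i x ord0 (lift ord0 i)).

Lemma rV_consK n : cancel (@rV_cons n) (@rV_uncons n).
Proof.
move=> [a x]; rewrite /rV_uncons /rV_cons !mxE unlift_none /=; congr pair.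
by apply/rowP => i; rewrite !mxE liftK.
Qed.

Lemma measurable_rV_cons n : measurable_fun setT (@rV_cons n).
Proof.
apply: measurable_fun_rVP => i.
rewrite (_ : (fun t => _) =
  (fun p : R * 'rV[R]_n => oapp (p.2 ord0) p.1 (unlift ord0 i))); last first.
  by apply/funext => p; rewrite mxE.
case: unliftP => [j _|_] /=; last exact: measurable_fst.
exact: (measurableT_comp (measurable_rV_coord j) measurable_snd).
Qed.

Lemma measurable_rV_uncons n : measurable_fun setT (@rV_uncons n).
Proof.
apply: measurable_fun_pair; first exact: measurable_rV_coord.
apply: measurable_fun_rVP => i.
rewrite (_ : (fun t => _) = rV_coord (lift ord0 i)); first exact: measurable_rV_coord.
by apply/funext => p; rewrite mxE.
Qed.

Section cons_measure.
Context n (m : {sigma_finite_measure set 'rV[R]_n -> \bar R}).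

Definition lebesgue_cons : set 'rV[R]_n.+1 -> \bar R :=
  pushforward (lebesgue_measure \x m)%E (@rV_cons n).

Let mc := @measurable_rV_cons n.

Let cons0 : lebesgue_cons set0 = 0%E. Proof. exact: measure0. Qed.

Let cons_ge0 A : (0 <= lebesgue_cons A)%E. Proof. exact: measure_ge0. Qed.

Let cons_sigma_additive : semi_sigma_additive lebesgue_cons.
Proof. exact: measure_semi_sigma_additive. Qed.

HB.instance Definition _ := isMeasure.Build _ _ _ lebesgue_cons
  cons0 cons_ge0 cons_sigma_additive.

Let cons_sigma_finite : sigma_finite setT lebesgue_cons.
Proof.
have /sigma_finiteP[F [TF ndF Foo]] := sigma_finiteT (@lebesgue_measure R).
have /sigma_finiteP[G [TG ndG Goo]] := sigma_finiteT m.
exists (fun k => @rV_uncons n @^-1` (F k `*` G k)).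
  rewrite -preimage_bigcup (_ : \bigcup_k _ = setT) ?preimage_setT//.
  rewrite -setXTT TF TG predeqE => -[x y]; split; first by move=> [k _ []]; split; exists k.
  move=> [/= [k _ Fx] [l _ Gy]]; exists (maxn k l) => //; split.
  - by move: x Fx; exact/subsetPset/ndF/leq_maxl.
  - by move: y Gy; exact/subsetPset/ndG/leq_maxr.
move=> k; have [mF Fk] := Foo k; have [mG Gk] := Goo k; split.
  rewrite -[X in measurable X]setTI; apply: measurable_rV_uncons => //.
  exact: measurableX.
rewrite /lebesgue_cons /pushforward -comp_preimage (_ : _ \o _ = id); last first.
  by apply/funext => p; exact: rV_consK.
by rewrite preimage_id product_measure1E// lte_mul_pinfty// ge0_fin_numE.
Qed.

HB.instance Definition _ := Measure_isSigmaFinite.Build _ _ _ lebesgue_cons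
  cons_sigma_finite.

End cons_measure.

Fixpoint lebesgue_rV n : {sigma_finite_measure set 'rV[R]_n -> \bar R} :=
  match n with
  | 0 => dirac (0 : 'rV[R]_0)
  | k.+1 => lebesgue_cons (lebesgue_rV k)
  end.

Lemma lebesgue_rV_box n (A : 'I_n -> set R) :
  (forall i, measurable (A i)) ->
  lebesgue_rV n [set x | forall i, A i (x ord0 i)] =
  (\prod_(i < n) lebesgue_measure (A i))%E.
Proof.
elim: n A => [|n IH] A mA.
  rewrite big_ord0 /= diracE mem_set//= => -[]//.
rewrite big_ord_recl -IH; last by move=> i; exact: mA.
have mtail : measurable [set x : 'rV[R]_n | forall i, A (lift ord0 i) (x ord0 i)].
  rewrite (_ : mkset _ = \bigcap_(i in [set: 'I_n]) (rV_coord i @^-1` A (lift ord0 i))).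
    apply: fin_bigcap_measurable => [|i _]; first exact: finite_finset.
    by rewrite -[X in measurable X]setTI; exact: measurable_rV_coord.
  by apply/seteqP; split => x /= h i; [move=> _; exact: h|exact: h].
rewrite -product_measure1E; [|exact: mA|exact: mtail].
rewrite /= /lebesgue_cons /pushforward; congr ((_ \x _)%E _).
apply/seteqP; split => [[a x] /= h|[a x] /= [h0 h] i].
  split; first by have := h ord0; rewrite mxE unlift_none.
  by move=> i; have := h (lift ord0 i); rewrite mxE liftK.
by rewrite mxE; case: unliftP => [j ->|->] /=.
Qed.

End LebesgueRn.

Section UnitBall.
Context {R : realType} (N : nat).
Implicit Types x : 'rV[R]_N.

(* The norm of the library on ['rV[R]_N] is the sup norm. *)
Definition enorm x : R := Num.sqrt (\sum_(i < N) x ord0 i ^+ 2).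

Definition uball : set 'rV[R]_N := [set x | enorm x < 1].

Definition usphere : set 'rV[R]_N := [set x | enorm x = 1].

Definition radial_proj x : 'rV[R]_N := (enorm x)^-1 *: x.

Lemma measurable_enorm : measurable_fun setT enorm.
Proof.
apply: (measurableT_comp (continuous_measurable_fun (@sqrt_continuous R))).
by apply: measurable_sum => i; apply: measurable_funX; exact: measurable_rV_coord.
Qed.

Lemma measurable_uball : measurable uball.
Proof.
rewrite (_ : uball = enorm @^-1` `]-oo, 1[%classic).
  by rewrite -[X in measurable X]setTI; exact: measurable_enorm.
by apply/seteqP; split => x; rewrite /uball /= in_itv.
Qed.

Lemma measurable_radial_proj : measurable_fun setT radial_proj.
Proof.
apply: measurable_fun_rVP => i.
rewrite (_ : (fun x => _) = (fun x => enorm x `^ (-1) * x ord0 i)); last first.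
  by apply/funext => x; rewrite mxE powR_inv1// sqrtr_ge0.
apply: measurable_funM; last exact: measurable_rV_coord.
exact: (measurableT_comp (measurable_powR _) measurable_enorm).
Qed.

Definition cone_measure : set 'rV[R]_N -> \bar R :=
  pushforward (mrestr (lebesgue_rV N) measurable_uball) radial_proj.

Let mp := measurable_radial_proj.

Let cone_measure0 : cone_measure set0 = 0%E.
Proof. exact: measure0. Qed.

Let cone_measure_ge0 A : (0 <= cone_measure A)%E.
Proof. exact: measure_ge0. Qed.

Let cone_measure_sigma_additive : semi_sigma_additive cone_measure.
Proof. exact: measure_semi_sigma_additive. Qed.

HB.instance Definition _ := isMeasure.Build _ _ _ cone_measure
  cone_measure0 cone_measure_ge0 cone_measure_sigma_additive.

(* The surface measure of the unit sphere, in polar coordinates as in Folland,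
   Real Analysis, Theorem 2.49: the measure of [A] is [N] times the volume of
   the cone [{ r x | 0 < r < 1, x in A }]. *)
Definition sphere_measure : set 'rV[R]_N -> \bar R :=
  mscale N%:R%:nng cone_measure.

HB.instance Definition _ := Measure.on sphere_measure.

End UnitBall.
Arguments uball {R} N.
Arguments usphere {R} N.
Arguments sphere_measure {R} N.

Section Sobolev.
Context {R : realType} (N : nat).
Local Notation E := 'rV[R]_N.
Local Notation B := (uball N : set E).
Local Notation S := (usphere N : set E).
Local Notation leb := (lebesgue_rV N : {measure set E -> \bar R}).
Local Notation sigma := (sphere_measure N : {measure set E -> \bar R}).
Implicit Types (u v p t : E -> R) (g : 'I_N -> E -> R).

Definition partial (i : 'I_N) p : E -> R := fun x => 'D_(delta_mx ord0 i) p x.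

Definition C1 p : Prop :=
  continuous p /\
  forall i, (forall x, derivable p x (delta_mx ord0 i)) /\
            continuous (partial i p).

Definition C1c p : Prop :=
  [/\ C1 p, compact (closure [set x | p x != 0]) &
      closure [set x | p x != 0] `<=` B].

Definition square_integrable (mu : set E -> \bar R) (D : set E) u : Prop :=
  measurable_fun D u /\ mu.-integrable D (fun x => (u x ^+ 2)%:E).

(* Weak derivatives are tested against [C^1] functions with compact support in
   the ball, as in Gilbarg-Trudinger, Section 7.3. *)
Definition weak_partial (i : 'I_N) u v : Prop :=
  forall p, C1c p ->
    \int[leb]_(x in B) (u x * partial i p x) =
    - \int[leb]_(x in B) (v x * p x).

Definition H1_with_grad u g : Prop :=
  square_integrable leb B u /\
  forall i, square_integrable leb B (g i) /\ weak_partial i u (g i).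

Definition H2_with_derivatives u g (h : 'I_N -> 'I_N -> E -> R) : Prop :=
  H1_with_grad u g /\ forall i, H1_with_grad (g i) (h i).

(* [t] is the trace on the sphere of [u], of weak gradient [g]: the trace
   operator is the continuous extension, from [H^1] of the ball to [L^2] of the
   sphere, of the restriction of [C^1] functions (up to the boundary). *)
Definition is_trace u g t : Prop :=
  square_integrable sigma S t /\
  exists p : nat -> E -> R,
    [/\ forall k, C1 (p k),
        (\int[leb]_(x in B) ((p k x - u x) ^+ 2)%:E)%E @[k --> \oo] --> 0%E,
        forall i, (\int[leb]_(x in B) ((partial i (p k) x - g i x) ^+ 2)%:E)%E
                    @[k --> \oo] --> 0%E &
        (\int[sigma]_(x in S) ((p k x - t x) ^+ 2)%:E)%E @[k --> \oo] --> 0%E].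

(* The normal derivative is the sum of the traces of the partial derivatives
   against the components of the outer normal, which at [x] is [x] itself. *)
Definition neumann g (h : 'I_N -> 'I_N -> E -> R) : Prop :=
  exists t : 'I_N -> E -> R,
    (forall i, is_trace (g i) (h i) (t i)) /\
    {ae sigma, forall x, S x -> \sum_(i < N) t i x * x ord0 i = 0}.

(* [u] is in [H^2] and solves [- Delta u + u = F(u)] a.e. in the ball, with the
   homogeneous Neumann condition. *)
Definition neumann_solution (F : R -> R) u : Prop :=
  exists (g : 'I_N -> E -> R) (h : 'I_N -> 'I_N -> E -> R),
    [/\ H2_with_derivatives u g h,
        {ae leb, forall x, B x -> - (\sum_(i < N) h i i x) + u x = F (u x)} &
        neumann g h].

Definition radial u : Prop :=
  forall x y, B x -> B y -> enorm x = enorm y -> u x = u y.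

Definition radially_increasing u : Prop :=
  forall x y, B x -> B y -> enorm x < enorm y -> u x < u y.

(* Constant, as an element of [L^2]: a.e. equal to a constant. *)
Definition ae_constant u : Prop :=
  exists c : R, {ae leb, forall x, B x -> u x = c}.

End Sobolev.

Definition radial_eigenvalue {R : realType} (N : nat) (lam : R) : Prop :=
  exists v : 'rV[R]_N -> R,
    [/\ neumann_solution (fun s => lam * s) v, radial v &
        ~ {ae (lebesgue_rV N : {measure set 'rV[R]_N -> \bar R}),
             forall x, uball N x -> v x = 0}].

Definition second_radial_eigenvalue {R : realType} (N : nat) (lam : R) : Prop :=
  [/\ 1 < lam, radial_eigenvalue N lam &
      forall mu : R, 1 < mu -> radial_eigenvalue N mu -> lam <= mu].

(* [f] is [C^1] on [[0, +oo[] with derivative [df], one-sided at [0]; the values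
   of [f] and [df] on negative numbers are irrelevant. *)
Definition C1_nonneg {R : realType} (f df : R -> R) : Prop :=
  (forall s, 0 <= s ->
     (f t - f s) / (t - s) @[t --> within `[0, +oo[ s^'] --> df s) /\
  {within `[0, +oo[, continuous df}.

(* Main.v *)
(* Radial solutions are sought by shooting: [V_d] solves the radial equation with
   [V_d 0 = d], with [s - f s] cut off so as to be Lipschitz and to vanish below
   the largest fixed point [um < u0] of [f]. For [d > um] close to [um], [V_d]
   increases on [[0, 1]]. For [d < u0] close to [u0] it does not: as
   [f' u0 > lambda_2], Sturm comparison with the radial eigenfunction of
   [lambda_2] makes [V_d'] change sign before 1. At the supremum of the [d] for
   which [V_d' > 0] on [(0, 1]], the derivative vanishes somewhere, and it can only
   do so at 1, by uniqueness for the Cauchy problem. An increasing solution with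
   [V' 1 = 0] satisfies [V 1 - d <= V 1 / N], hence [V <= 2 * u0], so that cutting
   off [f] at [2 * u0] is harmless and no growth condition is needed.

   The Sturm comparison needs a classical eigenfunction, whereas the eigenvalue is
   given through a weak one, [v]. If the regular solution of the radial eigenvalue
   equation did not satisfy the Neumann condition at 1, every continuous radial
   [q] would be the image of a radial function with vanishing normal derivative
   under the eigenvalue operator; Green's identity would make [v] orthogonal to
   all these [q], and so [v = 0]. *)
Require Import Defs.
From mathcomp Require Import all_boot all_order all_algebra.
From mathcomp Require Import all_classical all_reals all_analysis.
From mathcomp Require Import measurable_realfun ring lra.
Import Order.TTheory GRing.Theory Num.Theory.
Import numFieldNormedType.Exports.
Local Open Scope classical_set_scope.
Local Open Scope ring_scope.

Set Implicit Arguments.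
Unset Strict Implicit.
Unset Printing Implicit Defensive.

(** * One-dimensional calculus and the radial Laplacian *)

Section RealCalculus.
Context {R : realType}.
Implicit Types f g k : R -> R.

(** The radial equation is singular at 0. With [k] for the Laplacian of [V], the remedy is to work
    with the quotient [V' / r], which is a mean of [k]: it is continuous on [[0, 1]], equals
    [k 0 / N] at 0 and has the sign of [V'] elsewhere. Its positivity on the whole of [[0, 1]] is an
    open condition on the initial value, by compactness, whereas [V'] always vanishes at 0. [V]
    itself is a primitive in the variable [r ^+ 2], hence a differentiable function of the squared
    norm, and this gives its C^2 extension to the ball. On the weak side, traces are given by
    approximation, the surface measure by cones and weak derivatives by compactly supported test
    functions. What links them is the divergence theorem on the ball, obtained without charts: a
    cutoff moves the boundary term inside, and differentiating the dilates of an integral identifies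
    its limit. Only then can a weak eigenfunction be integrated by parts against a radial C^2
    function. *)

Lemma is_derive_continuous f (x d : R) : is_derive x 1 f d -> {for x, continuous f}.
Proof. by move=> [+ _] => /derivable1_diffP/differentiable_continuous. Qed.

Lemma MVT_pointwise f df (a b : R) : a < b ->
  (forall x, a < x < b -> is_derive x 1 f (df x)) ->
  (forall x, a <= x <= b -> {for x, continuous f}) ->
  exists2 c, a < c < b & f b - f a = df c * (b - a).
Proof.
move=> ab dfE cf.
have dfE' x : x \in `]a, b[%R -> is_derive x 1 f (df x).
  by rewrite in_itv/= => /dfE.
have cf' : {within `[a, b], continuous f}.
  apply: continuous_in_subspaceT => x; rewrite inE/= in_itv/= => xab.
  exact: cf.
have [c + ->] := MVT ab dfE' cf'.
by rewrite in_itv/= => cab; exists c.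
Qed.

Lemma derive_ge0_le f df (a b : R) : a <= b ->
  (forall x, a < x < b -> is_derive x 1 f (df x)) ->
  (forall x, a <= x <= b -> {for x, continuous f}) ->
  (forall x, a < x < b -> 0 <= df x) -> f a <= f b.
Proof.
rewrite le_eqVlt => /predU1P[->//|ab] dfE cf df0.
have [c cab e] := MVT_pointwise ab dfE cf.
by rewrite -subr_ge0 e mulr_ge0 ?subr_ge0 ?df0 // ltW.
Qed.

Lemma derive_gt0_lt f df (a b : R) : a < b ->
  (forall x, a < x < b -> is_derive x 1 f (df x)) ->
  (forall x, a <= x <= b -> {for x, continuous f}) ->
  (forall x, a < x < b -> 0 < df x) -> f a < f b.
Proof.
move=> ab dfE cf df0.
have [c cab e] := MVT_pointwise ab dfE cf.
by rewrite -subr_gt0 e mulr_gt0 ?subr_gt0 ?df0.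
Qed.

(** Monotonicity of both [g - f] and [g + f]; the bound on the slope may vary with the point. *)
Lemma derive_norm_le f df g dg (a b : R) : a <= b ->
  (forall x, a < x < b -> is_derive x 1 f (df x)) ->
  (forall x, a < x < b -> is_derive x 1 g (dg x)) ->
  (forall x, a <= x <= b -> {for x, continuous f}) ->
  (forall x, a <= x <= b -> {for x, continuous g}) ->
  (forall x, a < x < b -> `|df x| <= dg x) -> `|f b - f a| <= g b - g a.
Proof.
move=> ab dfE dgE cf cg dfg.
have h1 : (g \- f) a <= (g \- f) b.
  apply: (@derive_ge0_le _ (dg \- df)) => //= x xab.
  - by apply: is_deriveB; [exact: dgE|exact: dfE].
  - by apply: continuousB; [exact: cg|exact: cf].
  - by rewrite subr_ge0; apply: le_trans (dfg x xab); rewrite ler_norm.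
have h2 : (g \+ f) a <= (g \+ f) b.
  apply: (@derive_ge0_le _ (dg \+ df)) => //= x xab.
  - by apply: is_deriveD; [exact: dgE|exact: dfE].
  - by apply: continuousD; [exact: cg|exact: cf].
  - have := dfg x xab; rewrite ler_norml => /andP[+ _]; lra.
by rewrite ler_norml; move: h1 h2 => /=; lra.
Qed.

Lemma derive0_eq f (r : R) : 0 <= r ->
  (forall t : R, 0 <= t -> is_derive t 1 f 0) -> f r = f 0.
Proof.
rewrite le_eqVlt => /predU1P[<-//|r0] dE.
have [t tr|t /andP[t0 _]|c _] := @MVT_pointwise f (cst 0) 0 r r0.
- by apply: dE; lra.
- exact: is_derive_continuous (dE t t0).
by rewrite mul0r => /eqP; rewrite subr_eq0 => /eqP.
Qed.

Lemma is_derive_expn n (x : R) :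
  is_derive x 1 (fun y : R => y ^+ n) (n%:R * x ^+ n.-1).
Proof.
apply: DeriveDef; first exact: exprn_derivable.
by rewrite exp_derive /GRing.scale/= mulr1.
Qed.

(** The base point -1 makes every [x >= 0] interior to the domain of integration, so that the
    derivative at 0 is two-sided; subtracting the value at 0 restores the normalisation. *)
Definition primitive k (x : R) : R :=
  \int[lebesgue_measure]_(t in `[-1, x]) k t
  - \int[lebesgue_measure]_(t in `[-1, 0]) k t.

Lemma primitive0 k : primitive k 0 = 0.
Proof. by rewrite /primitive subrr. Qed.

Lemma is_derive_primitive k (x : R) : continuous k -> -1 < x ->
  is_derive x 1 (primitive k) (k x).
Proof.
move=> ck x1.
have xx1 : x < x + 1 by rewrite ltrDl.
have ik : lebesgue_measure.-integrable `[-1, x + 1] (EFin \o k).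
  apply: continuous_compact_integrable; first exact: segment_compact.
  exact: continuous_subspaceT.
have [d e] := continuous_FTC1_closed xx1 ik x1 (ck x).
have h : is_derive x 1
    (fun y => \int[lebesgue_measure]_(t in [set` `[(-1), y]]) k t) (k x).
  by rewrite -e derive1E; exact: derivableP.
rewrite /primitive; apply: is_derive_eq; last by rewrite subr0.
Qed.


Lemma primitive_le k1 k2 (r : R) : continuous k1 -> continuous k2 -> 0 <= r ->
  (forall t, 0 < t < r -> k1 t <= k2 t) -> primitive k1 r <= primitive k2 r.
Proof.
move=> c1 c2 r0 k12.
suff : (primitive k2 \- primitive k1) 0 <= (primitive k2 \- primitive k1) r.
  by rewrite /= !primitive0 subr0 subr_ge0.
have dE (t : R) : 0 <= t ->
    is_derive t 1 (primitive k2 \- primitive k1) (k2 t - k1 t).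
  move=> t0; have t1 : -1 < t by apply: lt_le_trans t0; lra.
  by apply: is_deriveB; exact: is_derive_primitive.
apply: (derive_ge0_le r0) => t tr.
- by apply: dE; lra.
- by apply: is_derive_continuous (dE _ _); lra.
- by rewrite subr_ge0 k12.
Qed.

(** Uniqueness of primitives: the difference has derivative 0 on [t >= 0] and vanishes at 0. *)
Lemma primitive_lin k1 k2 (a b r : R) :
  continuous k1 -> continuous k2 -> 0 <= r ->
  primitive (fun t => a * k1 t + b * k2 t) r
  = a * primitive k1 r + b * primitive k2 r.
Proof.
move=> c1 c2 r0.
have c3 : continuous (fun t : R => a * k1 t + b * k2 t).
  move=> t; apply: cvgD; apply: cvgM; by [exact: cvg_cst|exact: c1|exact: c2].
pose F := primitive (fun t => a * k1 t + b * k2 t)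
  \- (a \*: primitive k1 \+ b \*: primitive k2).
have dE (t : R) : 0 <= t -> is_derive t 1 F 0.
  move=> t0; have t1 : -1 < t by apply: lt_le_trans t0; lra.
  have h1 := is_derive_primitive c1 t1.
  have h2 := is_derive_primitive c2 t1.
  have h3 := is_derive_primitive c3 t1.
  by rewrite /F; apply: is_derive_eq; rewrite /GRing.scale/= subrr.
have := derive0_eq r0 dE.
rewrite /F /= !primitive0 /GRing.scale/= !mulr0 addr0 !subr0.
by move=> /eqP; rewrite subr_eq0 => /eqP.
Qed.

End RealCalculus.

(** * Means over balls and the radial Poisson equation *)

Section RadialMean.
Context {R : realType} (N : nat) (N0 : (0 < N)%N).
Implicit Types k : R -> R.

Let NR0 : (0 : R) < N%:R. Proof. by rewrite ltr0n. Qed.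

(** The flux [r ^+ N.-1 * V'] of a radial function [V] with Laplacian [k]. *)
Definition shell k : R -> R := primitive (fun t => t ^+ N.-1 * k t).

(* [rmean k r] is the integral over [0 <= s <= 1] of [s ^ (N - 1) * k (r * s)],
   so that the radial function with radial derivative [r * rmean k r] has
   Laplacian [k]. *)
Definition rmean k (r : R) : R :=
  if r == 0 then k 0 / N%:R else shell k `|r| / `|r| ^+ N.

Lemma continuous_shell k : continuous k -> continuous (fun t : R => t ^+ N.-1 * k t).
Proof. by move=> ck t; apply: cvgM; [exact: exprn_continuous|exact: ck]. Qed.

Lemma is_derive_shell k (r : R) : continuous k -> 0 <= r ->
  is_derive r 1 (shell k) (r ^+ N.-1 * k r).
Proof.
move=> ck r0; apply: (is_derive_primitive (continuous_shell ck)).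
by apply: lt_le_trans r0; lra.
Qed.

Lemma shell_rmean k (r : R) : 0 <= r -> shell k r = r ^+ N * rmean k r.
Proof.
move=> r0; rewrite /rmean; case: eqVneq => [->|rn0].
  by rewrite /shell primitive0 expr0n eqn0Ngt N0 mul0r.
by rewrite ger0_norm// mulrC divfK// expf_neq0.
Qed.

Lemma rmean_norm k (r : R) : rmean k `|r| = rmean k r.
Proof. by rewrite /rmean normr_eq0 normr_id. Qed.

Lemma shell_cst (c r : R) : 0 <= r -> shell (cst c) r = c / N%:R * r ^+ N.
Proof.
move=> r0.
have e : is_derive r 1 (shell (cst c)) (r ^+ N.-1 * c).
  by apply: is_derive_shell => // x; exact: cvg_cst.
pose F := shell (cst c) \- (c / N%:R) \*: (fun x : R => x ^+ N).
have dE (t : R) : 0 <= t -> is_derive t 1 F 0.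
  move=> t0; have h1 : is_derive t 1 (shell (cst c)) (t ^+ N.-1 * c).
    by apply: is_derive_shell => // x; exact: cvg_cst.
  have h2 : is_derive t 1 (fun x : R => x ^+ N) (N%:R * t ^+ N.-1)
      := is_derive_expn N t.
  rewrite /F; apply: is_derive_eq.
  by rewrite /GRing.scale/=; field; rewrite gt_eqF.
have := derive0_eq r0 dE.
rewrite /F /= /shell primitive0 /GRing.scale/= expr0n eqn0Ngt N0 mulr0 !subr0.
by move=> /eqP; rewrite subr_eq0 => /eqP.
Qed.

Lemma rmean_cst (c r : R) : rmean (cst c) r = c / N%:R.
Proof.
rewrite -rmean_norm; have [->|r0] := eqVneq r 0.
  by rewrite /rmean normr0 eqxx.
rewrite /rmean normr_eq0 (negbTE r0) normr_id shell_cst//.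
by field; rewrite ?expf_neq0 ?normr_eq0// gt_eqF.
Qed.

Lemma rmean_le k1 k2 (r : R) : continuous k1 -> continuous k2 -> 0 <= r ->
  (forall t, 0 <= t <= r -> k1 t <= k2 t) -> rmean k1 r <= rmean k2 r.
Proof.
move=> c1 c2 r0 k12; rewrite /rmean; case: eqVneq => [e|rn0].
  by rewrite ler_pM2r ?invr_gt0// k12// lexx.
have rp : 0 < r by rewrite lt_neqAle eq_sym rn0.
rewrite ger0_norm// ler_pM2r ?invr_gt0 ?exprn_gt0//.
apply: primitive_le => //; [exact: continuous_shell..|] => t tr.
by rewrite ler_pM2l ?exprn_gt0 ?k12; lra.
Qed.

Lemma rmean_ge_cst k (c r : R) : continuous k -> 0 <= r ->
  (forall t, 0 <= t <= r -> c <= k t) -> c / N%:R <= rmean k r.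
Proof.
move=> ck r0 kc; rewrite -(rmean_cst c r); apply: rmean_le => //.
by move=> x; exact: cvg_cst.
Qed.

Lemma rmean_le_cst k (c r : R) : continuous k -> 0 <= r ->
  (forall t, 0 <= t <= r -> k t <= c) -> rmean k r <= c / N%:R.
Proof.
move=> ck r0 kc; rewrite -(rmean_cst c r); apply: rmean_le => //.
by move=> x; exact: cvg_cst.
Qed.

Lemma rmean_norm_le k (c r : R) : continuous k -> 0 <= r ->
  (forall t, 0 <= t <= r -> `|k t| <= c) -> `|rmean k r| <= c / N%:R.
Proof.
move=> ck r0 kc; rewrite ler_norml -mulNr; apply/andP; split.
  by apply: rmean_ge_cst => // t /kc; rewrite ler_norml => /andP[].
by apply: rmean_le_cst => // t /kc; rewrite ler_norml => /andP[].
Qed.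

Lemma rmean_lin k1 k2 (a b r : R) : continuous k1 -> continuous k2 ->
  rmean (fun t => a * k1 t + b * k2 t) r = a * rmean k1 r + b * rmean k2 r.
Proof.
move=> c1 c2; rewrite /rmean; case: ifP => // _; first by rewrite mulrDl !mulrA.
rewrite /shell (_ : (fun t => _) =
  (fun t => a * (t ^+ N.-1 * k1 t) + b * (t ^+ N.-1 * k2 t))).
  by rewrite primitive_lin//; [rewrite mulrDl !mulrA|exact: continuous_shell..].
by apply/funext => t; ring.
Qed.

Lemma rmeanB k1 k2 (r : R) : continuous k1 -> continuous k2 ->
  rmean (k1 \- k2) r = rmean k1 r - rmean k2 r.
Proof.
move=> c1 c2; have := rmean_lin 1 (-1) r c1 c2.
rewrite !mul1r !mulN1r => <-; congr rmean; apply/funext => t /=.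
by rewrite mul1r mulN1r.
Qed.

Lemma eq_rmean k1 k2 (r : R) : continuous k1 -> continuous k2 ->
  (forall t, 0 <= t <= `|r| -> k1 t = k2 t) -> rmean k1 r = rmean k2 r.
Proof.
move=> c1 c2 e; rewrite -(rmean_norm k1) -(rmean_norm k2).
by apply: le_anti; rewrite !rmean_le// => t tr; rewrite e.
Qed.

(** The radial equation in terms of [w = V' / r]: it reads [r * w' + N * w = k]. *)
Lemma is_derive_rmean k (r : R) : continuous k -> 0 < r ->
  is_derive r 1 (rmean k) ((k r - N%:R * rmean k r) / r).
Proof.
move=> ck r0; have rN0 : r ^+ N != 0 by rewrite expf_neq0// gt_eqF.
apply: (@near_eq_is_derive _ _ _ (fun x : R => shell k x * (x ^+ N)^-1)).
  near=> x; have x0 : 0 < x by near: x; exact: lt_nbhsr.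
  by rewrite /rmean gt_eqF// gtr0_norm.
have h1 := is_derive_shell ck (ltW r0).
have h2 : is_derive r 1 (fun x : R => x ^+ N) (N%:R * r ^+ N.-1)
    := is_derive_expn N r.
have h3 := @is_deriveV _ (fun x : R => x ^+ N) _ _ _ rN0 h2.
apply: is_derive_eq.
rewrite /GRing.scale/= /rmean gt_eqF// gtr0_norm//.
case: N N0 rN0 => // n _ /=; rewrite exprS mulf_eq0 negb_or => /andP[rn0 rN0].
by move: (shell _ _) (r ^+ n) rN0 => c X X0; field; rewrite rn0 X0.
Unshelve. all: by end_near. Qed.

(** At 0, [rmean k y - k 0 / N] is the mean of [k - k 0], controlled by the oscillation of [k] near
    0; elsewhere the function is differentiable. *)
Lemma rmean_continuous k : continuous k -> continuous (rmean k).
Proof.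
move=> ck x; have [->|x0] := eqVneq x 0; last first.
  rewrite (_ : rmean k = rmean k \o Num.norm); last first.
    by apply/funext => y /=; rewrite rmean_norm.
  apply: continuous_comp; first exact: norm_continuous.
  by apply: is_derive_continuous (is_derive_rmean ck _); rewrite normr_gt0.
apply/cvgrPdist_le => e e0.
have /cvgrPdist_le/(_ e e0)[d /= d0 kd] := ck 0.
exists d => //= y /=; rewrite sub0r normrN => yd.
rewrite -(rmean_norm k y) {1}/rmean eqxx -(rmean_cst (k 0) `|y|).
rewrite -rmeanB//; last by move=> z; exact: cvg_cst.
apply: (@le_trans _ _ (e / N%:R)); last first.
  by rewrite ler_pdivrMr// ler_peMr// ?ler1n// ltW.
apply: rmean_norm_le => // [z|t ty].
  by apply: cvgB; [exact: cvg_cst|exact: ck].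
by apply: kd; rewrite /= sub0r normrN ger0_norm; lra.
Qed.

(** The radial function with Laplacian [k] that vanishes at 0. Integrating in the variable [r ^+ 2]
    makes it even in [r] and a differentiable function of the squared norm, also at the origin. *)
Definition green k (r : R) : R :=
  primitive (fun s => rmean k (Num.sqrt s) / 2) (r ^+ 2).

Lemma green0 k : green k 0 = 0.
Proof. by rewrite /green expr0n/= primitive0. Qed.

Lemma green_normr k (r : R) : green k `|r| = green k r.
Proof. by rewrite /green real_normK// num_real. Qed.

Lemma continuous_rmean_sqrt k : continuous k ->
  continuous (fun s : R => rmean k (Num.sqrt s) / 2).
Proof.
move=> ck s; apply: cvgM; last exact: cvg_cst.
apply: (continuous_comp (@sqrt_continuous R s)); exact: rmean_continuous.
Qed.

Lemma is_derive_green k (r : R) : continuous k ->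
  is_derive r 1 (green k) (r * rmean k r).
Proof.
move=> ck; have r1 : -1 < r ^+ 2 by apply: lt_le_trans (sqr_ge0 r); lra.
have h := is_derive_primitive (continuous_rmean_sqrt ck) r1.
have h2 : is_derive r 1 (fun x : R => x ^+ 2) (2 * r)
    := is_derive_expn 2 r.
have h3 : is_derive r 1 (green k) (rmean k (Num.sqrt (r ^+ 2)) / 2 * (2 * r)).
  exact: (@is_derive1_comp _ _ (fun x : R => x ^+ 2) r _ _ h h2).
apply: is_derive_eq.
by rewrite sqrtr_sqr rmean_norm; field.
Qed.

Lemma green_continuous k : continuous k -> continuous (green k).
Proof. by move=> ck x; exact: is_derive_continuous (is_derive_green x ck). Qed.

End RadialMean.

(** * Lebesgue measure on R^N *)

Section MeasurableRn.
Context {R : realType} (n : nat).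
Local Notation E := 'rV[R]_n.

Definition box (M : R) : set E := [set x | forall i, `|x ord0 i| <= M].

Lemma measurable_coord_set (A : 'I_n -> set R) : (forall i, measurable (A i)) ->
  measurable [set x : E | forall i, A i (x ord0 i)].
Proof.
move=> mA; rewrite (_ : mkset _ =
    \bigcap_(i in [set: 'I_n]) (rV_coord i @^-1` A i)).
  apply: fin_bigcap_measurable => [|i _]; first exact: finite_finset.
  by rewrite -[X in measurable X]setTI; exact: measurable_rV_coord.
by apply/seteqP; split => x /= h i; [move=> _; exact: h|exact: h].
Qed.

(** Balls of the sup norm are products of intervals, hence measurable for the sigma-algebra
    generated by the coordinates; the countably many with rational centre and radius [1 / (k + 1)]
    that lie in [A] cover it. *)
Lemma open_measurable_rV (A : set E) : open A -> measurable A.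
Proof.
move=> oA.
pose F (p : 'rV[rat]_n * nat) : set E :=
  [set x | forall i, ball (ratr (p.1 ord0 i) : R) p.2.+1%:R^-1 (x ord0 i)].
have mF p : measurable (F p).
  apply: (@measurable_coord_set
    (fun i => ball (ratr (p.1 ord0 i) : R) p.2.+1%:R^-1)) => i.
  exact: measurable_ball.
rewrite (_ : A = \bigcup_(p in [set: 'rV[rat]_n * nat])
    (if `[< F p `<=` A >] then F p else set0)).
  apply: countable_bigcupT_measurable => [|p]; first exact: countableP.
  by case: ifP.
apply/seteqP; split => [x Ax|x [p _]]; last first.
  by case: ifPn => // /asboolP; exact.
have : nbhs x A by exact: open_nbhs_nbhs.
rewrite -nbhs_ballE => -[e /= e0 xA].
(* A cube of radius below [e / 2] that contains [x] lies in the [e]-ball around [x]. *)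
have [k ke] : exists k : nat, k.+1%:R^-1 < e / 2.
  have /cvgrPdist_lt := @cvg_harmonic R.
  move=> /(_ (e / 2) (divr_gt0 e0 (ltr0n _ 2))) [k _ /(_ k (leqnn _))].
  by rewrite /= sub0r normrN ger0_norm ?invr_ge0// => ?; exists k.
have k0 : (0 : R) < k.+1%:R^-1 by rewrite invr_gt0.
set r := k.+1%:R^-1 in ke k0 *.
have /choice[q qx] : forall i, exists q : rat,
    `|x ord0 i - ratr q| < r.
  move=> i; have : x ord0 i - r < x ord0 i + r by lra.
  move=> /rat_in_itvoo[q]; rewrite in_itv/= => /andP[q1 q2]; exists q.
  by rewrite ltr_norml; lra.
exists (\row_i q i, k) => //=; case: ifPn => [_ i|/asboolPn[]].
  by rewrite /ball/= mxE distrC.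
move=> y Fy; apply: xA; split=> // j i; rewrite (ord1 j).
have := Fy i; rewrite /ball/= mxE -/r => yq.
rewrite (_ : x ord0 i - _ = (x ord0 i - ratr (q i)) + (ratr (q i) - y ord0 i)).
  by apply: (le_lt_trans (ler_normD _ _)); have := qx i; lra.
by ring.
Qed.

Lemma continuous_measurable_rV (f : E -> R) : continuous f ->
  measurable_fun setT f.
Proof.
move=> /continuousP cf; apply: (measurability _ (RGenOpens.measurableE R)).
move=> _ [_ [a [b ->] <-]]; rewrite setTI; apply: open_measurable_rV.
exact/cf/interval_open.
Qed.

Lemma measurable_box (M : R) : measurable (box M).
Proof.
rewrite (_ : box M = [set x | forall i, [set` `[-M, M]] (x ord0 i)]).
  exact: (@measurable_coord_set (fun=> [set` `[-M, M]])).
by apply/seteqP; split => x /= h i; have := h i; rewrite in_itv/= ler_norml.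
Qed.

Lemma box_lty (M : R) : (lebesgue_rV n (box M) < +oo)%E.
Proof.
rewrite (_ : box M = [set x | forall i, [set` `[-M, M]] (x ord0 i)]).
  rewrite (lebesgue_rV_box (A := fun=> [set` `[-M, M]]))//.
  rewrite ltey_eq; apply/orP; left; elim/big_ind: _ => // [|i _].
    exact: fin_numM.
  by rewrite lebesgue_measure_itv; case: ifP.
by apply/seteqP; split => x /= h i; have := h i; rewrite in_itv/= ler_norml.
Qed.

Lemma compact_box (M : R) : compact (box M).
Proof.
rewrite (_ : box M = [set x | forall i, [set` `[-M, M]] (x ord0 i)]).
  by apply: (@rV_compact _ _ (fun=> `[-M, M]%classic)) => _; exact: segment_compact.
by apply/seteqP; split => x /= h i; have := h i; rewrite in_itv/= ler_norml.
Qed.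

Lemma continuous_box_bounded (f : E -> R) (M : R) : continuous f ->
  exists2 C, 0 <= C & forall x, box M x -> `|f x| <= C.
Proof.
move=> cf.
have : compact [set f x | x in box M].
  by apply: continuous_compact; [exact: continuous_subspaceT|exact: compact_box].
move=> /compact_bounded[C [_ Cf]]; exists (`|C| + 1); first by rewrite addr_ge0.
move=> x Mx; apply: Cf; last by exists x.
by rewrite ltr_pwDr// ler_norm.
Qed.

Lemma bounded_integrable d (T : measurableType d) (mu : {measure set T -> \bar R})
    (D : set T) (f : T -> R) (C : R) : measurable D -> (mu D < +oo)%E ->
  measurable_fun D f -> (forall x, D x -> `|f x| <= C) ->
  mu.-integrable D (EFin \o f).
Proof.
move=> mD Doo mf fC; apply: measurable_bounded_integrable => //.
exists C; split; first by rewrite num_real.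
by move=> M CM x Dx; apply: le_trans (fC x Dx) (ltW CM).
Qed.

Lemma integrable_box (f : E -> R) (M C : R) : measurable_fun setT f ->
  (forall x, box M x -> `|f x| <= C) -> (forall x, ~ box M x -> f x = 0) ->
  (lebesgue_rV n).-integrable setT (EFin \o f).
Proof.
move=> mf fC f0.
rewrite (_ : EFin \o f = (EFin \o f) \_ (box M)).
  apply/(integrable_mkcond _ (measurable_box M)).1.
  apply: bounded_integrable fC; [exact: measurable_box|exact: box_lty|].
  exact: measurable_funTS.
apply/funext => x; rewrite patchE; case: ifPn => // /negP.
by rewrite inE => /f0 /= ->.
Qed.

End MeasurableRn.

(** * Splitting off the first coordinate *)

Section Fubini.
Context {R : realType}.

Lemma rV_consE0 n (p : R * 'rV[R]_n) : rV_cons p ord0 ord0 = p.1.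
Proof. by rewrite mxE unlift_none. Qed.

Lemma rV_consES n (p : R * 'rV[R]_n) i : rV_cons p ord0 (lift ord0 i) = p.2 ord0 i.
Proof. by rewrite mxE liftK. Qed.

Lemma forall_rV_cons n (P : 'I_n.+1 -> R -> Prop) (a : R) (x : 'rV[R]_n) :
  (forall i, P i (rV_cons (a, x) ord0 i)) <->
  P ord0 a /\ forall i, P (lift ord0 i) (x ord0 i).
Proof.
split=> [h|[h0 hS] i].
  split; first by have := h ord0; rewrite rV_consE0.
  by move=> i; have := h (lift ord0 i); rewrite rV_consES.
by case: (unliftP ord0 i) => [j ->|->]; rewrite ?rV_consE0// rV_consES.
Qed.

Lemma box_cons n M (a : R) (x : 'rV[R]_n) :
  box M (rV_cons (a, x)) <-> `|a| <= M /\ box M x.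
Proof. exact: (forall_rV_cons (fun _ t => `|t| <= M)). Qed.

Lemma scale_rV_cons n (c a : R) (x : 'rV[R]_n) :
  c *: rV_cons (a, x) = rV_cons (c * a, c *: x).
Proof.
apply/rowP => i; rewrite mxE.
by case: (unliftP ord0 i) => [j ->|->]; rewrite ?rV_consE0// !rV_consES/= mxE.
Qed.

Lemma ge0_integral_rV_cons n (f : 'rV[R]_n.+1 -> \bar R) :
  measurable_fun setT f -> (forall x, 0 <= f x)%E ->
  (\int[lebesgue_rV n.+1]_x f x =
   \int[lebesgue_measure]_a \int[lebesgue_rV n]_x f (rV_cons (a, x)))%E.
Proof.
move=> mf f0; rewrite /= /lebesgue_cons.
rewrite ge0_integral_pushforward//; last exact: measurable_rV_cons.
rewrite fubini_tonelli1//; last by move=> x; exact: f0.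
exact: (measurableT_comp mf (@measurable_rV_cons R n)).
Qed.

Lemma integral_rV_cons n (f : 'rV[R]_n.+1 -> \bar R) :
  (lebesgue_rV n.+1).-integrable setT f ->
  (\int[lebesgue_rV n.+1]_x f x =
   \int[lebesgue_measure]_a \int[lebesgue_rV n]_x f (rV_cons (a, x)))%E /\
  (\int[lebesgue_rV n.+1]_x f x =
   \int[lebesgue_rV n]_x \int[lebesgue_measure]_a f (rV_cons (a, x)))%E.
Proof.
move=> intf; have mf := measurable_int _ intf.
have mc := @measurable_rV_cons R n.
have intfc : (lebesgue_measure \x lebesgue_rV n)%E.-integrable setT
    (f \o @rV_cons R n).
  apply/integrableP; split; first exact: (measurableT_comp mf mc).
  have /integrableP[_] := intf; rewrite /= /lebesgue_cons.
  rewrite ge0_integral_pushforward//.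
  exact: measurableT_comp.
rewrite /= /lebesgue_cons integral_pushforward//.
by split; [rewrite -integral12_prod_meas1|rewrite -integral21_prod_meas1].
Qed.

End Fubini.

(** * Integrals of partial derivatives and of dilated functions *)

Section Calculus.
Context {R : realType}.

Lemma is_derive_affine (V V' : normedModType R) (g : V -> V') (f : V' -> R)
    (x v : V) (w : V') (d : R) :
  (forall h : R, g (h *: v + x) = h *: w + g x) ->
  is_derive (g x) w f d -> is_derive x v (f \o g) d.
Proof.
move=> gE [df dE].
have e : (fun h : R => h^-1 *: ((f \o shift (g x)) (h *: w) - f (g x))) =
    (fun h : R => h^-1 *: (((f \o g) \o shift x) (h *: v) - (f \o g) x)).
  by apply/funext => h /=; rewrite gE.
split; first by move: df; rewrite /derivable e.
by move: dE; rewrite /derive e.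
Qed.

Local Notation mu := (@lebesgue_measure R).

Lemma integral_derive0 (Q D : R -> R) (M : R) : 0 < M ->
  (forall x : R, is_derive x 1 Q (D x)) -> continuous D ->
  (forall x, M < `|x| -> Q x = 0) -> (forall x, M < `|x| -> D x = 0) ->
  (\int[mu]_x (D x)%:E = 0)%E.
Proof.
move=> M0 QD cD Q0 D0.
have -> : (\int[mu]_x (D x)%:E = \int[mu]_(x in `[(- (M + 1))%R, (M + 1)%R]) (D x)%:E)%E.
  rewrite [RHS]integral_mkcond; apply: eq_integral => x _.
  rewrite patchE; case: ifPn => // /negP; rewrite inE/= in_itv/= => xM.
  rewrite D0// ltNge; apply/negP; rewrite ler_norml => xM'.
  by apply: xM; lra.
have cQ : continuous Q by move=> x; exact: is_derive_continuous (QD x).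
have M1 : M < `|M + 1| by rewrite ger0_norm; lra.
have Q1 : Q (M + 1) = 0 by apply: Q0.
have Q2 : Q (- (M + 1)) = 0 by apply: Q0; rewrite normrN.
rewrite (@continuous_FTC2 _ D Q); last 1 first.
- by move=> x _; rewrite derive1E; apply: derive_val.
- by rewrite Q1 Q2 subee.
- lra.
- exact: continuous_subspaceT.
- split => [x _||]; first by apply: ex_derive.
  + by apply: cvg_at_right_filter; exact: cQ.
  + by apply: cvg_at_left_filter; exact: cQ.
Qed.

Lemma delta_rV_cons0 n : delta_mx ord0 ord0 = rV_cons (1, 0) :> 'rV[R]_n.+1.
Proof.
apply/rowP => i; rewrite mxE eqxx/=.
case: (unliftP ord0 i) => [j ->|->]; rewrite ?rV_consES ?rV_consE0 ?mxE ?eqxx//.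
Qed.

Lemma delta_rV_consS n (j : 'I_n) :
  delta_mx ord0 (lift ord0 j) = rV_cons (0, delta_mx ord0 j) :> 'rV[R]_n.+1.
Proof.
apply/rowP => i; rewrite mxE eqxx/=.
case: (unliftP ord0 i) => [k ->|->]; rewrite ?rV_consES ?rV_consE0 ?mxE ?eqxx//.
Qed.

Lemma add_rV_cons n (a b : R) (x y : 'rV[R]_n) :
  rV_cons (a, x) + rV_cons (b, y) = rV_cons (a + b, x + y).
Proof.
apply/rowP => i; rewrite mxE.
by case: (unliftP ord0 i) => [j ->|->]; rewrite ?rV_consE0// !rV_consES/= mxE.
Qed.

Lemma continuous_rV_cons n (a : R) :
  continuous (fun x : 'rV[R]_n => rV_cons (a, x)).
Proof.
move=> x; have FF : Filter (nbhs x) := nbhs_filter x.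
have := iffRL (@cvg_ballP R _ _ (nbhs x) FF (fun x => rV_cons (a, x)) (rV_cons (a, x))).
apply => e e0.
apply: (@filterS _ (nbhs x) (nbhs_filter x) (ball x e)); last first.
  exact: nbhsx_ballx.
move=> y [_ xy]; split=> // i j; rewrite (ord1 i).
case: (unliftP ord0 j) => [k ->|->]; rewrite ?rV_consES ?rV_consE0//=.
exact: ballxx.
Qed.

Lemma continuous_rV_consl n (x : 'rV[R]_n) :
  continuous (fun a : R => rV_cons (a, x)).
Proof.
move=> a; apply/cvg_ballP => e e0.
apply: (@filterS _ (nbhs a) (nbhs_filter a) (ball a e)); last first.
  exact: nbhsx_ballx.
move=> b ab; split=> // i j; rewrite (ord1 i).
case: (unliftP ord0 j) => [k ->|->]; rewrite ?rV_consES ?rV_consE0//=.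
exact: ballxx.
Qed.

(** Fubini with the first coordinate split off. If [i] is that coordinate, the inner integral is the
    one-variable [integral_derive0]; otherwise every slice is covered by the induction
    hypothesis. *)
Lemma integral_partial0 n (i : 'I_n) (Q D : 'rV[R]_n -> R) (M : R) : 0 < M ->
  (forall x, is_derive x (delta_mx ord0 i) Q (D x)) -> continuous D ->
  (forall x, ~ box M x -> Q x = 0) -> (forall x, ~ box M x -> D x = 0) ->
  (\int[lebesgue_rV n]_x (D x)%:E = 0)%E.
Proof.
move=> M0; elim: n i Q D => [[]//|n IH] i Q D QD cD Q0 D0.
have [C C0 DC] := continuous_box_bounded M cD.
have iD : (lebesgue_rV n.+1).-integrable setT (EFin \o D).
  by apply: (integrable_box (M := M)) DC D0; exact: continuous_measurable_rV.
have [e1 e2] := integral_rV_cons iD.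
case: (unliftP ord0 i) => [j|] ij; subst i.
- rewrite e1 integral0_eq// => a _ /=.
  apply: (IH j (fun x => Q (rV_cons (a, x)))) => [x|x|x nx|x nx].
  + apply: (@is_derive_affine _ _ (fun x => rV_cons (a, x)) Q) (QD _) => h.
    by rewrite delta_rV_consS scale_rV_cons add_rV_cons mulr0 add0r.
  + exact: continuous_comp (@continuous_rV_cons _ _ _) (cD _).
  + by apply: Q0 => /box_cons[].
  + by apply: D0 => /box_cons[].
- rewrite e2 integral0_eq// => x _ /=.
  apply: (@integral_derive0 (fun a => Q (rV_cons (a, x))) _ M) => [//|a|a|a aM|a aM].
  + apply: (@is_derive_affine _ _ (fun a => rV_cons (a, x)) Q) (QD _) => h.
    by rewrite delta_rV_cons0 scale_rV_cons add_rV_cons scaler0 add0r.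
  + exact: continuous_comp (@continuous_rV_consl _ _ _) (cD _).
  + by apply: Q0 => /box_cons[]; rewrite leNgt aM.
  + by apply: D0 => /box_cons[]; rewrite leNgt aM.
Qed.

(** Uniqueness of Lebesgue measure: [c] times its image under multiplication by [c] gives the right
    length to every half-open interval. *)
Lemma ge0_integral_dilation1 (c : R) (f : R -> \bar R) : 0 < c ->
  measurable_fun setT f -> (forall x, 0 <= f x)%E ->
  (\int[mu]_x f (c * x)%R = (c^-1)%:E * \int[mu]_x f x)%E.
Proof.
move=> c0 mf f0.
have mc : measurable_fun [set: measurableTypeR R] (fun x : measurableTypeR R => c * x : measurableTypeR R).
  exact: mulrl_measurable.
have k0 : 0 <= c by exact: ltW.
pose m' : {measure set (measurableTypeR R) -> \bar R} :=
  mscale (NngNum k0)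
    (pushforward mu (fun x : measurableTypeR R => c * x : measurableTypeR R)).
pose m := m' mc.
have mE A : measurable A -> mu A = m A.
  apply: lebesgue_measure_unique => X [[a b]] _ <-.
  rewrite /m/m'/= /mscale/= /pushforward.
  rewrite (_ : _ @^-1` _ = `]a / c, b / c]%classic).
    rewrite !lebesgue_measure_itv/= !lte_fin ltr_pM2r ?invr_gt0//.
    case: ifPn => _; last by rewrite mule0.
    by rewrite -EFinM; congr EFin; field; rewrite gt_eqF.
  apply/seteqP; split => x /=; rewrite !in_itv/= ltr_pdivrMr// ler_pdivlMr//;
    by rewrite (mulrC x).
have -> : (\int[mu]_x f x = \int[m]_x f x)%E.
  by apply: eq_measure_integral => A mA _; exact: mE.
rewrite /m/m' ge0_integral_mscale//= ge0_integral_pushforward//.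
by rewrite muleA -EFinM mulVf ?gt_eqF// mul1e.
Qed.

Lemma scale_rV_measurable n (c : R) :
  measurable_fun [set: 'rV[R]_n] (fun x : 'rV[R]_n => c *: x).
Proof.
apply: measurable_fun_rVP => i.
rewrite (_ : (fun t => _) = (fun t : 'rV[R]_n => c * rV_coord i t)).
  apply: measurable_funM; [exact: measurable_cst|exact: measurable_rV_coord].
by apply/funext => x; rewrite mxE.
Qed.

Lemma ge0_integral_dilation n (c : R) (f : 'rV[R]_n -> \bar R) : 0 < c ->
  measurable_fun setT f -> (forall x, 0 <= f x)%E ->
  (\int[lebesgue_rV n]_x f (c *: x)%R =
   (c ^- n)%R%:E * \int[lebesgue_rV n]_x f x)%E.
Proof.
move=> c0; elim: n f => [|n IH] f mf f0.
  rewrite expr0 invr1 mul1e; apply: eq_integral => x _.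
  by congr f; apply/rowP => -[].
have mfc : measurable_fun setT (fun x : 'rV[R]_n.+1 => f (c *: x)).
  exact: (measurableT_comp mf (@scale_rV_measurable _ c)).
have mcons := @measurable_rV_cons R n.
have mf2 : measurable_fun setT (fun p : R * 'rV[R]_n => f (rV_cons p)).
  exact: (measurableT_comp mf mcons).
have mF : measurable_fun setT (fun a => (\int[lebesgue_rV n]_x f (rV_cons (a, x)))%E).
  exact: (measurable_fun_fubini_tonelli_F (fun p => f (rV_cons p))).
rewrite !ge0_integral_rV_cons//.
under eq_integral do under eq_integral do rewrite scale_rV_cons.
under eq_integral => a _.
  rewrite (IH (fun x => f (rV_cons (c * a, x))))//; last first.
    exact: (measurableT_comp mf2 (pair1_measurable _)).
  over.
rewrite (ge0_integralZl _ measurableT); last 3 first.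
- apply: (measurableT_comp mF (mulrl_measurable _)).
- by move=> a _; exact: integral_ge0.
- by rewrite lee_fin invr_ge0 exprn_ge0// ltW.
rewrite (@ge0_integral_dilation1 c (fun a => \int[lebesgue_rV n]_x f (rV_cons (a, x)))%E)//.
  by rewrite muleA -EFinM exprSr invfM.
by move=> a; exact: integral_ge0.
Qed.

End Calculus.

(** * Radial functions of class C^2 *)

Section ContinuousOperations.
Context {R : realType} (T : topologicalType).
Implicit Types f g : T -> R.

Lemma continuous_mul f g : continuous f -> continuous g ->
  continuous (fun x => f x * g x).
Proof. by move=> cf cg x; apply: cvgM; [exact: cf|exact: cg]. Qed.

Lemma continuous_add f g : continuous f -> continuous g ->
  continuous (fun x => f x + g x).
Proof. by move=> cf cg x; apply: cvgD; [exact: cf|exact: cg]. Qed.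

Lemma continuous_sub f g : continuous f -> continuous g ->
  continuous (fun x => f x - g x).
Proof. by move=> cf cg x; apply: cvgB; [exact: cf|exact: cg]. Qed.

Lemma continuous_cst (c : R) : continuous (fun _ : T => c).
Proof. by move=> x; exact: cvg_cst. Qed.

Lemma continuous_div f g x : {for x, continuous f} -> {for x, continuous g} ->
  g x != 0 -> {for x, continuous (fun y => f y / g y)}.
Proof. by move=> cf cg gx; apply: cvgM => //; exact: cvgV. Qed.

Lemma continuous_compr f (h : R -> R) : continuous f -> continuous h ->
  continuous (fun x => h (f x)).
Proof. by move=> cf ch x; apply: continuous_comp; [exact: cf|exact: ch]. Qed.

Lemma continuous_squeeze0 f g x : (forall y, `|f y| <= `|g y|) -> g x = 0 ->
  {for x, continuous g} -> {for x, continuous f}.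
Proof.
move=> fg gx0 cg; have fx0 : f x = 0.
  by apply/eqP; rewrite -normr_le0 (le_trans (fg x))// gx0 normr0.
rewrite /prop_for /continuous_at fx0; apply/cvgr0Pnorm_le => e e0.
rewrite /prop_for /continuous_at gx0 in cg.
have h : \forall y \near x, `|g y| <= e by exact: (cvgr0_norm_le _ cg).
by near=> y; apply: le_trans (fg y) _; near: y.
Unshelve. all: by end_near.
Qed.

End ContinuousOperations.

Lemma continuous_sumr {R : realType} (T : topologicalType) (I : Type)
    (s : seq I) (F : I -> T -> R) : (forall i, continuous (F i)) ->
  continuous (fun x => \sum_(i <- s) F i x).
Proof.
move=> cF; elim: s => [|i s IH] x.
  by rewrite (_ : (fun _ => _) = cst 0); [exact: cvg_cst|apply/funext => y; rewrite big_nil].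
rewrite (_ : (fun _ => _) = (fun y => F i y + \sum_(j <- s) F j y)).
  by apply: cvgD; [exact: cF|exact: IH].
by apply/funext => y; rewrite big_cons.
Qed.

(** * Partial derivatives and the Euclidean norm *)

Section DirectionalDerivatives.
Context {R : realType} (N : nat).
Local Notation E := 'rV[R]_N.
Implicit Types (f g p : E -> R) (x : E).
Local Notation e_ i := (delta_mx ord0 i : E).

Lemma is_derive_lineP f x (v : E) (d : R) :
  is_derive (0 : R) 1 (fun h : R => f (h *: v + x)) d <-> is_derive x v f d.
Proof.
have e : (fun h : R => h^-1 *: (((fun h : R => f (h *: v + x)) \o shift 0) (h *: 1)
      - f (0 *: v + x))) =
    (fun h : R => h^-1 *: ((f \o shift x) (h *: v) - f x)).
  by apply/funext => h /=; rewrite addr0 scale0r add0r [h *: 1]mulr1.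
by split=> -[df dE]; split; move: df dE; rewrite /derivable /derive e.
Qed.

Lemma continuous_coord (i : 'I_N) : continuous (fun x => x ord0 i).
Proof. exact: coord_continuous. Qed.

Lemma is_derive_coord (i j : 'I_N) x :
  is_derive x (e_ j) (fun y => y ord0 i) (i == j)%:R.
Proof.
apply/is_derive_lineP.
rewrite (_ : (fun h : R => _) = (fun h : R => h * (i == j)%:R + x ord0 i)).
  apply: is_derive_eq; rewrite addr0 /GRing.scale/= mulr1 mulr0 add0r//.
by apply/funext => h; rewrite !mxE.
Qed.

Definition sqnorm x : R := \sum_(i < N) x ord0 i ^+ 2.

Lemma sqnorm_ge0 x : 0 <= sqnorm x.
Proof. by apply: sumr_ge0 => i _; exact: sqr_ge0. Qed.

Lemma enorm_ge0 x : 0 <= enorm x.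
Proof. exact: sqrtr_ge0. Qed.

Lemma sqr_enorm x : enorm x ^+ 2 = sqnorm x.
Proof. by rewrite sqr_sqrtr// sqnorm_ge0. Qed.

Lemma enorm0 : enorm (0 : E) = 0.
Proof.
by rewrite /enorm big1 ?sqrtr0// => i _; rewrite mxE expr0n.
Qed.

Lemma enormZ (c : R) x : enorm (c *: x) = `|c| * enorm x.
Proof.
rewrite /enorm -sqrtr_sqr -sqrtrM ?sqr_ge0//; congr Num.sqrt.
by rewrite mulr_sumr; apply: eq_bigr => i _; rewrite mxE exprMn.
Qed.

Lemma enorm_eq0 x : (enorm x == 0) = (x == 0).
Proof.
apply/idP/idP => [|/eqP->]; last by rewrite enorm0.
rewrite sqrtr_eq0 => x0; apply/eqP/rowP => i; rewrite mxE.
have : sqnorm x == 0 by rewrite eq_le x0 sqnorm_ge0.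
rewrite psumr_eq0; last by move=> j _; exact: sqr_ge0.
by move=> /allP/(_ i (mem_index_enum _)); rewrite sqrf_eq0 => /eqP.
Qed.

Lemma coord_le_enorm x i : `|x ord0 i| <= enorm x.
Proof.
rewrite -sqrtr_sqr ler_wsqrtr// (bigD1 i)//= lerDl.
by apply: sumr_ge0 => j _; exact: sqr_ge0.
Qed.

Lemma sqnorm_line (i : 'I_N) x (h : R) :
  sqnorm (h *: e_ i + x) = sqnorm x + (2 * x ord0 i * h + h ^+ 2).
Proof.
rewrite /sqnorm (bigD1 i)//= [in RHS](bigD1 i)//= !mxE !eqxx mulr1.
rewrite (eq_bigr (fun j => x ord0 j ^+ 2)); first ring.
by move=> j ji; rewrite !mxE (negbTE ji) mulr0 add0r.
Qed.

Lemma sqnorm_continuous : continuous sqnorm.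
Proof.
apply: continuous_sumr => i.
exact: continuous_compr (@continuous_coord i) (@exprn_continuous _ 2).
Qed.

Lemma enorm_continuous : continuous (@enorm R N).
Proof.
exact: (continuous_compr sqnorm_continuous (@sqrt_continuous R)).
Qed.

(** Chain rule through the squared norm, a polynomial on every line, because the norm itself is not
    differentiable at the origin. *)
Lemma is_derive_sqnorm_comp (F : R -> R) (d : R) (i : 'I_N) x :
  is_derive (sqnorm x) 1 F d ->
  is_derive x (e_ i) (F \o sqnorm) (d * (2 * x ord0 i)).
Proof.
move=> Fd; apply/is_derive_lineP.
pose q (h : R) : R := sqnorm x + (2 * x ord0 i * h + h ^+ 2).
rewrite (_ : (fun h : R => _) = F \o q); last first.
  by apply/funext => h /=; rewrite sqnorm_line.
have q0 : q 0 = sqnorm x by rewrite /q mulr0 expr0n !addr0.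
rewrite -q0 in Fd.
have dq : is_derive (0 : R) 1 q (2 * x ord0 i).
  rewrite /q; have h2 := is_derive_expn 2 (0 : R).
  apply: is_derive_eq; rewrite /GRing.scale/= !mulr0; ring.
exact: (@is_derive1_comp _ F q 0 _ _ Fd dq).
Qed.

(** The difference quotient at 0 is [g h] itself, so continuity of [g] suffices. This serves at the
    two delicate points: the Hessian at the origin and [pospart x ^+ 2] at 0. *)
Lemma is_derive_continuous_mul0 (g : R -> R) : {for 0, continuous g} ->
  is_derive (0 : R) 1 (fun h => h * g h) (g 0).
Proof.
move=> g0.
have h : h^-1 *: (((fun h => h * g h) \o shift 0) (h *: 1) - 0 * g 0)
    @[h --> (0 : R)^'] --> g 0.
  apply: cvg_trans (cvg_within_filter _ g0).
  apply: near_eq_cvg; near=> h => /=.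
  have h0 : h != 0 by near: h; exact: nbhs_dnbhs_neq.
  by rewrite [h *: 1]mulr1 addr0 mul0r subr0 scalerA mulVf// scale1r.
split; first by apply/cvg_ex; exists (g 0).
exact: cvg_lim h.
Unshelve. all: by end_near. Qed.

Lemma C1_partial p (dp : 'I_N -> E -> R) : continuous p ->
  (forall i x, is_derive x (e_ i) p (dp i x)) ->
  (forall i, continuous (dp i)) -> C1 p /\ forall i, partial i p = dp i.
Proof.
move=> cp dE cdp.
have e i : partial i p = dp i by apply/funext => x; exact: derive_val.
by split=> //; split=> // i; split; [move=> x; exact: ex_derive|rewrite e].
Qed.

Lemma C1_continuous p : C1 p -> continuous p.
Proof. by case. Qed.

Lemma C1_is_derive p i x : C1 p -> is_derive x (e_ i) p (partial i p x).
Proof. by case=> _ /(_ i)[/(_ x) h _]; exact: derivableP. Qed.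

Lemma continuous_partial p i : C1 p -> continuous (partial i p).
Proof. by case=> _ /(_ i)[]. Qed.

Lemma C1M p f : C1 p -> C1 f -> C1 (fun x => p x * f x) /\
  forall i, partial i (fun x => p x * f x) =
            fun x => p x * partial i f x + f x * partial i p x.
Proof.
move=> cp cf.
have cp' := C1_continuous cp; have cf' := C1_continuous cf.
apply: C1_partial => [|i x|i].
- exact: continuous_mul.
- have h1 := C1_is_derive i x cp; have h2 := C1_is_derive i x cf.
  exact: is_deriveM.
- by apply: continuous_add; apply: continuous_mul => //; exact: continuous_partial.
Qed.

End DirectionalDerivatives.

(** * Gradient and Hessian of a radial function *)

Section RadialC2.
Context {R : realType} (N : nat) (N0 : (0 < N)%N) (k : R -> R) (ck : continuous k).
Local Notation E := 'rV[R]_N.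
Implicit Types (x : E).
Local Notation w := (rmean N k).

Definition radial_fun (d : R) x : R := d + green N k (enorm x).

Definition radial_grad (i : 'I_N) x : R := x ord0 i * w (enorm x).

(** The second term is [x_i * x_j * w' / r], with [w'] eliminated by [r * w' = k - N * w]. At the
    origin the factors [x_i * x_j] make it 0, which is also its limit. *)
Definition radial_hess (i j : 'I_N) x : R :=
  (i == j)%:R * w (enorm x)
  + x ord0 i * x ord0 j * (k (enorm x) - N%:R * w (enorm x)) / enorm x ^+ 2.

Lemma continuous_rmean_enorm : continuous (fun x => w (enorm x)).
Proof.
by apply: continuous_compr; [exact: enorm_continuous|exact: rmean_continuous].
Qed.

Lemma radial_fun_C1 d : C1 (radial_fun d) /\
  forall i, partial i (radial_fun d) = radial_grad i.
Proof.
apply: C1_partial => [|i x|i].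
- apply: continuous_add; first exact: continuous_cst.
  by apply: continuous_compr; [exact: enorm_continuous|exact: green_continuous].
- pose F (s : R) := d + primitive (fun s => w (Num.sqrt s) / 2) s.
  rewrite (_ : radial_fun d = F \o @sqnorm R N); last first.
    by apply/funext => y; rewrite /radial_fun /F /= -sqr_enorm.
  have h : is_derive (sqnorm x) 1 F (w (Num.sqrt (sqnorm x)) / 2).
    have h1 : -1 < sqnorm x by apply: lt_le_trans (sqnorm_ge0 x); lra.
    have h2 := is_derive_primitive (continuous_rmean_sqrt N0 ck) h1.
    have h3 := is_deriveD (is_derive_cst d (sqnorm x) (1 : R)) h2.
    by rewrite add0r in h3.
  apply: is_derive_eq; first exact: is_derive_sqnorm_comp h.
  by rewrite /radial_grad /enorm -/(sqnorm x); field.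
- by apply: continuous_mul; [exact: continuous_coord|exact: continuous_rmean_enorm].
Qed.

Lemma is_derive_radial_grad i j x :
  is_derive x (delta_mx ord0 j) (radial_grad i) (radial_hess i j x).
Proof.
have [->|x0] := eqVneq x 0.
  (* At the origin: along the [j]-th axis the [i]-th component is [h] times a continuous function of
     [h], as [w] is even. *)
  apply/is_derive_lineP.
  rewrite (_ : (fun h : R => _) = (fun h => h * ((i == j)%:R * w h))); last first.
    apply/funext => h; rewrite addr0 /radial_grad !mxE/= -mulrA; congr (_ * (_ * _)).
    rewrite -[RHS](@rmean_norm _ N); congr (rmean _ _ _).
    rewrite enormZ -[RHS]mulr1; congr (_ * _).
    rewrite /enorm (bigD1 j)//= mxE !eqxx expr1n big1 ?addr0 ?sqrtr1//.
    by move=> l lj; rewrite mxE (negbTE lj) andbF expr0n.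
  have -> : radial_hess i j 0 = (i == j)%:R * w 0.
    by rewrite /radial_hess !mxE enorm0 !mul0r addr0.
  apply: (is_derive_continuous_mul0 (g := fun h => (i == j)%:R * w h)).
  by apply: cvgM; [exact: cvg_cst|exact: rmean_continuous].
have r0 : 0 < enorm x by rewrite lt_def enorm_ge0 enorm_eq0 x0.
have s0 : 0 < sqnorm x by rewrite -sqr_enorm exprn_gt0.
have h1 : is_derive (sqnorm x) 1 (w \o Num.sqrt)
    ((k (enorm x) - N%:R * w (enorm x)) / enorm x * (2 * enorm x)^-1).
  apply: is_derive1_comp.
    exact: is_derive_rmean.
  exact: is_derive1_sqrt.
have h2 := is_derive_sqnorm_comp j h1.
have h3 := is_derive_coord i j x.
have h4 := is_deriveM h3 h2.
apply: (is_derive_eq h4).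
rewrite /GRing.scale/= /radial_hess -/(enorm x).
by field; rewrite gt_eqF.
Qed.

(** Since [|x_i * x_j| <= |x|^2], the second term is dominated by [k - N * w], which vanishes at the
    origin because [w 0 = k 0 / N]. *)
Lemma continuous_radial_hess i j : continuous (radial_hess i j).
Proof.
have cg : continuous (fun x : E => k (enorm x) - N%:R * w (enorm x)).
  apply: continuous_sub.
    by apply: continuous_compr => //; exact: enorm_continuous.
  by apply: continuous_mul; [exact: continuous_cst|exact: continuous_rmean_enorm].
apply: continuous_add.
  by apply: continuous_mul; [exact: continuous_cst|exact: continuous_rmean_enorm].
move=> x; have [->|x0] := eqVneq x 0; last first.
  have h := continuous_mul (@continuous_coord R N i) (@continuous_coord R N j).
  have h1 := continuous_mul h cg.
  have h2 := continuous_compr (@enorm_continuous R N) (@exprn_continuous R 2).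
  have h3 : enorm x ^+ 2 != 0 by rewrite expf_neq0// enorm_eq0.
  exact: (continuous_div (h1 x) (h2 x) h3).
apply: (continuous_squeeze0 _ _ (cg 0)) => [y|]; last first.
  rewrite enorm0 /rmean eqxx mulrCA divff ?mulr1 ?subrr//.
  by rewrite pnatr_eq0 -lt0n.
have [->|y0] := eqVneq y 0; first by rewrite mxE !mul0r normr0.
rewrite mulrAC normrM ler_piMl// normrM normfV normrM.
have r0 : 0 < `|enorm y ^+ 2| by rewrite normr_gt0 expf_neq0// enorm_eq0.
rewrite ler_pdivrMr// mul1r normrX expr2 (ger0_norm (enorm_ge0 y)).
by apply: ler_pM => //; exact: coord_le_enorm.
Qed.

Lemma radial_grad_C1 i : C1 (radial_grad i) /\
  forall j, partial j (radial_grad i) = radial_hess i j.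
Proof.
apply: C1_partial => [|j x|j].
- by apply: continuous_mul; [exact: continuous_coord|exact: continuous_rmean_enorm].
- exact: is_derive_radial_grad.
- exact: continuous_radial_hess.
Qed.

Lemma radial_laplacian x : \sum_(i < N) radial_hess i i x = k (enorm x).
Proof.
rewrite /radial_hess big_split/=.
rewrite (eq_bigr (fun=> w (enorm x))); last by move=> i _; rewrite eqxx mul1r.
rewrite sumr_const card_ord -!mulr_suml.
rewrite (_ : \sum_(i < N) _ = enorm x ^+ 2); last first.
  by rewrite sqr_enorm; apply: eq_bigr => i _; rewrite expr2.
have [x0|x0] := eqVneq (enorm x) 0.
  rewrite x0 expr0n/= !mul0r addr0 /rmean eqxx -[LHS]mulr_natl.
  rewrite mulrCA divff ?mulr1//.
  by rewrite pnatr_eq0 -lt0n.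
by rewrite -[X in X + _]mulr_natl; field.
Qed.

End RadialC2.

(** * Cutoff functions and L^2 limits *)

Section Cutoff.
Context {R : realType}.
Implicit Types (d s t : R).

Definition pospart t : R := Num.max t 0.

Lemma pospart_ge0 t : 0 <= pospart t.
Proof. by rewrite /pospart le_max lexx orbT. Qed.

Lemma pospart_pos t : 0 <= t -> pospart t = t.
Proof. by move=> t0; rewrite /pospart; apply/max_idPl. Qed.

Lemma pospart_neg t : t <= 0 -> pospart t = 0.
Proof. by move=> t0; rewrite /pospart; apply/max_idPr. Qed.

Lemma pospart_continuous : continuous pospart.
Proof.
move=> t; apply: (@continuous_max _ _ idfun (cst 0)) => //.
exact: cvg_cst.
Qed.

Lemma is_derive_pospart_sqr t :
  is_derive t 1 (fun x => pospart x ^+ 2) (2 * pospart t).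
Proof.
have [t0|t0|->] := ltgtP t 0.
- rewrite pospart_neg ?ltW// mulr0.
  apply: (@near_eq_is_derive _ _ _ (cst 0)).
  near=> x; rewrite pospart_neg ?expr0n//.
  by apply: ltW; near: x; exact: lt_nbhsl.
- rewrite pospart_pos ?ltW//.
  apply: (near_eq_is_derive _ (is_derive_expn 2 t)).
  near=> x; rewrite pospart_pos//.
  by apply: ltW; near: x; exact: lt_nbhsr.
- rewrite (_ : (fun x => _) = (fun x => x * pospart x)); last first.
    apply/funext => x; have [x0|x0] := leP 0 x; first by rewrite pospart_pos// expr2.
    by rewrite pospart_neg ?ltW// expr0n mulr0.
  have := is_derive_continuous_mul0 (@pospart_continuous 0).
  by rewrite pospart_pos// mulr0.
Unshelve. all: by end_near. Qed.

(* [cutoff d] is a C^1 cutoff of [s < 1] which vanishes for [1 - d <= s]. It is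
   rational rather than polynomial, so that both [cutoff d --> 1] and the bound
   [cutoff_slope_le], uniform in [d], are elementary. *)
Definition cutoff d s : R :=
  pospart (1 - d - s) ^+ 2 / (d ^+ 2 + pospart (1 - d - s) ^+ 2).

Definition cutoff_slope d s : R :=
  2 * pospart (1 - d - s) * d ^+ 2 / (d ^+ 2 + pospart (1 - d - s) ^+ 2) ^+ 2.

Let den_gt0 d s : 0 < d -> 0 < d ^+ 2 + pospart (1 - d - s) ^+ 2.
Proof. by move=> d0; rewrite ltr_pwDl ?exprn_gt0 ?sqr_ge0. Qed.

Lemma is_derive_cutoff d s : 0 < d ->
  is_derive s 1 (cutoff d) (- cutoff_slope d s).
Proof.
move=> d0; pose P (s : R) := pospart (1 - d - s) ^+ 2.
have dl : is_derive s 1 (fun s : R => 1 - d - s) (-1).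
  by apply: is_derive_eq; ring.
have dP : is_derive s 1 P (2 * pospart (1 - d - s) * -1).
  exact: (@is_derive1_comp _ _ (fun s : R => 1 - d - s) s _ _
    (is_derive_pospart_sqr _) dl).
have dD : is_derive s 1 (fun s => d ^+ 2 + P s) (2 * pospart (1 - d - s) * -1).
  have := is_deriveD (is_derive_cst (d ^+ 2) s (1 : R)) dP.
  by rewrite add0r.
have D0 : d ^+ 2 + P s != 0 by rewrite gt_eqF// den_gt0.
have dV := @is_deriveV _ (fun s => d ^+ 2 + P s) _ _ _ D0 dD.
apply: (is_derive_eq (is_deriveM dP dV)).
rewrite /GRing.scale/= /cutoff_slope -/(P s); field.
by rewrite gt_eqF// den_gt0.
Qed.

Lemma cutoff_out d s : 1 - d <= s -> cutoff d s = 0.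
Proof. by move=> ds; rewrite /cutoff pospart_neg; [rewrite expr0n mul0r|lra]. Qed.

Lemma cutoff_slope_out d s : 1 - d <= s -> cutoff_slope d s = 0.
Proof.
by move=> ds; rewrite /cutoff_slope pospart_neg; [rewrite mulr0 !mul0r|lra].
Qed.

Lemma cutoff_ge0 d s : 0 <= cutoff d s.
Proof. by rewrite divr_ge0 ?addr_ge0 ?sqr_ge0. Qed.

Lemma cutoff_le1 d s : 0 < d -> cutoff d s <= 1.
Proof.
by move=> d0; rewrite ler_pdivrMr ?den_gt0// mul1r lerDr sqr_ge0.
Qed.

Lemma cutoff_slope_ge0 d s : 0 <= cutoff_slope d s.
Proof.
by rewrite divr_ge0 ?sqr_ge0// mulr_ge0 ?sqr_ge0// mulr_ge0 ?pospart_ge0.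
Qed.

(** With [y = 1 - d - s > 0] the claim is [2 * y * d ^+ 2 * (y + d) <= 2 * (d ^+ 2 + y ^+ 2) ^+ 2].
    Both sides are homogeneous of degree 4 in [d] and [y], which is why the bound does not depend on
    [d]. *)
Lemma cutoff_slope_le d s : 0 < d -> (1 - s) * cutoff_slope d s <= 2.
Proof.
move=> d0; have [ds|sd] := leP (1 - d) s.
  by rewrite cutoff_slope_out// mulr0.
rewrite /cutoff_slope mulrA ler_pdivrMr ?exprn_gt0 ?den_gt0//.
rewrite pospart_pos; last lra.
set y := 1 - d - s; have -> : 1 - s = y + d by rewrite /y; ring.
have y0 : 0 < y by rewrite /y; lra.
have : 0 <= (d ^+ 2 - y ^+ 2) ^+ 2 by exact: sqr_ge0.
have h1 : 0 <= d ^+ 2 * (y - d) ^+ 2 by rewrite mulr_ge0// sqr_ge0.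
have h2 : 0 <= y ^+ 4 by rewrite exprn_ge0// ltW.
have h3 : 0 <= y ^+ 2 * d ^+ 2 by rewrite mulr_ge0// sqr_ge0.
have h4 : 0 <= d ^+ 4 by rewrite exprn_ge0// ltW.
move=> h5; rewrite -subr_ge0.
have -> : 2 * (d ^+ 2 + y ^+ 2) ^+ 2 - (y + d) * (2 * y * d ^+ 2) =
  d ^+ 2 * (y - d) ^+ 2 + d ^+ 4 + y ^+ 2 * d ^+ 2 + y ^+ 4 + y ^+ 4 by ring.
lra.
Qed.

Lemma cutoff_slope_bounded d s : 0 < d -> `|cutoff_slope d s| <= 2 / d.
Proof.
move=> d0; rewrite ger0_norm ?cutoff_slope_ge0//.
have [ds|sd] := leP (1 - d) s.
  by rewrite cutoff_slope_out// divr_ge0// ltW.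
rewrite ler_pdivlMr// mulrC; apply: le_trans (cutoff_slope_le s d0).
by rewrite ler_wpM2r ?cutoff_slope_ge0//; lra.
Qed.

Lemma cutoff_continuous d : 0 < d -> continuous (cutoff d).
Proof. by move=> d0 s; exact: is_derive_continuous (is_derive_cutoff s d0). Qed.

Lemma cutoff_slope_continuous d : 0 < d -> continuous (cutoff_slope d).
Proof.
move=> d0.
have cp : continuous (fun s => pospart (1 - d - s)).
  apply: (@continuous_compr _ _ (fun s => 1 - d - s)).
    apply: (@continuous_sub _ _ (fun=> 1 - d) id); first exact: continuous_cst.
    by move=> s; exact: cvg_id.
  exact: pospart_continuous.
have cD : continuous (fun s => d ^+ 2 + pospart (1 - d - s) ^+ 2).
  apply: continuous_add; first exact: continuous_cst.
  exact: continuous_compr cp (@exprn_continuous _ 2).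
move=> s; apply: (@continuous_div _ _
  (fun s => 2 * pospart (1 - d - s) * d ^+ 2)
  (fun s => (d ^+ 2 + pospart (1 - d - s) ^+ 2) ^+ 2)).
- apply: continuous_mul (@continuous_cst _ _ _) _.
  exact: continuous_mul (@continuous_cst _ _ _) cp.
- exact: (continuous_compr cD (@exprn_continuous _ 2)).
- by rewrite expf_neq0// gt_eqF// den_gt0.
Qed.

Lemma harmonic_gt0 n : 0 < harmonic n :> R.
Proof. by rewrite /harmonic/= invr_gt0. Qed.

Let cvg_pospart s : s < 1 ->
  pospart (1 - harmonic n - s) @[n --> \oo] --> 1 - s.
Proof.
move=> s1; rewrite -[X in _ --> X]pospart_pos; last lra.
apply: continuous_cvg; first exact: pospart_continuous.
rewrite -[X in _ --> X - _](subr0 1); apply: cvgB; last exact: cvg_cst.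
by apply: cvgB; [exact: cvg_cst|exact: cvg_harmonic].
Qed.

Let cvg_sqr (u : nat -> R) (l : R) : u n @[n --> \oo] --> l ->
  u n ^+ 2 @[n --> \oo] --> l ^+ 2.
Proof. by move=> ul; rewrite expr2; apply: cvgM. Qed.

Let cvg_den s : s < 1 ->
  harmonic n ^+ 2 + pospart (1 - harmonic n - s) ^+ 2 @[n --> \oo] -->
  0 ^+ 2 + (1 - s) ^+ 2.
Proof.
move=> s1; apply: cvgD; apply: cvg_sqr; first exact: cvg_harmonic.
exact: cvg_pospart.
Qed.

Let den_neq0 s : s < 1 -> 0 ^+ 2 + (1 - s) ^+ 2 != 0.
Proof. by move=> s1; rewrite expr0n add0r expf_neq0// gt_eqF//; lra. Qed.

Lemma cvg_cutoff s : s < 1 -> cutoff (harmonic n) s @[n --> \oo] --> (1 : R).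
Proof.
move=> s1; rewrite (_ : 1 = (1 - s) ^+ 2 / (0 ^+ 2 + (1 - s) ^+ 2)); last first.
  by rewrite expr0n add0r divff// expf_neq0// gt_eqF//; lra.
apply: cvgM; first exact/cvg_sqr/cvg_pospart.
by apply: cvgV; [exact: den_neq0|exact: cvg_den].
Qed.

Lemma cvg_cutoff_slope s : s < 1 ->
  cutoff_slope (harmonic n) s @[n --> \oo] --> (0 : R).
Proof.
move=> s1.
rewrite (_ : 0 = 2 * (1 - s) * 0 ^+ 2 / (0 ^+ 2 + (1 - s) ^+ 2) ^+ 2); last first.
  by rewrite expr0n mulr0 mul0r.
apply: cvgM.
  apply: cvgM; last exact/cvg_sqr/cvg_harmonic.
  by apply: cvgM; [exact: cvg_cst|exact: cvg_pospart].
by apply: cvgV; [rewrite expf_neq0// den_neq0|exact/cvg_sqr/cvg_den].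
Qed.

End Cutoff.

(** * Limits of integrals over a set of finite measure *)

Section Integration.
Context d (T : measurableType d) {R : realType}.
Variables (mu : {measure set T -> \bar R}) (D : set T).
Hypotheses (mD : measurable D) (Doo : (mu D < +oo)%E).
Implicit Types (f g : T -> R).
Local Notation integrable f := (mu.-integrable D (EFin \o f)).

Lemma integrable_measurable f : integrable f -> measurable_fun D f.
Proof. by move=> /measurable_int/measurable_EFinP. Qed.

Lemma integrable_le f g : measurable_fun D f -> integrable g ->
  (forall x, D x -> `|f x| <= g x) -> integrable f.
Proof.
move=> mf ig fg; apply: (le_integrable mD _ _ ig); first exact/measurable_EFinP.
by move=> x Dx /=; rewrite lee_fin (le_trans (fg x Dx))// ler_norm.
Qed.

Lemma integrable_mul_bounded f g (C : R) : integrable f -> measurable_fun D g ->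
  (forall x, D x -> `|g x| <= C) -> integrable (fun x => f x * g x).
Proof.
move=> fi mg gC; apply: (@integrable_le _ (fun x => C * `|f x|)).
- by apply: measurable_funM => //; exact: integrable_measurable.
- have /(integrableZl mD C) := integrable_norm fi.
  by apply: eq_integrable => // x _.
- by move=> x Dx; rewrite normrM mulrC ler_wpM2r// gC.
Qed.

Lemma sqr_integrable_integrable f : measurable_fun D f ->
  integrable (fun x => f x ^+ 2) -> integrable f.
Proof.
move=> mf f2; apply: (@integrable_le _ (fun x => 1 + f x ^+ 2)) => //.
  have i1 : integrable (fun=> 1 : R).
    by apply: (bounded_integrable (C := 1)) => // x _; rewrite normr1.
  by have := integrableD mD i1 f2; apply: eq_integrable => // x _.
move=> x _; rewrite -real_normK ?num_real//; set a := `|f x|.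
have := sqr_ge0 (a - 1); nra.
Qed.

Lemma Rintegral_dominated (fn : nat -> T -> R) f g :
  (forall n, measurable_fun D (fn n)) -> measurable_fun D f ->
  (forall x, D x -> fn n x @[n --> \oo] --> f x) ->
  integrable g -> (forall n x, D x -> `|fn n x| <= g x) ->
  \int[mu]_(x in D) fn n x @[n --> \oo] --> \int[mu]_(x in D) f x.
Proof.
move=> mfn mf cf ig fg.
have [||||| fi _] := @dominated_convergence _ T R mu D mD
  (fun n => EFin \o fn n) (EFin \o f) (EFin \o g).
- by move=> n; exact/measurable_EFinP.
- exact/measurable_EFinP.
- by apply: aeW => x Dx; apply: cvg_EFin; [exact: nearW|exact: cf].
- exact: ig.
- by apply: aeW => x n Dx; rewrite /= lee_fin fg.
move=> h.
have {}h : (fun n => (\int[mu]_(x in D) (fn n x)%:E)%E) @ \oo -->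
    (\int[mu]_(x in D) (f x)%:E)%E by exact: h.
rewrite -(fineK (integrable_fin_num mD fi)) in h.
exact: (fine_cvg h).
Qed.

(** Young's inequality [|b| <= e + b ^+ 2 / e] takes the place of Cauchy-Schwarz: the error is at
    most [K * (e * M + a n / e)], made small by fixing [e] before [n]. *)
Lemma Rintegral_cvg_L2 (fn : nat -> T -> R) f (p : T -> R) (C : R) :
  (forall n, integrable (fn n)) ->
  (forall n, integrable (fun x => (fn n x - f x) ^+ 2)) -> integrable f ->
  (\int[mu]_(x in D) ((fn n x - f x) ^+ 2)%:E)%E @[n --> \oo] --> 0%E ->
  measurable_fun D p -> (forall x, D x -> `|p x| <= C) ->
  \int[mu]_(x in D) (fn n x * p x) @[n --> \oo] --> \int[mu]_(x in D) (f x * p x).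
Proof.
move=> ifn ifn2 fi cvg2 mp pC.
pose a n := \int[mu]_(x in D) ((fn n x - f x) ^+ 2).
have a0 : a n @[n --> \oo] --> (0 : R).
  exact: (fine_cvg cvg2).
have M0 : 0 <= fine (mu D) by exact: fine_ge0.
set M := fine (mu D) in M0.
pose K := `|C|.
have K0 : 0 <= K by rewrite /K.
have i1 : integrable (fun=> 1 : R).
  by apply: (bounded_integrable (C := 1)) => // x _; rewrite normr1.
have bound n (e : R) : 0 < e ->
    `|\int[mu]_(x in D) (f x * p x) - \int[mu]_(x in D) (fn n x * p x)| <=
    K * (e * M + e^-1 * a n).
  move=> e0.
  have ifp := integrable_mul_bounded fi mp pC.
  have ifnp := integrable_mul_bounded (ifn n) mp pC.
  rewrite -RintegralB//.
  have id : integrable (fun x => f x * p x - fn n x * p x).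
    by have := integrableB mD ifp ifnp; apply: eq_integrable.
  apply: (le_trans (le_normr_Rintegral mD id)).
  have ig : integrable (fun x => K * e * 1 + K * e^-1 * (fn n x - f x) ^+ 2).
    have h1 := integrableZl mD (K * e) i1.
    have h2 := integrableZl mD (K * e^-1) (ifn2 n).
    by have := integrableD mD h1 h2; apply: eq_integrable.
  have -> : K * (e * M + e^-1 * a n) =
      \int[mu]_(x in D) (K * e * 1 + K * e^-1 * (fn n x - f x) ^+ 2).
    have h1 : integrable (fun=> K * e * 1).
      by have := integrableZl mD (K * e) i1; apply: eq_integrable.
    have h2 : integrable (fun x => K * e^-1 * (fn n x - f x) ^+ 2).
      by have := integrableZl mD (K * e^-1) (ifn2 n); apply: eq_integrable.
    rewrite RintegralD// (RintegralZl _ mD (ifn2 n)) Rintegral_cst// -/M -/(a n).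
    ring.
  apply: le_Rintegral => //; first exact: integrable_norm.
  move=> x Dx; rewrite -mulrBl normrM distrC.
  set b := fn n x - f x.
  have pK : `|p x| <= K by rewrite (le_trans (pC x Dx))// ler_norm.
  apply: (@le_trans _ _ (`|b| * K)); first by rewrite ler_wpM2l.
  have e1 : 0 < e^-1 by rewrite invr_gt0.
  have : 0 <= e^-1 * (`|b| - e) ^+ 2 + `|b|.
    by rewrite addr_ge0// mulr_ge0 ?sqr_ge0 ?ltW.
  have -> : e^-1 * (`|b| - e) ^+ 2 + `|b| = e^-1 * b ^+ 2 - `|b| + e.
    rewrite sqrrB real_normK ?num_real//; field; by rewrite gt_eqF.
  move=> h; have -> : K * e * 1 + K / e * b ^+ 2 =
    K * (e^-1 * b ^+ 2 - `|b| + e) + `|b| * K by ring.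
  by rewrite lerDr mulr_ge0.
apply/cvgrPdist_lt => e e0.
(* With this value for the parameter of Young's inequality, [K * r * M < e / 2]; the added 1 keeps
   the denominator positive. *)
pose r := e / (2 * (K * M + 1)).
have KM : 0 <= K * M by rewrite mulr_ge0.
have r0 : 0 < r by rewrite divr_gt0// mulr_gt0//; lra.
have c0 : 0 < r * (e / (2 * (K + 1))).
  by rewrite mulr_gt0// divr_gt0// mulr_gt0//; lra.
have /cvgrPdist_lt/(_ _ c0) := a0.
apply: filterS => n; rewrite sub0r normrN => an.
apply: (le_lt_trans (bound n r r0)).
have h1 : K * (r * M) < e / 2.
  have -> : e / 2 = r * (K * M + 1) by rewrite /r; field; rewrite gt_eqF//; lra.
  by rewrite mulrCA ltr_pM2l//; lra.
have h2 : K * (r^-1 * a n) <= e / 2.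
  apply: (@le_trans _ _ (K * (e / (2 * (K + 1))))).
    rewrite ler_wpM2l// mulrC ler_pdivrMr// mulrC.
    exact: le_trans (ler_norm _) (ltW an).
  rewrite mulrA ler_pdivrMr ?mulr_gt0//; last lra.
  by have := ltW e0; nra.
rewrite mulrDr; lra.
Qed.

End Integration.

(** * Weak derivatives on the ball *)

Lemma cvg_uniq {R : realType} (a b : nat -> R) (la lb : R) :
  (forall n, a n = b n) -> a n @[n --> \oo] --> la ->
  b n @[n --> \oo] --> lb -> la = lb.
Proof.
move=> ab; have <- : a = b by exact/funext.
by move=> ca cb; rewrite -(cvg_lim (@Rhausdorff R) ca) (cvg_lim (@Rhausdorff R) cb).
Qed.

Section Ball.
Context {R : realType} (N : nat).
Local Notation E := 'rV[R]_N.
Local Notation B := (uball N : set E).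
Local Notation leb := (lebesgue_rV N : {measure set E -> \bar R}).
Implicit Types (u v p q : E -> R) (x : E).
Local Notation integrable f := (leb.-integrable B (EFin \o f)).
Local Notation s := (@sqnorm R N).

Lemma uball_sqnorm x : B x <-> s x < 1.
Proof. by rewrite /uball/= -sqr_enorm expr_lt1// enorm_ge0. Qed.

Lemma uball_box : B `<=` box 1.
Proof.
by move=> x Bx i; apply: le_trans (coord_le_enorm x i) _; apply: ltW.
Qed.

Lemma measurable_ball_fun u : measurable_fun setT u -> measurable_fun B u.
Proof. by move=> mu; exact: measurable_funTS. Qed.

Lemma continuous_ball_measurable q : continuous q -> measurable_fun B q.
Proof. by move=> /continuous_measurable_rV/measurable_ball_fun. Qed.

Lemma uball_lty : (leb B < +oo)%E.
Proof.
apply: le_lt_trans (box_lty N (1 : R)); apply: le_measure.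
- by rewrite inE; exact: measurable_uball.
- by rewrite inE; exact: measurable_box.
- exact: uball_box.
Qed.

Lemma continuous_ball_bounded q : continuous q ->
  exists2 C, 0 <= C & forall x, B x -> `|q x| <= C.
Proof.
move=> /(continuous_box_bounded 1)[C C0 qC]; exists C => // x /uball_box.
exact: qC.
Qed.

Lemma bounded_ball_integrable u (C : R) : measurable_fun setT u ->
  (forall x, B x -> `|u x| <= C) -> integrable u.
Proof.
move=> mu uC; apply: (bounded_integrable _ _ _ uC).
- exact: measurable_uball.
- exact: uball_lty.
- exact: measurable_ball_fun.
Qed.

Lemma continuous_ball_integrable q : continuous q -> integrable q.
Proof.
move=> cq; have [C _ qC] := continuous_ball_bounded cq.
by apply: bounded_ball_integrable qC; exact: continuous_measurable_rV.
Qed.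

Definition cutoff_fun (d : R) x : R := cutoff d (s x).

Definition cutoff_grad (d : R) (i : 'I_N) x : R :=
  - cutoff_slope d (s x) * (2 * x ord0 i).

Lemma continuous_cutoff_fun d : 0 < d -> continuous (cutoff_fun d).
Proof.
by move=> d0; exact: continuous_compr (@sqnorm_continuous R N) (cutoff_continuous d0).
Qed.

Lemma continuous_slope_fun d : 0 < d -> continuous (fun x => cutoff_slope d (s x)).
Proof.
move=> d0.
exact: continuous_compr (@sqnorm_continuous R N) (cutoff_slope_continuous d0).
Qed.

Lemma C1_cutoff_fun d : 0 < d ->
  C1 (cutoff_fun d) /\ forall i, partial i (cutoff_fun d) = cutoff_grad d i.
Proof.
move=> d0; apply: C1_partial => [|i x|i].
- exact: continuous_cutoff_fun.
- exact: is_derive_sqnorm_comp (is_derive_cutoff _ d0).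
- rewrite (_ : cutoff_grad d i =
      (fun x => (-2) * (cutoff_slope d (s x) * x ord0 i))).
    apply: continuous_mul; first exact: continuous_cst.
    by apply: continuous_mul; [exact: continuous_slope_fun|exact: continuous_coord].
  by apply/funext => x; rewrite /cutoff_grad; ring.
Qed.

Lemma C1c_cutoff d q : 0 < d -> C1 q ->
  C1c (fun x => q x * cutoff_fun d x) /\
  forall i, partial i (fun x => q x * cutoff_fun d x) =
    fun x => q x * cutoff_grad d i x + cutoff_fun d x * partial i q x.
Proof.
move=> d0 cq; have [c1 p1] := C1_cutoff_fun d0.
have [c2 p2] := C1M cq c1; split; last by move=> i; rewrite p2 p1.
have cl : closed [set x | s x <= 1 - d].
  rewrite (_ : [set x | _] = s @^-1` [set t | t <= 1 - d])//.
  by apply: closed_comp; [move=> x _; exact: sqnorm_continuous|exact: closed_le].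
(* The support stays in a closed set that is contained in the open ball. *)
have sub : closure [set x | q x * cutoff_fun d x != 0] `<=` [set x | s x <= 1 - d].
  rewrite [X in _ `<=` X](closure_id _).1//; apply: closure_subset => x /=.
  apply: contra_neqT; rewrite -ltNge => /ltW sd.
  by rewrite /cutoff_fun cutoff_out// mulr0.
have subB : closure [set x | q x * cutoff_fun d x != 0] `<=` B.
  by move=> x /sub /= sx; apply/uball_sqnorm; apply: le_lt_trans sx _; lra.
split=> //.
apply: (@subclosed_compact _ _ (box 1)).
- exact: closed_closure.
- exact: compact_box.
- exact: subset_trans subB uball_box.
Qed.

Lemma Rintegral_ballE u : (forall x, ~ B x -> u x = 0) ->
  \int[leb]_(x in B) u x = \int[leb]_x u x.
Proof.
move=> u0; rewrite Rintegral_mkcond; congr Rintegral; apply/funext => x.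
rewrite patchE; case: ifPn => // /negP; rewrite inE => nB.
by rewrite u0.
Qed.

Lemma cutoff_out_ball d x : 0 < d -> ~ B x ->
  cutoff_fun d x = 0 /\ cutoff_slope d (s x) = 0.
Proof.
move=> d0 /uball_sqnorm/negP; rewrite -leNgt => sx.
by rewrite /cutoff_fun cutoff_out ?cutoff_slope_out//; lra.
Qed.

(* Says that the classical gradient is a weak one, with the test function
   [cutoff_fun d]. *)
Lemma Rintegral_cutoff_partial d i q : 0 < d -> C1 q ->
  \int[leb]_(x in B) (q x * cutoff_grad d i x + cutoff_fun d x * partial i q x)
  = 0.
Proof.
move=> d0 cq; have [[cQ _ _] pQ] := C1c_cutoff d0 cq.
rewrite Rintegral_ballE; last first.
  move=> x /(cutoff_out_ball d0)[c0 s0].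
  by rewrite /cutoff_grad c0 s0 oppr0 !(mul0r, mulr0) addr0.
rewrite -[RHS]/(fine 0%:E); congr fine.
apply: (@integral_partial0 _ _ i (fun x => q x * cutoff_fun d x) _ 1) => //.
- by move=> x; have := C1_is_derive i x cQ; rewrite pQ.
- by rewrite -pQ; exact: continuous_partial.
- move=> x nb; have nB : ~ B x by move/uball_box.
  by rewrite (cutoff_out_ball d0 nB).1 mulr0.
- move=> x nb; have nB : ~ B x by move/uball_box.
  have [c0 s0] := cutoff_out_ball d0 nB.
  by rewrite /cutoff_grad c0 s0 oppr0 !(mul0r, mulr0) addr0.
Qed.

(** Extended to the whole space, [q * p] vanishes off the ball, so its partial derivative integrates
    to 0; the product rule then gives the weak formula. *)
Lemma weak_partial_C1 i q : C1 q -> weak_partial i q (partial i q).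
Proof.
move=> cq p [cp kp sp].
have [cQ pQ] := C1M cq cp.
(* Off its closed support [p] is 0 on a whole neighbourhood, so its derivative vanishes too. *)
have p0 x : ~ B x -> p x = 0 /\ partial i p x = 0.
  move=> nB; have nK : ~ closure [set x | p x != 0] x by move=> /sp.
  have pnear : \near x, cst 0 x = p x.
    have oC : open (~` closure [set x | p x != 0]).
      by apply: closed_openC; exact: closed_closure.
    have := open_nbhs_nbhs (conj oC nK); apply: filterS => y ny /=.
    by apply/esym/eqP/negP => /negP yp; apply: ny; exact: subset_closure.
  split; first by rewrite -(nbhs_singleton pnear).
  by rewrite /partial -(near_eq_derive _ pnear) derive_cst.
have iQ : \int[leb]_(x in B) (q x * partial i p x + p x * partial i q x) = 0.
  rewrite Rintegral_ballE; last first.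
    by move=> x /p0[-> ->]; rewrite mulr0 mul0r addr0.
  rewrite -[RHS]/(fine 0%:E); congr fine.
  apply: (@integral_partial0 _ _ i (fun x => q x * p x) _ 1) => //.
  - by move=> x; have := C1_is_derive i x cQ; rewrite pQ.
  - by rewrite -pQ; exact: continuous_partial.
  - by move=> x nb; rewrite (p0 x _).1 ?mulr0// => /uball_box.
  - move=> x nb; have [|-> ->] := p0 x; first by move/uball_box.
    by rewrite mulr0 mul0r addr0.
have cq' := C1_continuous cq; have cp' := C1_continuous cp.
have i1 : integrable (fun x => q x * partial i p x).
  apply: continuous_ball_integrable; apply: continuous_mul => //.
  exact: continuous_partial.
have i2 : integrable (fun x => p x * partial i q x).
  apply: continuous_ball_integrable; apply: continuous_mul => //.
  exact: continuous_partial.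
move: iQ; rewrite RintegralD//; last exact: measurable_uball.
move=> /eqP; rewrite addr_eq0 => /eqP ->; congr (- _).
by apply: eq_Rintegral => x _; rewrite mulrC.
Qed.

Lemma cutoff_slope_ball_le d x : 0 < d -> B x ->
  (1 - s x) * cutoff_slope d (s x) <= 2.
Proof. by move=> d0 _; exact: cutoff_slope_le. Qed.

Lemma coord_ball x i : B x -> `|x ord0 i| <= 1.
Proof. by move=> /uball_box/(_ i). Qed.

(** The slope blows up like [1 / d] near the sphere. The factor [1 - s x] compensates this and
    yields the dominating function [2 * C * g], while inside the ball the slope tends to 0
    pointwise. *)
Lemma cvg_Rintegral_slope u (C : R) : measurable_fun B u ->
  forall g, integrable g -> (forall x, B x -> 0 <= g x) ->
  (forall x, B x -> `|u x| <= C * (1 - s x) * g x) -> 0 <= C ->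
  \int[leb]_(x in B) (u x * cutoff_slope (harmonic n) (s x)) @[n --> \oo] --> (0 : R).
Proof.
move=> mu g ig g0 ug C0.
have mB : measurable B := @measurable_uball R N.
rewrite (_ : 0 = \int[leb]_(x in B) (0 : R)); last first.
  by rewrite Rintegral_cst// mul0r.
apply: (@Rintegral_dominated _ _ _ leb B mB _ (cst 0) (fun x => 2 * C * g x)).
- move=> n; apply: measurable_funM => //; apply: measurable_ball_fun.
  by apply: continuous_measurable_rV; apply: continuous_slope_fun; exact: harmonic_gt0.
- exact: measurable_cst.
- move=> x /uball_sqnorm Bx /=; rewrite -(mulr0 (u x)); apply: cvgM.
    exact: cvg_cst.
  exact: cvg_cutoff_slope.
- by have := integrableZl mB (2 * C) ig; apply: eq_integrable.
- move=> n x Bx; rewrite normrM (ger0_norm (cutoff_slope_ge0 _ _)).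
  have h := ug x Bx; have h2 := cutoff_slope_ball_le (harmonic_gt0 n) Bx.
  apply: (@le_trans _ _ (C * (1 - s x) * g x * cutoff_slope (harmonic n) (s x))).
    by rewrite ler_wpM2r ?cutoff_slope_ge0.
  have -> : C * (1 - s x) * g x * cutoff_slope (harmonic n) (s x) =
    (C * g x) * ((1 - s x) * cutoff_slope (harmonic n) (s x)) by ring.
  have -> : 2 * C * g x = (C * g x) * 2 by ring.
  by rewrite ler_wpM2l// mulr_ge0// g0.
Qed.

Lemma cvg_Rintegral_cutoff u : integrable u ->
  \int[leb]_(x in B) (u x * cutoff_fun (harmonic n) x) @[n --> \oo] -->
  \int[leb]_(x in B) u x.
Proof.
move=> iu; have mB : measurable B := @measurable_uball R N.
have mu := integrable_measurable iu.
apply: (@Rintegral_dominated _ _ _ leb B mB _ u (fun x => `|u x|)) => //.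
- move=> n; apply: measurable_funM => //; apply: measurable_ball_fun.
  by apply: continuous_measurable_rV; apply: continuous_cutoff_fun; exact: harmonic_gt0.
- move=> x /uball_sqnorm Bx /=; rewrite -[X in _ --> X]mulr1; apply: cvgM.
    exact: cvg_cst.
  exact: cvg_cutoff.
- exact: integrable_norm.
- move=> n x Bx; rewrite normrM ler_piMr// ger0_norm ?cutoff_ge0//.
  by rewrite cutoff_le1// harmonic_gt0.
Qed.

(* A C^1 function vanishing on the sphere is a legitimate test function: the
   error made by cutting it off is controlled by [cutoff_slope_le]. *)
Lemma weak_partial_boundary0 i u v q (C : R) : integrable u -> integrable v ->
  weak_partial i u v -> C1 q -> 0 <= C ->
  (forall x, B x -> `|q x| <= C * (1 - s x)) ->
  \int[leb]_(x in B) (u x * partial i q x) = - \int[leb]_(x in B) (v x * q x).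
Proof.
move=> iu iv uv cq C0 qC; have mB : measurable B := @measurable_uball R N.
have cq' := C1_continuous cq.
have [K K0 qK] := continuous_ball_bounded cq'.
have [K' K0' qK'] := continuous_ball_bounded (continuous_partial (i := i) cq).
have mu := integrable_measurable iu.
have mq := continuous_ball_measurable cq'.
have mp := continuous_ball_measurable (continuous_partial (i := i) cq).
have mi := continuous_ball_measurable (@continuous_coord R N i).
have ip := integrable_mul_bounded mB iu mp qK'.
have iq := integrable_mul_bounded mB iv mq qK.
(* [w] collects the terms in which the derivative of [q * cutoff_fun] falls on the cutoff. *)
pose w x := u x * (q x * (-2 * x ord0 i)).
have mw : measurable_fun B w.
  apply: measurable_funM => //; apply: measurable_funM => //.
  by apply: measurable_funM => //; exact: measurable_cst.
have key n : \int[leb]_(x in B) (w x * cutoff_slope (harmonic n) (s x)) +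
    \int[leb]_(x in B) ((u x * partial i q x) * cutoff_fun (harmonic n) x) =
    - \int[leb]_(x in B) ((v x * q x) * cutoff_fun (harmonic n) x).
  have d0 : 0 < harmonic n :> R := harmonic_gt0 n.
  have [cQ pQ] := C1c_cutoff d0 cq.
  have mc : measurable_fun B (cutoff_fun (harmonic n)).
    exact: continuous_ball_measurable (continuous_cutoff_fun d0).
  have ms : measurable_fun B (fun x => cutoff_slope (harmonic n) (s x)).
    exact: continuous_ball_measurable (continuous_slope_fun d0).
  have c1 x : B x -> `|cutoff_fun (harmonic n) x| <= 1.
    by move=> _; rewrite ger0_norm ?cutoff_ge0// cutoff_le1.
  have c2 x : B x -> `|cutoff_slope (harmonic n) (s x)| <= 2 / harmonic n.
    by move=> _; exact: cutoff_slope_bounded.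
  have := uv _ cQ; rewrite pQ => e.
  rewrite -RintegralD//; last 2 first.
  - apply: (integrable_mul_bounded mB _ ms c2).
    apply: (integrable_mul_bounded mB iu (C := 2 * K)).
      by apply: measurable_funM => //; apply: measurable_funM => //; exact: measurable_cst.
    move=> x Bx; rewrite !normrM normrN (ger0_norm (ler0n _ 2)) mulrCA ler_wpM2l//.
    by rewrite -[leRHS]mulr1 ler_pM ?qK// coord_ball.
  - exact: (integrable_mul_bounded mB ip mc c1).
  transitivity (\int[leb]_(x in B) (u x *
      (q x * cutoff_grad (harmonic n) i x + cutoff_fun (harmonic n) x * partial i q x))).
    by apply: eq_Rintegral => x _; rewrite /w /cutoff_grad; ring.
  by rewrite e; congr (- _); apply: eq_Rintegral => x _; rewrite mulrA.
have l1 : \int[leb]_(x in B) (w x * cutoff_slope (harmonic n) (s x)) @[n --> \oo] --> (0 : R).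
  apply: (@cvg_Rintegral_slope w (2 * C) mw (fun x => `|u x|)).
  - exact: integrable_norm.
  - by move=> x _.
  - move=> x Bx; rewrite /w !normrM normrN (ger0_norm (ler0n _ 2)) mulrC.
    rewrite ler_wpM2r//; have h := qC x Bx; have h2 := coord_ball i Bx.
    have -> : 2 * C * (1 - s x) = (C * (1 - s x)) * (2 * 1) by ring.
    by rewrite ler_pM// ?mulr_ge0// ler_wpM2l.
  - by rewrite mulr_ge0.
have l2 := cvg_Rintegral_cutoff ip.
have l3 := cvg_Rintegral_cutoff iq.
rewrite -[LHS]add0r; exact: (cvg_uniq key (cvgD l1 l2) (cvgN l3)).
Qed.

End Ball.

(** * The divergence theorem on the ball *)

Section Divergence.
Context {R : realType} (N : nat).
Local Notation E := 'rV[R]_N.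
Local Notation B := (uball N : set E).
Local Notation S := (usphere N : set E).
Local Notation leb := (lebesgue_rV N : {measure set E -> \bar R}).
Local Notation sigma := (sphere_measure N : {measure set E -> \bar R}).
Implicit Types (u v p q : E -> R) (x y z : E).
Local Notation integrable f := (leb.-integrable B (EFin \o f)).
Local Notation s := (@sqnorm R N).
Local Notation omega := (@radial_proj R N).

Let mB : measurable B := @measurable_uball R N.

Lemma C1_segment q i z (C a b : R) : C1 q -> a <= b ->
  (forall h, a <= h <= b -> `|partial i q (h *: delta_mx ord0 i + z)| <= C) ->
  `|q (b *: delta_mx ord0 i + z) - q (a *: delta_mx ord0 i + z)| <= C * (b - a).
Proof.
move=> cq ab qC.
pose phi (h : R) := q (h *: delta_mx ord0 i + z).
have dphi (h : R) : is_derive h 1 phi (partial i q (h *: delta_mx ord0 i + z)).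
  apply: (@is_derive_affine R R^o E (fun h : R => h *: delta_mx ord0 i + z) q h 1
    (delta_mx ord0 i)) (C1_is_derive i _ cq) => h'.
  by rewrite [h' *: 1]mulr1 scalerDl addrA.
have dg (h : R) : is_derive h 1 (fun h => C * h) C.
  apply: is_derive_eq; rewrite /GRing.scale/=; ring.
have := derive_norm_le ab (fun h _ => dphi h) (fun h _ => dg h).
rewrite mulrBr; apply.
- by move=> h _; exact: is_derive_continuous (dphi h).
- by move=> h _; exact: is_derive_continuous (dg h).
- by move=> h hab; apply: qC; lra.
Qed.

(* Move from [x] to [y] one coordinate at a time. *)
Lemma C1_lipschitz_box q : C1 q ->
  exists2 L, 0 <= L & forall x y t, box 1 x -> box 1 y ->
    (forall i, `|y ord0 i - x ord0 i| <= t) -> `|q y - q x| <= L * t.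
Proof.
move=> cq.
have cS : continuous (fun x => \sum_(i < N) `|partial i q x|).
  apply: continuous_sumr => i.
  apply: (continuous_compr (continuous_partial (i := i) cq)).
  exact: norm_continuous.
have [C C0 qC] := continuous_box_bounded 1 cS.
have qC' i x : box 1 x -> `|partial i q x| <= C.
  move=> /qC; apply: le_trans; rewrite [leRHS]ger0_norm ?sumr_ge0//.
  by rewrite (bigD1 i)//= lerDl sumr_ge0.
exists (N%:R * C); first by rewrite mulr_ge0.
move=> x y t bx bY xyt.
pose z k : E := \row_j (if (j < k)%N then y ord0 j else x ord0 j).
have step k : (k < N)%N -> `|q (z k.+1) - q (z k)| <= C * t.
  move=> kN; pose i := Ordinal kN.
  pose z0 : E := \row_j (if j == i then 0 else z k ord0 j).
  have zE h j : (h *: delta_mx ord0 i + z0) ord0 j =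
      if j == i then h else z k ord0 j.
    by rewrite !mxE eqxx/=; case: eqP => _; rewrite ?mulr1 ?addr0// mulr0 add0r.
  have -> : z k = x ord0 i *: delta_mx ord0 i + z0.
    apply/rowP => j; rewrite zE; case: eqP => [->|//].
    by rewrite mxE ltnn.
  have -> : z k.+1 = y ord0 i *: delta_mx ord0 i + z0.
    apply/rowP => j; rewrite zE; case: eqP => [->|/eqP ji]; first by rewrite mxE ltnSn.
    rewrite !mxE ltnS leq_eqVlt (_ : (j == k :> nat) = false)//.
    by apply/negbTE; apply: contra ji => /eqP jk; apply/eqP/val_inj.
  have bz h : -1 <= h <= 1 -> box 1 (h *: delta_mx ord0 i + z0).
    move=> h1 j; rewrite zE; case: eqP => _; first by rewrite ler_norml.
    by rewrite mxE; case: ifP => _.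
  have /andP[x1 x2] : -1 <= x ord0 i <= 1 by rewrite -ler_norml.
  have /andP[y1 y2] : -1 <= y ord0 i <= 1 by rewrite -ler_norml.
  have xyi := xyt i.
  have [xy|/ltW yx] := leP (x ord0 i) (y ord0 i).
    apply: (@le_trans _ _ (C * (y ord0 i - x ord0 i))).
      by apply: C1_segment => // h hxy; apply/qC'/bz; lra.
    by rewrite ler_wpM2l// (le_trans (ler_norm _)).
  rewrite distrC; apply: (@le_trans _ _ (C * (x ord0 i - y ord0 i))).
    by apply: C1_segment => // h hxy; apply/qC'/bz; lra.
  by rewrite ler_wpM2l// (le_trans (ler_norm _))// distrC.
have zN : z N = y by apply/rowP => j; rewrite mxE ltn_ord.
have z0E : z 0 = x by apply/rowP => j; rewrite mxE.
have sum k : (k <= N)%N -> `|q (z k) - q (z 0)| <= k%:R * C * t.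
  elim: k => [_|k IH kN]; first by rewrite subrr normr0 !mul0r.
  have -> : q (z k.+1) - q (z 0) = (q (z k.+1) - q (z k)) + (q (z k) - q (z 0)) by ring.
  apply: (le_trans (ler_normD _ _)).
  have := lerD (step k kN) (IH (ltnW kN)); rewrite -natr1; move/le_trans; apply.
  by rewrite le_eqVlt; apply/orP; left; apply/eqP; ring.
by have := sum N (leqnn N); rewrite zN z0E.
Qed.

Lemma is_derive_harmonic (phi : R -> R) (t l : R) : is_derive t 1 phi l ->
  (phi (t + harmonic n) - phi t) / harmonic n @[n --> \oo] --> l.
Proof.
move=> [df dE]; have h : h^-1 *: ((phi \o shift t) (h *: 1) - phi t)
    @[h --> (0 : R)^'] --> l by rewrite -dE; exact: df.
have h' := iffLR (cvgr_dnbhsP _ _ _) h (@harmonic R).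
have h0 : (forall n, @harmonic R n != 0) /\ @harmonic R n @[n --> \oo] --> (0 : R).
  by split; [move=> n; rewrite gt_eqF// harmonic_gt0|exact: cvg_harmonic].
apply: cvg_trans (h' h0); apply: near_eq_cvg; apply: nearW => n /=.
by rewrite /GRing.scale/= mulr1 mulrC (addrC t).
Qed.

Lemma sqnormZ (c : R) x : s (c *: x) = c ^+ 2 * s x.
Proof. by rewrite -!sqr_enorm enormZ exprMn real_normK// num_real. Qed.

(** For [c >= 1] the dilated cutoff is still supported in the ball, so both integrals extend to the
    whole space, where dilations act by the factor [c ^- N]. *)
Lemma ge0_cutoff_dilation u (d c K : R) : measurable_fun setT u ->
  (forall x, 0 <= u x <= K) -> (forall c x, 0 < c -> u (c *: x) = u x) ->
  0 < d -> 1 <= c ->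
  \int[leb]_(x in B) (u x * cutoff d (c ^+ 2 * s x)) =
  c ^- N * \int[leb]_(x in B) (u x * cutoff d (s x)).
Proof.
move=> mu uK uh d0 c1; have c0 : 0 < c by apply: lt_le_trans c1.
have u0 x : 0 <= u x by case/andP: (uK x).
have K0 : 0 <= K by case/andP: (uK 0) => /le_trans; apply.
have out (b : R) x : 1 <= b -> ~ B x -> u x * cutoff d (b ^+ 2 * s x) = 0.
  move=> b1 /uball_sqnorm/negP; rewrite -leNgt => sx; rewrite cutoff_out ?mulr0//.
  apply: (@le_trans _ _ 1); first by lra.
  by rewrite -[leLHS]mulr1 ler_pM// exprn_ege1.
have out1 x : ~ B x -> u x * cutoff d (s x) = 0.
  by move=> /(out 1 x (lexx _)); rewrite expr1n mul1r.
have mf : measurable_fun setT (fun x => u x * cutoff d (s x)).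
  apply: measurable_funM => //; apply: continuous_measurable_rV.
  exact: continuous_cutoff_fun.
have fi : integrable (fun x => u x * cutoff d (s x)).
  apply: (bounded_ball_integrable (C := K)) => // x _.
  rewrite normrM !ger0_norm ?cutoff_ge0// -[leRHS]mulr1.
  by apply: ler_pM; rewrite ?cutoff_ge0 ?cutoff_le1//; case/andP: (uK x).
rewrite (Rintegral_ballE (fun x => @out c x c1)) (Rintegral_ballE out1) /Rintegral.
rewrite -[c ^- N]/(fine (c ^- N)%:E) -fineM//; last first.
  have := integrable_fin_num mB fi; congr (_ \is a fin_num).
  rewrite integral_mkcond; apply: eq_integral => x _; rewrite patchE.
  by case: ifPn => // /negP; rewrite inE => /out1 ->.
congr fine.
rewrite -(ge0_integral_dilation (f := fun x => (u x * cutoff d (s x))%:E))//.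
- by apply: eq_integral => x _; rewrite uh// sqnormZ.
- exact/measurable_EFinP.
- by move=> x; rewrite lee_fin mulr_ge0// cutoff_ge0.
Qed.

(* Euler's identity for the function [u * cutoff d], with [u] homogeneous of
   degree 0: differentiate at [c = 1] the integral of its dilation by [c]. *)
Lemma ge0_cutoff_euler u (d K : R) : measurable_fun setT u ->
  (forall x, 0 <= u x <= K) -> (forall c x, 0 < c -> u (c *: x) = u x) ->
  0 < d ->
  \int[leb]_(x in B) (u x * (2 * s x * cutoff_slope d (s x))) =
  N%:R * \int[leb]_(x in B) (u x * cutoff d (s x)).
Proof.
move=> mu uK uh d0.
have u0 x : 0 <= u x by case/andP: (uK x).
have uK' x : u x <= K by case/andP: (uK x).
have K0 : 0 <= K by exact: le_trans (u0 0) (uK' 0).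
have muB : measurable_fun B u by exact: measurable_ball_fun.
pose I := \int[leb]_(x in B) (u x * cutoff d (s x)).
pose phi x (c : R) := cutoff d (c ^+ 2 * s x).
have mphi c : measurable_fun B (fun x => phi x c).
  apply: continuous_ball_measurable.
  apply: (@continuous_compr _ _ (fun x => c ^+ 2 * s x) (cutoff d)).
    by apply: continuous_mul; [exact: continuous_cst|exact: sqnorm_continuous].
  exact: cutoff_continuous.
have iphi c : integrable (fun x => u x * phi x c).
  apply: (bounded_integrable (C := K) mB (uball_lty N)).
    exact: measurable_funM.
  move=> x _; rewrite normrM !ger0_norm ?cutoff_ge0// -[leRHS]mulr1.
  by apply: ler_pM; rewrite ?cutoff_ge0 ?cutoff_le1.
have dphi x : is_derive (1 : R) 1 (phi x) (- cutoff_slope d (s x) * (2 * s x)).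
  have h1 : is_derive (1 : R) 1 (fun c => c ^+ 2 * s x) (2 * s x).
    have := is_derive_expn 2 (1 : R); rewrite expr1n mulr1 => h.
    apply: (is_derive_eq (is_deriveM h (is_derive_cst (s x) (1 : R) (1 : R)))).
    by rewrite /GRing.scale/=; ring.
  have h2 : is_derive ((1 : R) ^+ 2 * s x) 1 (cutoff d) (- cutoff_slope d (s x)).
    by rewrite expr1n mul1r; exact: is_derive_cutoff.
  exact: (@is_derive1_comp _ (cutoff d) (fun c : R => c ^+ 2 * s x) 1 _ _ h2 h1).
(* Quotients from the right are enough, and [ge0_cutoff_dilation] is available for [c >= 1]. *)
pose quot n x := u x * ((phi x (1 + harmonic n) - phi x 1) / harmonic n).
have mquot n : measurable_fun B (quot n).
  apply: measurable_funM => //; apply: measurable_funM => //.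
  exact: measurable_funB.
have c1 n : 1 <= 1 + harmonic n :> R by rewrite lerDl ltW// harmonic_gt0.
have quotE n : \int[leb]_(x in B) quot n x =
    ((1 + harmonic n) ^- N - 1) / harmonic n * I.
  transitivity (\int[leb]_(x in B)
      (((harmonic n)^-1 * (u x * phi x (1 + harmonic n) - u x * phi x 1)))).
    by apply: eq_Rintegral => x _; rewrite /quot; ring.
  rewrite RintegralZl//; last by have := integrableB mB (iphi (1 + harmonic n)) (iphi 1); apply: eq_integrable.
  rewrite RintegralB// (ge0_cutoff_dilation mu uK uh d0 (c1 n)).
  rewrite (_ : \int[leb]_(x in B) (u x * phi x 1) = I); last first.
    by apply: eq_Rintegral => x _; rewrite /phi expr1n mul1r.
  by rewrite -/I; ring.
have l1 : \int[leb]_(x in B) quot n x @[n --> \oo] -->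
    \int[leb]_(x in B) (u x * (- cutoff_slope d (s x) * (2 * s x))).
  (* For the dominating constant: [cutoff d] is Lipschitz with constant [2 / d], [s x < 1], and
     [((1 + h) ^+ 2 - 1) / h = 2 + h <= 3] for [h = harmonic n]. *)
  apply: (@Rintegral_dominated _ _ _ leb B mB quot _ (fun=> K * (2 / d * 3))) => //.
  - apply: measurable_funM => //; apply: continuous_ball_measurable.
    apply: (@continuous_mul _ _ (fun x => - cutoff_slope d (s x)) (fun x => 2 * s x)).
      rewrite (_ : (fun x => _) = (fun x => 0 - cutoff_slope d (s x))).
        by apply: continuous_sub; [exact: continuous_cst|exact: continuous_slope_fun].
      by apply/funext => x; rewrite sub0r.
    by apply: continuous_mul; [exact: continuous_cst|exact: sqnorm_continuous].
  - move=> x _; apply: cvgM; first exact: cvg_cst.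
    exact: is_derive_harmonic.
  - by apply: continuous_ball_integrable; exact: continuous_cst.
  - move=> n x /uball_sqnorm sx.
    have h0 := harmonic_gt0 n : 0 < harmonic n :> R.
    have h1 : harmonic n <= 1 :> R by rewrite /harmonic/= invf_le1// ler1n.
    rewrite /quot normrM (ger0_norm (u0 x)); apply: ler_pM => //.
    rewrite normrM (ger0_norm (x := (harmonic n)^-1)); last by rewrite invr_ge0 ltW.
    rewrite ler_pdivrMr//; set hn : R := harmonic n in h0 h1 *.
    have sx0 := sqnorm_ge0 x.
    have le1 : 1 ^+ 2 * s x <= (1 + hn) ^+ 2 * s x.
      by rewrite expr1n ler_wpM2r// exprn_ege1//; lra.
    have dl (t : R) : is_derive t 1 (fun t => 2 / d * t) (2 / d).
      apply: is_derive_eq; rewrite /GRing.scale/=; ring.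
    have := derive_norm_le le1 (fun t _ => is_derive_cutoff t d0) (fun t _ => dl t).
    move=> h; apply: (@le_trans _ _ (2 / d * ((1 + hn) ^+ 2 * s x) - 2 / d * (1 ^+ 2 * s x))).
      apply: h => t _; first exact: cutoff_continuous.
        exact: is_derive_continuous (dl t).
      by rewrite normrN; exact: cutoff_slope_bounded.
    have -> : 2 / d * ((1 + hn) ^+ 2 * s x) - 2 / d * (1 ^+ 2 * s x) =
      2 / d * ((2 + hn) * hn * s x) by ring.
    have d20 : 0 <= 2 / d by rewrite divr_ge0// ltW.
    rewrite -[leRHS](mulrA (2 / d)) ler_wpM2l//.
    have h3 : 0 <= (2 + hn) * hn by rewrite mulr_ge0//; lra.
    apply: (@le_trans _ _ ((2 + hn) * hn * 1)); first by rewrite ler_wpM2l// ltW.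
    by rewrite mulr1 ler_wpM2r//; lra.
have l2 : ((1 + harmonic n) ^- N - 1) / harmonic n @[n --> \oo] --> (- N%:R : R).
  have h1 := is_derive_expn N (1 : R); rewrite expr1n mulr1 in h1.
  have n0 : (1 : R) ^+ N != 0 by rewrite expr1n oner_neq0.
  have h2 := @is_deriveV _ (fun x : R => x ^+ N) _ _ _ n0 h1.
  have := is_derive_harmonic h2.
  by rewrite !expr1n invr1 /GRing.scale/= mulN1r.
have l3 : ((1 + harmonic n) ^- N - 1) / harmonic n * I @[n --> \oo] --> - N%:R * I.
  by apply: cvgM l2 _; exact: cvg_cst.
have := cvg_uniq quotE l1 l3.
move=> e; rewrite -/I -[RHS]opprK -mulNr -e.
have is' : integrable (fun x => u x * (2 * s x * cutoff_slope d (s x))).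
  apply: (integrable_mul_bounded mB (C := 2 * 1 * (2 / d))).
  - by apply: (bounded_ball_integrable (C := K)) => // x _; rewrite ger0_norm.
  - apply: continuous_ball_measurable.
    apply: (@continuous_mul _ _ (fun x => 2 * s x)); last exact: continuous_slope_fun.
    by apply: continuous_mul; [exact: continuous_cst|exact: sqnorm_continuous].
  - move=> x /uball_sqnorm sx; rewrite normrM; apply: ler_pM => //.
      rewrite normrM ger0_norm// ler_wpM2l// ger0_norm ?sqnorm_ge0//.
      exact: ltW.
    exact: cutoff_slope_bounded.
rewrite -[LHS]opprK; congr (- _); rewrite -[LHS]mulN1r -(RintegralZl _ mB is').
by apply: eq_Rintegral => x _; ring.
Qed.

End Divergence.

(** * From cones to the sphere *)

Section DivergenceTheorem.
Context {R : realType} (N : nat).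
Local Notation E := 'rV[R]_N.
Local Notation B := (uball N : set E).
Local Notation S := (usphere N : set E).
Local Notation leb := (lebesgue_rV N : {measure set E -> \bar R}).
Local Notation sigma := (sphere_measure N : {measure set E -> \bar R}).
Implicit Types (u v p q : E -> R) (x y z : E).
Local Notation integrable f := (leb.-integrable B (EFin \o f)).
Local Notation s := (@sqnorm R N).
Local Notation omega := (@radial_proj R N).

Let mB : measurable B := @measurable_uball R N.

(** The nonnegative case applies to [u + K] and to the constant [K]; subtract, both sides being
    linear. *)
Lemma cutoff_euler u (d K : R) : measurable_fun setT u ->
  (forall x, `|u x| <= K) -> (forall c x, 0 < c -> u (c *: x) = u x) ->
  0 < d ->
  \int[leb]_(x in B) (u x * (2 * s x * cutoff_slope d (s x))) =
  N%:R * \int[leb]_(x in B) (u x * cutoff d (s x)).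
Proof.
move=> mu uK uh d0; have K0 : 0 <= K by exact: le_trans (normr_ge0 _) (uK 0).
have uK2 x : 0 <= u x + K <= 2 * K.
  by have := uK x; rewrite ler_norml => /andP[]; lra.
have iK : integrable (fun=> K).
  by apply: continuous_ball_integrable; exact: continuous_cst.
have iu : integrable u by exact: bounded_ball_integrable.
have split (w : E -> R) (C : R) : continuous w -> (forall x, B x -> `|w x| <= C) ->
    \int[leb]_(x in B) ((u x + K) * w x) =
    \int[leb]_(x in B) (u x * w x) + \int[leb]_(x in B) (K * w x).
  move=> cw wC; have mw := continuous_ball_measurable cw.
  rewrite -RintegralD//.
  - by apply: eq_Rintegral => x _; rewrite mulrDl.
  - exact: integrable_mul_bounded wC.
  - exact: (integrable_mul_bounded mB iK mw wC).
have c1 := continuous_cutoff_fun (N := N) d0.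
have c2 : continuous (fun x => 2 * s x * cutoff_slope d (s x)).
  apply: continuous_mul; last exact: continuous_slope_fun.
  by apply: continuous_mul; [exact: continuous_cst|exact: sqnorm_continuous].
have [C1 _ wC1] := continuous_ball_bounded c1.
have [C2 _ wC2] := continuous_ball_bounded c2.
have e1 := @ge0_cutoff_euler _ _ (fun x => u x + K) d (2 * K).
have e2 := @ge0_cutoff_euler _ _ (fun x : E => K) d K.
have : \int[leb]_(x in B) ((u x + K) * (2 * s x * cutoff_slope d (s x))) =
  N%:R * \int[leb]_(x in B) ((u x + K) * cutoff d (s x)).
  apply: e1 => //.
  - by apply: measurable_funD => //; exact: measurable_cst.
  - by move=> c x c0; rewrite uh.
rewrite (split _ _ c2 wC2) (split _ _ c1 wC1) mulrDr e2//.
- by move/addIr.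
- by move=> x; rewrite lexx K0.
Qed.

Lemma enorm_radial_proj x : x != 0 -> enorm (omega x) = 1.
Proof.
move=> x0; rewrite /radial_proj enormZ ger0_norm ?invr_ge0 ?enorm_ge0//.
by rewrite mulVf// enorm_eq0.
Qed.

Lemma radial_proj0 : omega 0 = 0.
Proof. by rewrite /radial_proj scaler0. Qed.

Lemma radial_projZ (c : R) x : 0 < c -> omega (c *: x) = omega x.
Proof.
move=> c0; rewrite /radial_proj enormZ gtr0_norm// scalerA invfM.
by congr (_ *: _); rewrite mulrAC mulVf ?gt_eqF// mul1r.
Qed.

Lemma box_radial_proj x : box 1 (omega x).
Proof.
move=> i; have [->|x0] := eqVneq x 0.
  by rewrite radial_proj0 mxE normr0.
by rewrite -(enorm_radial_proj x0) coord_le_enorm.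
Qed.

Lemma measurable_comp_radial_proj q : continuous q ->
  measurable_fun setT (q \o omega).
Proof.
move=> cq; apply: (measurableT_comp (continuous_measurable_rV cq)).
exact: measurable_radial_proj.
Qed.

Lemma measurable_usphere : measurable S.
Proof.
rewrite (_ : S = (@enorm R N) @^-1` [set 1])//.
by rewrite -[X in measurable X]setTI; apply: measurable_enorm.
Qed.

(** Change of variables for the cone measure. The origin is the only point of the ball that is not
    projected to the sphere: it is sent to 0, whence the condition [f 0 = 0]. *)
Lemma ge0_integral_sphere (f : E -> \bar R) : measurable_fun setT f ->
  (forall x, 0 <= f x)%E -> f 0 = 0%E ->
  (\int[sigma]_(x in S) f x = N%:R%:E * \int[leb]_(x in B) f (omega x))%E.
Proof.
move=> mf f0 f00; have mS := measurable_usphere.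
have mfS : measurable_fun S f by exact: measurable_funTS.
rewrite /= /sphere_measure ge0_integral_mscale//=; congr (_ * _)%E.
rewrite /cone_measure ge0_integral_pushforward//; last exact: measurable_radial_proj.
have mo : measurable_fun setT (f \o omega).
  by apply: (measurableT_comp mf); exact: measurable_radial_proj.
have mD : measurable (omega @^-1` S).
  by rewrite -[X in measurable X]setTI; apply: measurable_radial_proj.
rewrite (@ge0_negligible_integral _ _ _ _ _ (~` B))//; first last.
- by rewrite /= /mrestr setICl measure0.
- by move=> x _; exact: f0.
- exact: measurable_funTS.
- exact: measurableC.
rewrite setDE setCK.
transitivity (\int[leb]_(x in omega @^-1` S `&` B) (f \o omega) x)%E.
  apply: eq_measure_integral => A mA AD.
  by rewrite -[LHS]/(leb (A `&` B)) setIidl// => x /AD[].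
rewrite integral_mkcondl; apply: eq_integral => x _; rewrite patchE.
case: ifPn => // /negP; rewrite inE /preimage/= /usphere/= => nS.
have [->|x0] := eqVneq x 0; first by rewrite radial_proj0 f00.
by case: nS; exact: enorm_radial_proj.
Qed.

Lemma sphere_lty : (sigma S < +oo)%E.
Proof.
rewrite /= /sphere_measure /mscale/= lte_mul_pinfty// /cone_measure /pushforward.
apply: le_lt_trans (uball_lty N); rewrite /mrestr; apply: le_measure.
- rewrite inE; apply: measurableI => //.
  rewrite -[X in measurable X]setTI; apply: measurable_radial_proj => //.
  exact: measurable_usphere.
- by rewrite inE.
- exact: subIsetr.
Qed.

Lemma Rintegral_sphere q (C : R) : measurable_fun setT q -> q 0 = 0 ->
  (forall x, box 1 x -> `|q x| <= C) ->
  \int[sigma]_(x in S) q x = N%:R * \int[leb]_(x in B) q (omega x).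
Proof.
move=> mq q0 qC.
have mo : measurable_fun setT (q \o omega).
  by apply: (measurableT_comp mq); exact: measurable_radial_proj.
have io : integrable (q \o omega).
  apply: (bounded_ball_integrable (C := C)) => // x _; apply: qC.
  exact: box_radial_proj.
have mq' : measurable_fun setT (EFin \o q) by exact/measurable_EFinP.
rewrite /Rintegral [X in fine X = _]integralE [X in _ * fine X]integralE.
have e1 := ge0_integral_sphere (f := (EFin \o q)^\+%E) (measurable_funepos mq')
  (fun x => funepos_ge0 _ x).
have e2 := ge0_integral_sphere (f := (EFin \o q)^\-%E) (measurable_funeneg mq')
  (fun x => funeneg_ge0 _ x).
rewrite e1; last by rewrite funeposE/= q0 maxxx.
rewrite e2; last by rewrite funenegE/= q0 oppr0 maxxx.
rewrite -[N%:R in RHS]/(fine N%:R%:E) -fineM//; last first.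
  by rewrite -integralE; exact: integrable_fin_num.
rewrite -[fun x => (q (omega x))%:E]/((EFin \o q) \o omega).
rewrite -[EFin \o (q \o omega)]/((EFin \o q) \o omega) in io.
have f1 := integrable_pos_fin_num mB io.
have f2 := integrable_neg_fin_num mB io.
rewrite funepos_comp funeneg_comp in f1 f2 *.
by rewrite -muleBr// fin_num_adde_defl// fin_numN.
Qed.

(** Testing [partial i q] against the cutoff leaves the integral of [2 * q x * x_i] times the slope,
    concentrated near the sphere. Replacing [q x * x_i] by [s x * F x], where [F] extends its values
    on the sphere with degree 0, costs the error [D], of order [1 - s x], which disappears in the
    limit. Euler's identity turns the rest into [N] times the integral of [F] against the cutoff,
    whose limit is the surface integral. *)
Theorem divergence_ball i q : C1 q ->
  \int[leb]_(x in B) partial i q x = \int[sigma]_(x in S) (q x * x ord0 i).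
Proof.
move=> cq; have cq' := C1_continuous cq.
have ci := @continuous_coord R N i.
have cqi : continuous (fun x => q x * x ord0 i) by exact: continuous_mul.
have [C C0 qC] := continuous_box_bounded 1 cq'.
have [C' C0' qiC] := continuous_box_bounded 1 cqi.
have [L L0 qL] := C1_lipschitz_box cq.
rewrite (Rintegral_sphere (C := C')); last 3 first.
- exact: continuous_measurable_rV.
- by rewrite mxE mulr0.
- exact: qiC.
pose F x := q (omega x) * omega x ord0 i.
have mF : measurable_fun setT F by exact: (measurable_comp_radial_proj cqi).
have FC' x : `|F x| <= C' by exact/qiC/box_radial_proj.
have iF : integrable F by apply: (bounded_ball_integrable (C := C')).
pose D x := q x * (2 * x ord0 i) - 2 * s x * F x.
have c2x : continuous (fun x => q x * (2 * x ord0 i)).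
  by apply: continuous_mul => //; apply: continuous_mul => //; exact: continuous_cst.
have c2s : continuous (fun x => 2 * s x).
  by apply: continuous_mul; [exact: continuous_cst|exact: sqnorm_continuous].
have mD : measurable_fun B D.
  apply: measurable_funB; first exact: continuous_ball_measurable.
  by apply: measurable_funM; [exact: continuous_ball_measurable|exact: measurable_ball_fun].
have DC x : B x -> `|D x| <= 2 * (L + C) * (1 - s x) * 1.
  move=> Bx; have sx := (uball_sqnorm x).1 Bx; rewrite mulr1.
  have [x0|x0] := eqVneq x 0.
    have -> : D x = 0 by rewrite /D /F x0 radial_proj0 mxE !mulr0 subrr.
    by rewrite normr0 mulr_ge0 ?subr_ge0 ?(ltW sx)// mulr_ge0// addr_ge0.
  (* Since [x = r *: omega x], [D x] is [2 * x_i * (q x - r * q (omega x))]; the Lipschitz bound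
     along the ray yields the factor [1 - r <= 1 - s x]. *)
  set r := enorm x; have r1 : r < 1 by exact: Bx.
  have r0 : 0 < r by rewrite lt_def enorm_ge0 enorm_eq0 x0.
  have r1' : 0 <= 1 - r by rewrite subr_ge0 ltW.
  have xE j : x ord0 j = r * omega x ord0 j.
    by rewrite mxE mulrA divff ?mul1r// gt_eqF.
  have -> : D x = 2 * x ord0 i * ((q x - q (omega x)) + (1 - r) * q (omega x)).
    by rewrite /D /F -sqr_enorm -/r (xE i); ring.
  have h1 : `|q x - q (omega x)| <= L * (1 - r).
    rewrite distrC; apply: qL; [exact: uball_box|exact: box_radial_proj|] => j.
    rewrite xE -[X in X - _]mul1r -mulrBl normrM ger0_norm//.
    by rewrite -[leRHS]mulr1 ler_wpM2l//; exact: box_radial_proj.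
  have h2 : `|(1 - r) * q (omega x)| <= C * (1 - r).
    rewrite normrM ger0_norm// mulrC ler_wpM2r//.
    exact/qC/box_radial_proj.
  have h3 : `|(q x - q (omega x)) + (1 - r) * q (omega x)| <= (L + C) * (1 - r).
    by apply: le_trans (ler_normD _ _) _; rewrite [leRHS]mulrDl lerD.
  have h4 : (1 - r) <= 1 - s x.
    by rewrite lerD2l lerN2 -sqr_enorm -/r expr2 ler_piMr// ltW.
  rewrite normrM; apply: (@le_trans _ _ (2 * ((L + C) * (1 - r)))).
    apply: ler_pM => //; rewrite normrM ger0_norm// -[leRHS]mulr1 ler_wpM2l//.
    exact: coord_ball.
  by rewrite -mulrA ler_wpM2l// ler_wpM2l// addr_ge0.
have cp := continuous_partial (i := i) cq.
have ip : integrable (partial i q) by exact: continuous_ball_integrable.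
have key n : \int[leb]_(x in B) (partial i q x * cutoff_fun (harmonic n) x) =
    \int[leb]_(x in B) (D x * cutoff_slope (harmonic n) (s x)) +
    N%:R * \int[leb]_(x in B) (F x * cutoff_fun (harmonic n) x).
  have d0 : 0 < harmonic n :> R := harmonic_gt0 n.
  have cc := continuous_cutoff_fun (N := N) d0.
  have cs := continuous_slope_fun (N := N) d0.
  have cg : continuous (cutoff_grad (harmonic n) i : E -> R).
    have [c1 p1] := C1_cutoff_fun N d0.
    by have := continuous_partial (i := i) c1; rewrite p1.
  have hF c x : 0 < c -> F (c *: x) = F x by move=> c0; rewrite /F radial_projZ.
  have e0 := cutoff_euler mF FC' hF d0.
  transitivity (\int[leb]_(x in B) (D x * cutoff_slope (harmonic n) (s x)) +
    \int[leb]_(x in B) (F x * (2 * s x * cutoff_slope (harmonic n) (s x)))); last first.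
    by rewrite e0.
  have [Cs Cs0 wCs] := continuous_ball_bounded cs.
  have [C2 C20 wC2] := continuous_ball_bounded (continuous_mul c2s cs).
  rewrite -RintegralD//; last 2 first.
  - apply: (integrable_mul_bounded mB _ (continuous_ball_measurable cs) wCs).
    apply: (integrable_le mB mD _ DC).
    apply: continuous_ball_integrable.
    apply: continuous_mul; last exact: continuous_cst.
    apply: continuous_mul; first exact: continuous_cst.
    by apply: continuous_sub; [exact: continuous_cst|exact: sqnorm_continuous].
  - exact: (integrable_mul_bounded mB iF (continuous_ball_measurable (continuous_mul c2s cs)) wC2).
  have e := Rintegral_cutoff_partial i d0 cq.
  rewrite (RintegralD mB) in e; last 2 first.
  - by apply: continuous_ball_integrable; exact: continuous_mul cq' cg.
  - by apply: continuous_ball_integrable; exact: continuous_mul cc cp.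
  move/eqP: e; rewrite addrC addr_eq0 => /eqP e.
  transitivity (\int[leb]_(x in B) (cutoff_fun (harmonic n) x * partial i q x)).
    by apply: eq_Rintegral => x _; rewrite mulrC.
  rewrite e -mulN1r -RintegralZl//; last first.
    by apply: continuous_ball_integrable; exact: continuous_mul cq' cg.
  by apply: eq_Rintegral => x _; rewrite /cutoff_grad /D; ring.
have l1 := cvg_Rintegral_cutoff ip.
have l2 : \int[leb]_(x in B) (D x * cutoff_slope (harmonic n) (s x)) @[n --> \oo] --> (0 : R).
  apply: (cvg_Rintegral_slope (C := 2 * (L + C)) mD (g := fun=> 1)) => //.
  - by apply: continuous_ball_integrable; exact: continuous_cst.
  - by rewrite mulr_ge0// addr_ge0.
have l3 : N%:R * \int[leb]_(x in B) (F x * cutoff_fun (harmonic n) x) @[n --> \oo]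
    --> N%:R * \int[leb]_(x in B) F x.
  by apply: cvgM; [exact: cvg_cst|exact: cvg_Rintegral_cutoff].
by rewrite (cvg_uniq key l1 (cvgD l2 l3)) add0r.
Qed.

End DivergenceTheorem.

(** * Green's identity for weak solutions *)

Lemma Rintegral_sum d (T : measurableType d) {R : realType}
    (mu : {measure set T -> \bar R}) (D : set T) (I : Type) (r : seq I)
    (F : I -> T -> R) : measurable D ->
  (forall i, mu.-integrable D (EFin \o F i)) ->
  mu.-integrable D (EFin \o (fun x => \sum_(i <- r) F i x)) /\
  \int[mu]_(x in D) (\sum_(i <- r) F i x) =
  \sum_(i <- r) \int[mu]_(x in D) F i x.
Proof.
move=> mD iF; elim: r => [|i r [IH1 IH2]].
  rewrite big_nil (_ : (fun x => _) = cst 0); last first.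
    by apply/funext => x; rewrite big_nil.
  split; last by rewrite Rintegral_cst// mul0r.
  by apply: eq_integrable (integrable0 mu D).
have e : (fun x => \sum_(j <- i :: r) F j x) =
    (fun x => F i x + \sum_(j <- r) F j x).
  by apply/funext => x; rewrite big_cons.
rewrite e big_cons RintegralD// IH2; split=> //.
by have := integrableD mD (iF i) IH1; apply: eq_integrable.
Qed.

Lemma square_integrable_sub d (T : measurableType d) {R : realType}
    (mu : {measure set T -> \bar R}) (D : set T) (f g : T -> R) :
  measurable D -> measurable_fun D f -> measurable_fun D g ->
  mu.-integrable D (EFin \o (fun x => f x ^+ 2)) ->
  mu.-integrable D (EFin \o (fun x => g x ^+ 2)) ->
  mu.-integrable D (EFin \o (fun x => (f x - g x) ^+ 2)).
Proof.
move=> mD mf mg f2 g2.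
apply: (@integrable_le _ _ _ _ _ mD _ (fun x => 2 * f x ^+ 2 + 2 * g x ^+ 2)).
- by apply: measurable_funX; exact: measurable_funB.
- have h := integrableD mD (integrableZl mD 2 f2) (integrableZl mD 2 g2).
  by move: h; apply: eq_integrable.
- move=> x _; rewrite ger0_norm ?sqr_ge0//.
  by have := sqr_ge0 (f x + g x); nra.
Qed.

Section WeakNeumann.
Context {R : realType} (N : nat) (N0 : (0 < N)%N).
Local Notation E := 'rV[R]_N.
Local Notation B := (uball N : set E).
Local Notation S := (usphere N : set E).
Local Notation leb := (lebesgue_rV N : {measure set E -> \bar R}).
Local Notation sigma := (sphere_measure N : {measure set E -> \bar R}).
Implicit Types (u v p q : E -> R).
Local Notation integrable f := (leb.-integrable B (EFin \o f)).
Local Notation s := (@sqnorm R N).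

Let mB : measurable B := @measurable_uball R N.
Let mS : measurable S := @measurable_usphere R N.

Lemma continuous_sphere_measurable q : continuous q -> measurable_fun S q.
Proof. by move=> /continuous_measurable_rV; exact: measurable_funTS. Qed.

Lemma usphere_box : S `<=` box 1.
Proof. by move=> x Sx i; apply: le_trans (coord_le_enorm x i) _; rewrite Sx. Qed.

Lemma continuous_sphere_integrable q : continuous q ->
  sigma.-integrable S (EFin \o q).
Proof.
move=> cq; have [C _ qC] := continuous_box_bounded 1 cq.
apply: (bounded_integrable (C := C) mS (sphere_lty N)).
- exact: continuous_sphere_measurable.
- by move=> x /usphere_box; exact: qC.
Qed.

Lemma cvg_L2_ball (P : nat -> E -> R) u q : (forall n, continuous (P n)) ->
  square_integrable leb B u ->
  (\int[leb]_(x in B) ((P n x - u x) ^+ 2)%:E)%E @[n --> \oo] --> 0%E ->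
  continuous q ->
  \int[leb]_(x in B) (P n x * q x) @[n --> \oo] --> \int[leb]_(x in B) (u x * q x).
Proof.
move=> cP [mu u2] h cq; have [C _ qC] := continuous_ball_bounded cq.
have lB := uball_lty N : (leb B < +oo)%E.
apply: (Rintegral_cvg_L2 mB lB _ _ _ h _ qC).
- by move=> n; exact: continuous_ball_integrable.
- move=> n; apply: (square_integrable_sub mB) => //.
  + exact: continuous_ball_measurable.
  + apply: continuous_ball_integrable.
    exact: (continuous_compr (cP n) (@exprn_continuous R 2)).
- exact: (sqr_integrable_integrable mB lB).
- exact: continuous_ball_measurable.
Qed.

Lemma cvg_L2_sphere (P : nat -> E -> R) u q : (forall n, continuous (P n)) ->
  square_integrable sigma S u ->
  (\int[sigma]_(x in S) ((P n x - u x) ^+ 2)%:E)%E @[n --> \oo] --> 0%E ->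
  continuous q ->
  \int[sigma]_(x in S) (P n x * q x) @[n --> \oo] -->
  \int[sigma]_(x in S) (u x * q x).
Proof.
move=> cP [mu u2] h cq; have [C _ qC] := continuous_box_bounded 1 cq.
have lS := sphere_lty N : (sigma S < +oo)%E.
apply: (Rintegral_cvg_L2 (C := C) mS lS _ _ _ h).
- by move=> n; exact: continuous_sphere_integrable.
- move=> n; apply: (square_integrable_sub mS) => //.
  + exact: continuous_sphere_measurable.
  + apply: continuous_sphere_integrable.
    exact: (continuous_compr (cP n) (@exprn_continuous R 2)).
- exact: (sqr_integrable_integrable mS lS).
- exact: continuous_sphere_measurable.
- by move=> x /usphere_box; exact: qC.
Qed.

(** The divergence theorem for [P n * q], where [P n] are the C^1 functions defining the trace; the
    three integrals pass to the limit by L^2 convergence. *)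
Lemma trace_parts i u (g : 'I_N -> E -> R) (t : E -> R) q :
  square_integrable leb B u -> square_integrable leb B (g i) ->
  is_trace u g t -> C1 q ->
  \int[leb]_(x in B) (u x * partial i q x) + \int[leb]_(x in B) (g i x * q x) =
  \int[sigma]_(x in S) (t x * (q x * x ord0 i)).
Proof.
move=> u2 g2 [t2 [P [cP Pu Pg Pt]]] cq.
have cq' := C1_continuous cq; have cpq := continuous_partial (i := i) cq.
have cP' n := C1_continuous (cP n).
have cpP n := continuous_partial (i := i) (cP n).
have l1 := cvg_L2_ball cP' u2 Pu cpq.
have l2 := cvg_L2_ball cpP g2 (Pg i) cq'.
have l3 := cvg_L2_sphere cP' t2 Pt (continuous_mul cq' (@continuous_coord R N i)).
apply: (cvg_uniq _ (cvgD l1 l2) l3) => n /=.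
rewrite -RintegralD//; last 2 first.
- by apply: continuous_ball_integrable; exact: continuous_mul.
- by apply: continuous_ball_integrable; exact: continuous_mul.
have [cPq pPq] := C1M (cP n) cq.
transitivity (\int[leb]_(x in B) partial i (fun x => P n x * q x) x).
  by rewrite pPq; apply: eq_Rintegral => x _; rewrite [X in _ + X]mulrC.
by rewrite divergence_ball//; apply: eq_Rintegral => x _; rewrite mulrA.
Qed.

(** Needed to use the gradient of a radial function as a test function in [weak_partial_boundary0].
    For [r <= 1 / 2] the factor [1 - r ^+ 2] is bounded below; beyond, [w 1 = 0] and
    [|w'| = |k - N * w| / r <= 4 * K]. *)
Lemma rmean_boundary_le (k : R -> R) : continuous k -> rmean N k 1 = 0 ->
  exists2 C, 0 <= C & forall r, 0 <= r <= 1 ->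
    `|r * rmean N k r| <= C * (1 - r ^+ 2).
Proof.
move=> ck w1.
have cn : continuous (fun r => `|k r|).
  exact: (continuous_compr ck (@norm_continuous _ _)).
have [c _ kc] := @EVT_max R (fun r => `|k r|) 0 1 ler01 (continuous_subspaceT cn).
set K := `|k c|; have K0 : 0 <= K by rewrite /K.
have kK r : 0 <= r <= 1 -> `|k r| <= K by move=> r01; apply: kc; rewrite in_itv.
have NR : (1 : R) <= N%:R by rewrite ler1n.
have wK r : 0 <= r <= 1 -> `|N%:R * rmean N k r| <= K.
  move=> r01; rewrite normrM ger0_norm// mulrC -ler_pdivlMr ?ltr0n//.
  by apply: rmean_norm_le => //; [lra|move=> t tr; apply: kK; lra].
have wK' r : 0 <= r <= 1 -> `|rmean N k r| <= K.
  move=> /wK; apply: le_trans; rewrite normrM ger0_norm// ler_peMl//.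
exists (4 * K); first by rewrite mulr_ge0.
move=> r r01; have r2 : r ^+ 2 <= r by rewrite expr2 ler_piMr//; lra.
have [rh|rh] := leP r (1 / 2).
  rewrite normrM; have /andP[r0 _] := r01; rewrite (ger0_norm r0).
  have h := wK' r r01; apply: (@le_trans _ _ (1 / 2 * K)).
    by apply: ler_pM.
  have h2 : 1 / 2 <= 1 - r ^+ 2 by lra.
  by nra.
have [r0 r1] : 0 <= r /\ r <= 1 by lra.
have dl (t : R) : is_derive t 1 (fun t => 4 * K * t) (4 * K).
  apply: is_derive_eq; rewrite /GRing.scale/=; ring.
have dw (t : R) : r < t < 1 -> is_derive t 1 (rmean N k) ((k t - N%:R * rmean N k t) / t).
  by move=> tr; apply: is_derive_rmean => //; lra.
have := derive_norm_le r1 dw (fun t _ => dl t).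
rewrite w1 sub0r normrN => h; rewrite normrM (ger0_norm r0).
apply: (@le_trans _ _ `|rmean N k r|); first by rewrite ler_piMl.
apply: (@le_trans _ _ (4 * K * 1 - 4 * K * r)); last first.
  by rewrite -mulrBr ler_wpM2l ?mulr_ge0//; lra.
apply: h => t tr.
- exact: rmean_continuous.
- exact: is_derive_continuous (dl t).
have t01 : 0 <= t <= 1 by lra.
have t0 : 0 < t by lra.
rewrite normrM normfV (gtr0_norm t0) ler_pdivrMr//.
apply: (le_trans (ler_normB _ _)).
have := lerD (kK t t01) (wK t t01); move/le_trans; apply.
have t2 : 1 / 2 <= t by lra.
by nra.
Qed.

(* Green's second identity for a weak solution [v] and a radial function of
   Laplacian [k], both with vanishing normal derivative. *)
Lemma neumann_green (lam d : R) v (k : R -> R) :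
  neumann_solution (fun r => lam * r) v -> continuous k -> rmean N k 1 = 0 ->
  \int[leb]_(x in B) (v x * (k (enorm x) + (lam - 1) * radial_fun k d x)) = 0.
Proof.
move=> [g [h [[[v2 vg] gh] eqv [t [tr t0]]]]] ck w1.
have lB := uball_lty N : (leb B < +oo)%E.
have [cp pp] := @radial_fun_C1 R N N0 k ck d.
set p : E -> R := radial_fun k d in cp pp *.
have iv : integrable v by case: v2 => m2 i2; exact: (sqr_integrable_integrable mB lB).
have g2 i : square_integrable leb B (g i) by exact: (vg i).1.
have h2 i j : square_integrable leb B (h i j) by exact: ((gh i).2 j).1.
have ig i : integrable (g i).
  by case: (g2 i) => m2 i2; exact: (sqr_integrable_integrable mB lB).
have ih i j : integrable (h i j).
  by case: (h2 i j) => m2 i2; exact: (sqr_integrable_integrable mB lB).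
have [C C0 wC] := rmean_boundary_le ck w1.
have cp' := C1_continuous cp.
have [Cp _ pC] := continuous_ball_bounded cp'.
have mp := continuous_ball_measurable cp'.
have cH i j := @continuous_radial_hess R N N0 k ck i j.
have iH i : integrable (fun x => v x * radial_hess k i i x).
  have [C' _ HC'] := continuous_ball_bounded (cH i i).
  exact: (integrable_mul_bounded mB iv (continuous_ball_measurable (cH i i)) HC').
have ihp i : integrable (fun x => h i i x * p x).
  exact: (integrable_mul_bounded mB (ih i i) mp pC).
(* The test function [radial_grad k i] vanishes on the sphere as [rmean N k 1 = 0], so no trace of
   [v] enters. *)
have part1 i : \int[leb]_(x in B) (v x * radial_hess k i i x) =
    - \int[leb]_(x in B) (g i x * partial i p x).
  have [cg pg] := @radial_grad_C1 R N N0 k ck i.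
  rewrite -(pg i) pp.
  apply: (weak_partial_boundary0 iv (ig i) (vg i).2 cg C0) => x Bx.
  rewrite -sqr_enorm; apply: le_trans (wC (enorm x) _); last first.
    by rewrite enorm_ge0 ltW//.
  rewrite /radial_grad !normrM ler_wpM2r// (ger0_norm (enorm_ge0 x)).
  exact: coord_le_enorm.
have part2 i : \int[leb]_(x in B) (g i x * partial i p x) +
    \int[leb]_(x in B) (h i i x * p x) =
    \int[sigma]_(x in S) (t i x * (p x * x ord0 i)).
  exact: trace_parts (g2 i) (h2 i i) (tr i) cp.
have it i : sigma.-integrable S (EFin \o (fun x => t i x * (p x * x ord0 i))).
  have [[mt t2] _] := tr i.
  have cpx := continuous_mul cp' (@continuous_coord R N i).
  have [C' _ pxC] := continuous_box_bounded 1 cpx.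
  apply: (integrable_mul_bounded (C := C') mS).
  - exact: (sqr_integrable_integrable mS (sphere_lty N)).
  - exact: continuous_sphere_measurable.
  - by move=> x /usphere_box; exact: pxC.
have ae1 : \int[leb]_(x in B) (\sum_(i < N) h i i x * p x) =
    \int[leb]_(x in B) ((1 - lam) * (v x * p x)).
  have [isum _] := Rintegral_sum (index_enum 'I_N) mB ihp.
  congr fine; apply: ae_eq_integral => //.
  - exact: measurable_int isum.
  - apply/measurable_EFinP; apply: measurable_funM; first exact: measurable_cst.
    by apply: measurable_funM => //; case: v2.
  - apply: filterS eqv => x /= + Bx => /(_ Bx) e; congr EFin.
    rewrite -mulr_suml mulrA; congr (_ * _).
    by rewrite mulrBl mul1r -e; ring.
(* The Neumann condition on [v] cancels only the sum of the boundary terms over [i], not each of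
   them. *)
have ae2 : \int[sigma]_(x in S) (\sum_(i < N) t i x * (p x * x ord0 i)) = 0.
  have [isum _] := Rintegral_sum (index_enum 'I_N) mS it.
  transitivity (\int[sigma]_(x in S) (0 : R)); last first.
    by rewrite Rintegral_cst// mul0r.
  congr fine; apply: ae_eq_integral => //.
  - exact: measurable_int isum.
  - apply: filterS t0 => x /= + Sx => /(_ Sx) e; congr EFin.
    rewrite (eq_bigr (fun i => p x * (t i x * x ord0 i))); last by move=> i _; ring.
    by rewrite -mulr_sumr e mulr0.
have ivp : integrable (fun x => v x * p x) by exact: integrable_mul_bounded pC.
have [iSum eSum] := Rintegral_sum (index_enum 'I_N) mB iH.
transitivity (\int[leb]_(x in B) (\sum_(i < N) v x * radial_hess k i i x +
    (lam - 1) * (v x * p x))).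
  apply: eq_Rintegral => x _; rewrite -mulr_sumr radial_laplacian// -/(p x); ring.
have iv2 : integrable (fun x => (lam - 1) * (v x * p x)).
  by have := integrableZl mB (lam - 1) ivp; apply: eq_integrable.
rewrite RintegralD// eSum (RintegralZl _ mB ivp).
rewrite (eq_bigr (fun i => \int[leb]_(x in B) (h i i x * p x) -
    \int[sigma]_(x in S) (t i x * (p x * x ord0 i)))); last first.
  by move=> i _; rewrite part1 -part2; ring.
rewrite sumrB -(Rintegral_sum (index_enum 'I_N) mB ihp).2.
rewrite -(Rintegral_sum (index_enum 'I_N) mS it).2 ae1 ae2 (RintegralZl _ mB ivp).
ring.
Qed.

End WeakNeumann.

(** * The radial initial value problem *)

Section GeometricApproximation.
Context {R : realType}.

Lemma geometric_small (A e : R) : 0 < e -> exists n, A / 2 ^+ n < e.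
Proof.
move=> e0.
have h : geometric A (2^-1) @ \oo --> (0 : R).
  by apply: cvg_geometric; rewrite ger0_norm//; lra.
have /cvgrPdist_lt/(_ e e0)[n _ /(_ n (leqnn n))] := h.
rewrite /= sub0r normrN exprVn => /(le_lt_trans (ler_norm _)) h'.
by exists n.
Qed.

Lemma le_geometric_eq0 (a A : R) : (forall n, `|a| <= A / 2 ^+ n) -> a = 0.
Proof.
move=> aA; apply/eqP; rewrite -normr_le0 leNgt; apply/negP => a0.
have [n An] := geometric_small A a0.
by have := lt_le_trans An (aA n); rewrite ltxx.
Qed.

Lemma le_geometric (a b A : R) : (forall n, a <= b + A / 2 ^+ n) -> a <= b.
Proof.
move=> aA; rewrite leNgt -subr_gt0; apply/negP => ab.
have [n An] := geometric_small A ab.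
by have := aA n; lra.
Qed.

(** [a] is nondecreasing, [b] nonincreasing and every [a m] is at most every [b n]; the supremum of
    [a] thus lies between [a n] and [b n] for all [n], which gives the limit together with the
    rate. *)
Lemma geometric_cauchy (x : nat -> R) (C : R) :
  (forall n, `|x n.+1 - x n| <= C / 2 ^+ n) ->
  exists l, forall n, `|x n - l| <= 2 * C / 2 ^+ n.
Proof.
move=> xC.
pose a n := x n - 2 * C / 2 ^+ n; pose b n := x n + 2 * C / 2 ^+ n.
have half n : 2 * C / 2 ^+ n = C / 2 ^+ n + 2 * C / 2 ^+ n.+1.
  by rewrite exprS; field; rewrite expf_neq0.
have nda : {homo a : n m / (n <= m)%N >-> n <= m}.
  apply: homo_leq => [|y u v|n]; [exact: lexx|exact: le_trans|].
  by have := xC n; rewrite ler_norml /a (half n) => /andP[]; lra.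
have nib : {homo b : n m / (n <= m)%N >-> m <= n}.
  apply: homo_leq => [|y u v h1 h2|n].
  - exact: lexx.
  - exact: le_trans h2 h1.
  - by have := xC n; rewrite ler_norml /b (half n) => /andP[]; lra.
have C0 : 0 <= C by have := le_trans (normr_ge0 _) (xC 0); rewrite expr0 divr1.
have ab n : a n <= b n.
  have : 0 <= 2 * C / 2 ^+ n by rewrite divr_ge0 ?exprn_ge0// mulr_ge0.
  by rewrite /a /b; lra.
have abmn m n : a m <= b n.
  have [mn|/ltnW nm] := leqP m n; first exact: le_trans (nda _ _ mn) (ab n).
  exact: le_trans (ab m) (nib _ _ nm).
exists (sup (range a)) => n.
have h1 : a n <= sup (range a).
  apply: ub_le_sup; last by exists n.
  by exists (b 0) => _ [m _ <-].
have h2 : sup (range a) <= b n.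
  by apply: ge_sup; [exists (a 0), 0|move=> _ [m _ <-]].
by rewrite ler_norml; move: h1 h2; rewrite /a /b; lra.
Qed.

Lemma uniform_geometric_continuous (f : nat -> R -> R) (u : R -> R) (A : R) :
  (forall n, continuous (f n)) -> (forall n r, `|f n r - u r| <= A / 2 ^+ n) ->
  continuous u.
Proof.
move=> cf fu x; apply/cvgrPdist_le => e e0.
have e3 : 0 < e / 3 by rewrite divr_gt0.
have [n An] := geometric_small A e3.
have /cvgrPdist_le/(_ _ e3) := cf n x; apply: filterS => y fxy.
have -> : u x - u y = (f n x - f n y) - (f n x - u x) + (f n y - u y) by ring.
apply: (le_trans (ler_normD _ _)).
apply: (@le_trans _ _ ((`|f n x - f n y| + `|f n x - u x|) + `|f n y - u y|)).
  by rewrite lerD2r ler_normB.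
by have := fu n x; have := fu n y; move: fxy An => /=; lra.
Qed.

End GeometricApproximation.

(** * Picard iteration in a weighted norm *)

Section InitialValueProblem.
Context {R : realType} (N : nat) (N0 : (0 < N)%N).
Implicit Types (k u v : R -> R) (d r : R).

Lemma green_lin k1 k2 (a b r : R) : continuous k1 -> continuous k2 ->
  green N (fun t => a * k1 t + b * k2 t) r = a * green N k1 r + b * green N k2 r.
Proof.
move=> c1 c2; rewrite /green -primitive_lin//; last 3 first.
- exact: continuous_rmean_sqrt.
- exact: continuous_rmean_sqrt.
- exact: sqr_ge0.
congr primitive; apply/funext => s /=.
by rewrite rmean_lin// mulrDl !mulrA.
Qed.

Lemma greenB k1 k2 r : continuous k1 -> continuous k2 ->
  green N (k1 \- k2) r = green N k1 r - green N k2 r.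
Proof.
move=> c1 c2; have -> : k1 \- k2 = (fun t => 1 * k1 t + -1 * k2 t).
  by apply/funext => t; rewrite /= mul1r mulN1r.
by rewrite (green_lin _ _ _ c1 c2) mul1r mulN1r.
Qed.

Lemma green_cst0 r : green N (cst 0) r = 0.
Proof.
have e : cst 0 = (fun t : R => 0 * t + 0 * t) by apply/funext => t; rewrite mul0r addr0.
have cid : continuous (id : R -> R) by move=> t; exact: cvg_id.
by rewrite e (green_lin _ _ _ cid cid) !mul0r addr0.
Qed.

Lemma eq_green k1 k2 r : continuous k1 -> continuous k2 ->
  (forall t, 0 <= t <= `|r| -> k1 t = k2 t) -> green N k1 r = green N k2 r.
Proof.
move=> c1 c2 e; rewrite -(green_normr N k1) -(green_normr N k2).
apply/eqP; rewrite -subr_eq0 -greenB//; apply/eqP.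
have dz (t : R) : is_derive t 1 (green N (k1 \- k2)) (t * rmean N (k1 \- k2) t).
  by apply: is_derive_green => // s; apply: cvgB; [exact: c1|exact: c2].
have : `|green N (k1 \- k2) `|r| - green N (k1 \- k2) 0|
    <= (cst 0 : R -> R) `|r| - (cst 0 : R -> R) 0.
  apply: (@derive_norm_le _ _ _ (cst 0) (cst 0)) => // t tr.
  - exact: is_derive_continuous (dz t).
  - exact: cvg_cst.
  - rewrite rmeanB// (eq_rmean (k2 := k2) N0)// ?subrr ?mulr0 ?normr0//.
    by move=> s st; apply: e; move: st; rewrite ger0_norm; lra.
by rewrite green0 subr0 subrr normr_le0 => /eqP.
Qed.

(* The Picard iteration contracts by 1/2 for the norm weighted by [weight]. *)
Definition weight (L r : R) : R := expR (L * r ^+ 2).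

Lemma weight_ge1 (L r : R) : 0 < L -> 1 <= weight L r.
Proof. by move=> L0; rewrite -expR0 ler_expR mulr_ge0 ?sqr_ge0// ltW. Qed.

Lemma weight_le (L r t : R) : 0 < L -> 0 <= t <= r -> weight L t <= weight L r.
Proof.
move=> L0 tr; rewrite ler_expR ler_wpM2l ?(ltW L0)//.
by rewrite ler_sqr ?nnegrE; lra.
Qed.

Lemma is_derive_weight (L r : R) :
  is_derive r 1 (weight L) (2 * L * r * weight L r).
Proof.
have h1 : is_derive r 1 (fun x : R => L * x ^+ 2) (2 * L * r).
  apply: (is_derive_eq (is_deriveZ L (is_derive_expn 2 r))).
  by rewrite /GRing.scale/= expr1; ring.
have := @is_derive1_comp _ expR (fun x : R => L * x ^+ 2) r _ _
  (is_derive_expR _) h1.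
by rewrite mulrC.
Qed.

(** [c / (2 * L) * weight L] has derivative [c * t * weight L t], which bounds [|t * rmean N k t|]
    because the weight is nondecreasing. The [2 * L] in the denominator, against the Lipschitz
    constant [L], is where the contraction factor 1/2 comes from. *)
Lemma green_weight_le k (L c r : R) : continuous k -> 0 < L -> 0 <= c ->
  0 <= r -> (forall t, 0 <= t <= r -> `|k t| <= c * weight L t) ->
  `|green N k r| <= c / (2 * L) * weight L r.
Proof.
move=> ck L0 c0 r0 kc.
have dw (t : R) : is_derive t 1 (fun t => c / (2 * L) * weight L t)
    (c * t * weight L t).
  apply: (is_derive_eq (is_deriveZ (c / (2 * L)) (is_derive_weight L t))).
  by rewrite /GRing.scale/=; field; rewrite gt_eqF.
have := derive_norm_le r0 (fun t _ => is_derive_green N0 t ck) (fun t _ => dw t).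
rewrite green0 subr0 => h.
apply: (@le_trans _ _ (c / (2 * L) * weight L r - c / (2 * L) * weight L 0)).
  apply: h => t tr.
  - exact: green_continuous.
  - exact: is_derive_continuous (dw t).
  - have t0 : 0 <= t by lra.
    rewrite normrM (ger0_norm t0) (mulrC c) -mulrA ler_wpM2l//.
    apply: (@le_trans _ _ (c * weight L t / N%:R)).
      apply: rmean_norm_le => // s st; apply: (@le_trans _ _ (c * weight L s)).
        by apply: kc; lra.
      by rewrite ler_wpM2l// weight_le.
    rewrite ler_pdivrMr ?ltr0n// ler_peMr// ?ler1n//.
    by rewrite mulr_ge0// expR_ge0.
rewrite lerBlDr lerDl mulr_ge0 ?expR_ge0//.
by rewrite divr_ge0// mulr_ge0// ltW.
Qed.

(** Composition with it makes the iterates continuous on the whole line while their values are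
    controlled on [[0, 1]] alone. *)
Definition clamp01 r : R := Num.min `|r| 1.

Lemma clamp01_itv r : 0 <= clamp01 r <= 1.
Proof. by rewrite /clamp01 le_min normr_ge0 ler01 ge_min lexx orbT. Qed.

Lemma clamp01_id r : 0 <= r <= 1 -> clamp01 r = r.
Proof. by move=> /andP[r0 r1]; rewrite /clamp01 ger0_norm//; apply/min_idPl. Qed.

Lemma clamp01_continuous : continuous clamp01.
Proof.
move=> r; apply: (@continuous_min _ _ Num.norm (cst 1)) => //.
  exact: norm_continuous.
exact: cvg_cst.
Qed.

Variables (H : R -> R -> R) (L : R).
Hypothesis (L0 : 0 < L).
Hypothesis cH : forall u, continuous u -> continuous (fun s => H s (u s)).
Hypothesis HL : forall s a b, `|H s a - H s b| <= L * `|a - b|.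

Fixpoint picard d n : R -> R :=
  match n with
  | 0 => cst d
  | m.+1 => fun r => d + green N (fun s => H s (picard d m s)) (clamp01 r)
  end.

Lemma picard_continuous d n : continuous (picard d n).
Proof.
elim: n => [|n IH] /=; first exact: continuous_cst.
apply: continuous_add; first exact: continuous_cst.
apply: continuous_compr; first exact: clamp01_continuous.
by apply: green_continuous => //; exact: cH.
Qed.

Lemma picard_clamp d n r : picard d n r = picard d n (clamp01 r).
Proof.
by case: n => [//|n] /=; rewrite (@clamp01_id (clamp01 r))// clamp01_itv.
Qed.

Lemma green_contraction u v (c r : R) : continuous u -> continuous v -> 0 <= c ->
  0 <= r -> (forall t, 0 <= t <= r -> `|u t - v t| <= c * weight L t) ->
  `|green N (fun s => H s (u s)) r - green N (fun s => H s (v s)) r|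
  <= c / 2 * weight L r.
Proof.
move=> cu cv c0 r0 uv; rewrite -greenB; [|exact: cH..].
have -> : c / 2 = L * c / (2 * L) by field; rewrite gt_eqF.
apply: green_weight_le => //.
- by move=> s; apply: cvgB; exact: cH.
- by rewrite mulr_ge0// ltW.
- move=> t tr /=; apply: (le_trans (HL _ _ _)).
  by rewrite -mulrA ler_wpM2l ?(ltW L0)// uv.
Qed.

Lemma picard_step d : exists2 C, 0 <= C & forall n r, 0 <= r <= 1 ->
  `|picard d n.+1 r - picard d n r| <= C / 2 ^+ n * weight L r.
Proof.
have c0 : continuous (fun r => `|green N (fun s => H s d) r|).
  apply: continuous_compr; last exact: norm_continuous.
  by apply: green_continuous => //; apply: (cH (u := cst d)); exact: continuous_cst.
have [c _ kc] := @EVT_max R _ 0 1 ler01 (continuous_subspaceT c0).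
exists `|green N (fun s => H s d) c|; first exact: normr_ge0.
set C := `|green N (fun s => H s d) c|.
elim=> [|n IH] r r01.
  rewrite /= clamp01_id// addrAC subrr add0r expr0 divr1.
  apply: (@le_trans _ _ C); first by apply: kc; rewrite in_itv.
  by rewrite ler_peMr ?weight_ge1 ?normr_ge0.
have /andP[r0 r1] := r01.
rewrite -[picard d n.+2 r]/(d + green N (fun s => H s (picard d n.+1 s)) (clamp01 r)).
rewrite -[picard d n.+1 r]/(d + green N (fun s => H s (picard d n s)) (clamp01 r)).
rewrite clamp01_id// opprD addrACA subrr add0r.
apply: (@le_trans _ _ (C / 2 ^+ n / 2 * weight L r)).
  apply: green_contraction => //; [exact: picard_continuous..| |].
    by rewrite divr_ge0 ?exprn_ge0 ?normr_ge0.
  by move=> t tr; apply: IH; lra.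
by rewrite exprSr invfM mulrA.
Qed.

(** The last two clauses are the form in which uniqueness is used later: Lipschitz dependence on the
    initial value, uniform in [r], and constancy of the solution that starts at a zero of [H]. Both
    are proved on the iterates. *)
Theorem ivp : exists u : R -> R -> R,
  [/\ forall d, continuous (u d),
      forall d r, 0 <= r <= 1 ->
        u d r = d + green N (fun s => H s (u d s)) r,
      forall d e r, 0 <= r <= 1 -> `|u d r - u e r| <= 2 * expR L * `|d - e| &
      forall d, (forall s, H s d = 0) -> forall r, u d r = d].
Proof.
have ex d : exists u : R -> R, exists2 C, 0 <= C & forall n r,
    `|picard d n r - u r| <= 2 * C / 2 ^+ n * weight L (clamp01 r).
  have [C C0 PC] := picard_step d.
  have /choice[u uP] : forall r, exists l, forall n,
      `|picard d n r - l| <= 2 * (C * weight L (clamp01 r)) / 2 ^+ n.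
    move=> r; apply: geometric_cauchy => n; rewrite mulrAC.
    rewrite picard_clamp (picard_clamp d n); apply: PC; exact: clamp01_itv.
  exists u, C => // n r; apply: (le_trans (uP r n)).
  by rewrite le_eqVlt; apply/orP; left; apply/eqP; ring.
have /choice[u uP] := ex.
have w1 r : weight L (clamp01 r) <= expR L.
  have -> : expR L = weight L 1 by rewrite /weight expr1n mulr1.
  exact: weight_le (clamp01_itv r).
have cu d : continuous (u d).
  have [C C0 PC] := uP d.
  apply: (@uniform_geometric_continuous _ (picard d) _ (2 * C * expR L)).
    exact: picard_continuous.
  move=> n r; apply: le_trans (PC n r) _; rewrite mulrAC ler_wpM2r ?invr_ge0 ?exprn_ge0//.
  by rewrite ler_wpM2l// mulr_ge0.
exists u; split=> //.
- move=> d r r01; have [C C0 PC] := uP d; have /andP[r0 r1] := r01.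
  apply/eqP; rewrite -subr_eq0; apply/eqP.
  apply: (@le_geometric_eq0 _ _ (2 * C * expR L)) => n.
  set X := d + _.
  have h1 : `|u d r - picard d n.+1 r| <= C / 2 ^+ n * weight L r.
    rewrite distrC; apply: le_trans (PC n.+1 r) _; rewrite clamp01_id//.
    rewrite ler_wpM2r ?expR_ge0//.
    by rewrite exprS le_eqVlt; apply/orP; left; apply/eqP; field; rewrite expf_neq0.
  have h2 : `|picard d n.+1 r - X| <= C / 2 ^+ n * weight L r.
    rewrite -[picard d n.+1 r]/(d + green N (fun s => H s (picard d n s)) (clamp01 r)).
    have sub2 (a b c : R) : c + a - (c + b) = a - b by ring.
    rewrite (clamp01_id r01) sub2.
    have -> : C / 2 ^+ n = (2 * C / 2 ^+ n) / 2 by field; rewrite expf_neq0.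
    apply: green_contraction => //; first exact: picard_continuous.
      by rewrite divr_ge0 ?exprn_ge0// mulr_ge0.
    move=> t tr; have := PC n t; rewrite clamp01_id//; lra.
  have -> : u d r - X = (u d r - picard d n.+1 r) + (picard d n.+1 r - X) by ring.
  apply: (le_trans (ler_normD _ _)); apply: (le_trans (lerD h1 h2)).
  rewrite -mulrDl (_ : C / 2 ^+ n + C / 2 ^+ n = 2 * C / 2 ^+ n); last by ring.
  rewrite mulrAC ler_wpM2r ?invr_ge0 ?exprn_ge0// ler_wpM2l ?mulr_ge0//.
  by have := w1 r; rewrite clamp01_id.
- move=> d e r r01; have [C C0 PC] := uP d; have [D D0 PD] := uP e.
  (* The bound reproduces itself: [|d - e| + |d - e| * weight L t <= 2 * |d - e| * weight L t], as
     the weight is at least 1. *)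
  have pde n t : 0 <= t <= 1 ->
      `|picard d n t - picard e n t| <= 2 * `|d - e| * weight L t.
    elim: n t => [|n IH] t t01 /=.
      have := weight_ge1 t L0; have := normr_ge0 (d - e); nra.
    rewrite clamp01_id//; have /andP[t0 t1] := t01.
    set A := green N _ t; set A' := green N _ t.
    have h : `|A - A'| <= (2 * `|d - e|) / 2 * weight L t.
      have de0 : 0 <= 2 * `|d - e| by rewrite mulr_ge0.
      apply: (green_contraction (@picard_continuous d n) (@picard_continuous e n) de0 t0).
      by move=> y yt; apply: IH; lra.
    have -> : d + A - (e + A') = (d - e) + (A - A') by ring.
    apply: (le_trans (ler_normD _ _)).
    have := weight_ge1 t L0; have := normr_ge0 (d - e); nra.
  apply: (@le_geometric _ _ _ ((2 * C + 2 * D) * expR L)) => n.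
  have wr : weight L r <= expR L by have := w1 r; rewrite clamp01_id.
  have i0 : 0 <= (2 ^+ n)^-1 :> R by rewrite invr_ge0 exprn_ge0.
  have h1 := PC n r; have h2 := PD n r; have h3 := pde n r r01.
  rewrite clamp01_id// in h1 h2.
  have -> : u d r - u e r = - (picard d n r - u d r) + (picard e n r - u e r)
    + (picard d n r - picard e n r) by ring.
  apply: (le_trans (ler_normD _ _)).
  apply: (@le_trans _ _ ((2 * C / 2 ^+ n * weight L r + 2 * D / 2 ^+ n * weight L r)
     + 2 * `|d - e| * weight L r)).
    apply: lerD => //; apply: (le_trans (ler_normD _ _)).
    by rewrite normrN lerD.
  have h4 : 2 * C / 2 ^+ n * weight L r <= 2 * C / 2 ^+ n * expR L.
    by rewrite ler_wpM2l// mulr_ge0// mulr_ge0.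
  have h5 : 2 * D / 2 ^+ n * weight L r <= 2 * D / 2 ^+ n * expR L.
    by rewrite ler_wpM2l// mulr_ge0// mulr_ge0.
  have h6 : 2 * `|d - e| * weight L r <= 2 * `|d - e| * expR L.
    by rewrite ler_wpM2l// mulr_ge0.
  apply: (le_trans (lerD (lerD h4 h5) h6)).
  by rewrite le_eqVlt; apply/orP; left; apply/eqP; ring.
- move=> d Hd r; have [C C0 PC] := uP d.
  have pd n t : picard d n t = d.
    elim: n t => [//|n IH] t /=.
    rewrite (@eq_green _ (cst 0)).
    + by rewrite green_cst0 addr0.
    + by apply: cH; exact: picard_continuous.
    + exact: continuous_cst.
    + by move=> y _; rewrite IH.
  apply/esym/eqP; rewrite -subr_eq0; apply/eqP.
  apply: (@le_geometric_eq0 _ _ (2 * C * weight L (clamp01 r))) => n.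
  by have := PC n r; rewrite pd mulrAC.
Qed.

End InitialValueProblem.

(** * Radial eigenfunctions *)

Section RadialDensity.
Context {R : realType} (N : nat) (N0 : (0 < N)%N).
Local Notation E := 'rV[R]_N.
Local Notation B := (uball N : set E).
Local Notation leb := (lebesgue_rV N : {measure set E -> \bar R}).
Implicit Types (v : E -> R) (A : set R).
Local Notation integrable f := (leb.-integrable B (EFin \o f)).

Let mB : measurable B := @measurable_uball R N.

Lemma measurable_indic_enorm A : measurable A ->
  measurable_fun B (fun x => \1_A (enorm x) : R).
Proof.
move=> mA; apply: measurable_ball_fun.
exact: (measurableT_comp (measurable_indic mA) (@measurable_enorm R N)).
Qed.

Lemma integrable_mul_indic v A : integrable v -> measurable A ->
  integrable (fun x => v x * \1_A (enorm x)).
Proof.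
move=> iv mA; apply: (integrable_mul_bounded (C := 1) mB iv).
  exact: measurable_indic_enorm.
by move=> x _; rewrite ger0_norm indicE; case: (_ \in _).
Qed.

(** A monotone class argument: indicators of open rays are limits of continuous functions, the rays
    are stable under intersection, and the sets with vanishing integral form a lambda-system, which
    therefore contains all Borel sets. *)
Lemma Rintegral_mul_indic0 v : integrable v ->
  (forall q : R -> R, continuous q -> \int[leb]_(x in B) (v x * q (enorm x)) = 0) ->
  forall A, measurable A -> \int[leb]_(x in B) (v x * \1_A (enorm x)) = 0.
Proof.
move=> iv vq; have mv := integrable_measurable iv.
pose H A := measurable A /\ \int[leb]_(x in B) (v x * \1_A (enorm x)) = 0.
have inv : integrable (fun x => `|v x|) by exact: integrable_norm.
have lim (F : nat -> R -> R) A :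
    (forall n, measurable_fun B (fun x => F n (enorm x))) -> measurable A ->
    (forall n r, `|F n r| <= 1) ->
    (forall r, F n r @[n --> \oo] --> (\1_A r : R)) ->
    (forall n, \int[leb]_(x in B) (v x * F n (enorm x)) = 0) ->
    \int[leb]_(x in B) (v x * \1_A (enorm x)) = 0.
  move=> mF mA F1 FA F0.
  have : \int[leb]_(x in B) (v x * F n (enorm x)) @[n --> \oo] -->
      \int[leb]_(x in B) (v x * \1_A (enorm x)).
    apply: (@Rintegral_dominated _ _ _ leb B mB _ _ (fun x => `|v x|)) => //.
    - by move=> n; apply: measurable_funM.
    - by apply: measurable_funM => //; exact: measurable_indic_enorm.
    - by move=> x _; apply: cvgM; [exact: cvg_cst|exact: FA].
    - by move=> n x _; rewrite normrM ler_piMr.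
  move=> h; apply: (cvg_uniq _ h (cvg_cst 0)) => n; exact: F0.
have HG : [set A : set R | exists x, A = `]x, +oo[%classic] `<=` H.
  move=> _ [a ->]; split; first exact: measurable_itv.
  pose F (n : nat) (r : R) := Num.min (n%:R * pospart (r - a)) 1.
  have cF n : continuous (F n).
    move=> r; apply: (@continuous_min _ _ (fun r => n%:R * pospart (r - a)) (cst 1)).
      apply: (@continuous_mul _ _ (cst n%:R)); first exact: continuous_cst.
      apply: (@continuous_compr _ _ (fun r => r - a)); last exact: pospart_continuous.
      by apply: (@continuous_sub _ _ id); [move=> s; exact: cvg_id|exact: continuous_cst].
    exact: cvg_cst.
  apply: (lim F).
  - move=> n; apply: continuous_ball_measurable.
    exact: continuous_compr (@enorm_continuous R N) (cF n).
  - exact: measurable_itv.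
  - move=> n r; rewrite ger0_norm ?ge_min ?lexx ?orbT//.
    by rewrite le_min ler01 mulr_ge0// pospart_ge0.
  - move=> r; rewrite indicE mem_setE in_itv/= andbT.
    have [ar|ra] := ltP a r; last first.
      rewrite (_ : (fun n => _) = cst 0); first exact: cvg_cst.
      by apply/funext => n; rewrite /F pospart_neg ?subr_le0// mulr0 min_l.
    have ra : 0 < r - a by rewrite subr_gt0.
    apply: cvg_near_cst.
    have [m _ mP] : \forall n \near \oo, (r - a)^-1 <= n%:R by exact: nbhs_infty_ger.
    exists m => // n /mP h; apply/min_idPr.
    by rewrite pospart_pos ?(ltW ra)// -ler_pdivrMr// mul1r.
  - by move=> n; exact: vq.
move=> A mA; suff : H A by case.
have mG : (@measurable _ (measurableTypeR R)) = <<s setT, @RGenOInfty.G R >>.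
  exact: RGenOInfty.measurableE.
have GI : setI_closed (@RGenOInfty.G R).
  move=> _ _ [a ->] [b ->]; exists (Num.max a b).
  by apply/seteqP; split => x /=; rewrite !in_itv/= !andbT gt_max;
    [move=> [-> ->]|move=> /andP[]].
apply: (@lambda_system_subset _ _ GI setT H) => //; last by rewrite -mG.
split=> //.
- split; first exact: measurableT.
  rewrite -(vq (cst 1)); last exact: continuous_cst.
  by apply: eq_Rintegral => x _; rewrite indicT.
- move=> A1 A2 A21 [mA1 i1] [mA2 i2]; split; first exact: measurableD.
  have ie : forall A, measurable A -> integrable (fun x => v x * \1_A (enorm x)).
    by move=> *; exact: integrable_mul_indic.
  rewrite -[RHS](subrr (0 : R)) -{1}i1 -i2 -RintegralB//; [|exact: ie..].
  apply: eq_Rintegral => x _; rewrite -mulrBr !indicE; congr (_ * _).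
  move: (enorm x) => r; have [h2|h2] := pselect (A2 r).
    by rewrite (mem_set h2) (mem_set (A21 _ h2)) memNset ?subrr// => -[].
  rewrite (memNset h2) subr0; have [h1|h1] := pselect (A1 r).
    by rewrite !mem_set.
  by rewrite !memNset// => -[].
- move=> F ndF HF; have mF n : measurable (F n) by case: (HF n).
  split; first exact: bigcupT_measurable.
  apply: (lim (fun n => \1_(F n))).
  + by move=> n; exact: measurable_indic_enorm.
  + exact: bigcupT_measurable.
  + by move=> n r; rewrite ger0_norm indicE; case: (_ \in _).
  + move=> r; apply: cvg_near_cst; rewrite indicE.
    have [|nF] := boolP (r \in _).
      rewrite inE => -[m _ Fm]; exists m => // n mn; rewrite indicE mem_set//.
      by move: r Fm; exact/subsetPset/ndF.
    near=> n; rewrite indicE memNset// => Fn; move/negP: nF; apply.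
    by rewrite inE; exists n.
  + by move=> n; case: (HF n).
Unshelve. all: by end_near. Qed.

(** [v x] is [V (enorm x)], where [V] is the restriction of [v] to a half-line, measurable since
    measurability here is Borel. The difference of the indicators of [V > 0] and [V < 0] is an
    admissible weight and turns [v] into [|v|]. *)
Lemma radial_density v : integrable v -> radial v ->
  (forall q : R -> R, continuous q -> \int[leb]_(x in B) (v x * q (enorm x)) = 0) ->
  {ae leb, forall x, B x -> v x = 0}.
Proof.
move=> iv rv vq; have mv := integrable_measurable iv.
have vA := Rintegral_mul_indic0 iv vq.
pose i0 := Ordinal N0.
pose e (r : R) : E := r *: delta_mx ord0 i0.
have ee r : 0 <= r -> enorm (e r) = r.
  move=> r0; rewrite /e enormZ (ger0_norm r0) -[RHS]mulr1; congr (_ * _).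
  rewrite /enorm (bigD1 i0)//= mxE !eqxx expr1n big1 ?addr0 ?sqrtr1//.
  by move=> l lj; rewrite mxE (negbTE lj) andbF expr0n.
have me : measurable_fun setT e.
  apply: measurable_fun_rVP => j.
  rewrite (_ : (fun t => _) = (fun t : R => t * (j == i0)%:R)).
    by apply: measurable_funM => //; exact: measurable_cst.
  by apply/funext => t; rewrite !mxE.
pose V (r : R) := (v \_ B) (e r).
have mV : measurable_fun setT V.
  have mvB : measurable_fun setT (v \_ B) by exact: (measurable_restrictT _ mB).1 mv.
  exact: (measurableT_comp mvB me).
have vV x : B x -> V (enorm x) = v x.
  move=> Bx; have Be : B (e (enorm x)).
    by rewrite /uball/= ee ?enorm_ge0.
  by rewrite /V patchE mem_set//; apply: rv => //; rewrite ee ?enorm_ge0.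
pose A1 := V @^-1` `]0, +oo[; pose A2 := V @^-1` `]-oo, 0[.
have mA1 : measurable A1 by rewrite -[X in measurable X]setTI; exact: mV.
have mA2 : measurable A2 by rewrite -[X in measurable X]setTI; exact: mV.
have norm0 : \int[leb]_(x in B) `|v x| = 0.
  rewrite -[RHS](subrr (0 : R)) -{1}(vA _ mA1) -(vA _ mA2).
  rewrite -RintegralB//; [|exact: integrable_mul_indic..].
  apply: eq_Rintegral => x; rewrite inE => Bx.
  rewrite -mulrBr !indicE; have Vx := vV x Bx.
  have a1 : A1 (enorm x) <-> 0 < v x by rewrite /A1 /preimage/= in_itv/= andbT Vx.
  have a2 : A2 (enorm x) <-> v x < 0 by rewrite /A2 /preimage/= in_itv/= Vx.
  have [v0|v0|v0] := ltgtP (v x) 0.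
  - rewrite memNset; last by move=> /a1 /(lt_trans v0); rewrite ltxx.
    by rewrite (mem_set (a2.2 v0)) sub0r mulrN1 ltr0_norm.
  - rewrite (mem_set (a1.2 v0)) memNset; last by move=> /a2 /(lt_trans v0); rewrite ltxx.
    by rewrite subr0 mulr1 gtr0_norm.
  - by rewrite v0 mul0r normr0.
have inv : integrable (fun x => `|v x|) by exact: integrable_norm.
have mEv : measurable_fun B (EFin \o v) by exact/measurable_EFinP.
have /(ae_eq_integral_abs leb mB mEv) : (\int[leb]_(x in B) `|(EFin \o v) x| = 0)%E.
  have := fineK (integrable_fin_num mB inv).
  by rewrite -[fine _]/(\int[leb]_(x in B) `|v x|) norm0 => /esym.
by apply: filterS => x /= + Bx => /(_ Bx) [].
Qed.

(* Otherwise, solving the forced radial equation with vanishing normal derivative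
   at 1 for an arbitrary right-hand side [q] would give [v] orthogonal to [q]. *)
Theorem radial_eigenvalue_ode (lam : R) : 1 < lam -> radial_eigenvalue N lam ->
  exists psi : R -> R, [/\ continuous psi,
    forall r, 0 <= r <= 1 -> psi r = 1 - (lam - 1) * green N psi r &
    rmean N psi 1 = 0].
Proof.
move=> lam1 [v [sv rv nv]].
set kap := lam - 1; have kap0 : 0 < kap by rewrite /kap; lra.
have kapn0 : kap != 0 by rewrite gt_eqF.
have cons (q : R -> R) : continuous q -> exists U : R -> R -> R,
    (forall d, continuous (U d)) /\ (forall d r, 0 <= r <= 1 ->
        U d r = d + green N (fun s => q s - kap * U d s) r).
  move=> cq; have [||U [cU eU _ _]] := @ivp R N N0 (fun s a => q s - kap * a) kap kap0.
  - move=> u cu; apply: continuous_sub => //.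
    by apply: continuous_mul => //; exact: continuous_cst.
  - move=> s a b; rewrite (_ : _ - _ = kap * (b - a)); last by ring.
    by rewrite normrM (gtr0_norm kap0) distrC.
  - by exists U.
have c0 : continuous (cst 0 : R -> R) by exact: continuous_cst.
have [U [cU eU]] := cons _ c0.
pose psi := U 1; have cpsi : continuous psi by exact: cU.
have green_psi r : green N (fun s => 0 - kap * psi s) r = - kap * green N psi r.
  have -> : (fun s => 0 - kap * psi s) = (fun s => (- kap) * psi s + 0 * psi s).
    by apply/funext => s; ring.
  by rewrite (green_lin N0 _ _ _ cpsi cpsi) mul0r addr0.
have epsi r : 0 <= r <= 1 -> psi r = 1 - kap * green N psi r.
  by move=> r01; rewrite -mulNr -green_psi; exact: eU.
exists psi; split=> //; apply/eqP/negP => /negP w0; apply: nv.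
have [g [h [[[v2 _] _] _ _]]] := sv.
have iv : integrable v.
  by case: v2 => m2 i2; exact: (sqr_integrable_integrable mB (uball_lty N)).
apply: radial_density => // q cq.
have [P0 [cP0 eP0]] := cons q cq.
pose p0 := P0 0; have cp0 : continuous p0 by exact: cP0.
pose k0 s := q s - kap * p0 s.
have ck0 : continuous k0.
  apply: continuous_sub => //; apply: continuous_mul => //; exact: continuous_cst.
(* The value that makes [rmean N k 1] vanish; it exists because [rmean N psi 1] is not 0. *)
pose c := rmean N k0 1 / (kap * rmean N psi 1).
(* On [[0, 1]], [c + green N k] is [p0 + c * psi]: a particular solution of the forced equation plus
   a multiple of the homogeneous one. *)
pose k s := 1 * k0 s + (- kap * c) * psi s.
have ck : continuous k.
  apply: continuous_add; apply: continuous_mul => //; exact: continuous_cst.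
have w1 : rmean N k 1 = 0.
  rewrite (rmean_lin N _ _ _ ck0 cpsi) /c; field.
  by rewrite kapn0 w0.
have ek r : 0 <= r <= 1 -> k r + kap * (c + green N k r) = q r.
  move=> r01; have e1 := eP0 0 r r01; rewrite -/p0 -/k0 add0r in e1.
  rewrite (green_lin N0 _ _ _ ck0 cpsi) -e1.
  have -> : k r = q r - kap * p0 r - kap * c * psi r by rewrite /k /k0; ring.
  by rewrite (epsi r r01); ring.
rewrite -[RHS](neumann_green N0 c sv ck w1).
apply: eq_Rintegral => x; rewrite inE => Bx; congr (_ * _).
rewrite /radial_fun -/kap ek// enorm_ge0/= ltW//.
Qed.

End RadialDensity.

(** * The cut-off nonlinearity *)

Section Nonlinearity.
Context {R : realType} (f df : R -> R).
Hypothesis fC1 : C1_nonneg f df.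

Lemma dist_min_le (a b c : R) : `|Num.min a c - Num.min b c| <= `|a - b|.
Proof.
have [ac|ac] := leP a c; have [bc|bc] := leP b c.
- by [].
- by rewrite !ler0_norm; lra.
- by rewrite !ger0_norm; lra.
- by rewrite subrr normr0.
Qed.

Lemma dist_max_le (a b c : R) : `|Num.max a c - Num.max b c| <= `|a - b|.
Proof.
have [ac|ac] := leP c a; have [bc|bc] := leP c b.
- by [].
- by rewrite !ger0_norm; lra.
- by rewrite !ler0_norm; lra.
- by rewrite subrr normr0.
Qed.

Lemma C1_nonneg_is_derive (s : R) : 0 < s -> is_derive s 1 f (df s).
Proof.
move=> s0; have fs := fC1.1 s (ltW s0).
have h : h^-1 *: ((f \o shift s) (h *: 1) - f s) @[h --> (0 : R)^'] --> df s.
  apply/cvgrPdist_le => e e0; have /cvgrPdist_le/(_ e e0) := fs.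
  move=> [r /= r0 rP]; exists (Num.min r s); first by rewrite /= lt_min r0.
  move=> y /=; rewrite sub0r normrN lt_min => /andP[yr ys] y0.
  have ysp : 0 <= y + s by have := ler_norm (- y); rewrite normrN; lra.
  have := rP (y + s); rewrite /= opprD addrA addrAC subrr sub0r normrN.
  move=> /(_ yr); rewrite in_itv/= andbT => h.
  rewrite [y *: 1]mulr1 [_ *: _]mulrC -[X in _ / X](addrK s); apply: h => //.
  by apply: contra_neq y0 => ys0; apply: (addIr s); rewrite add0r.
split; first by apply/cvg_ex; exists (df s).
exact: cvg_lim h.
Qed.

Lemma C1_nonneg_continuous (s : R) : 0 < s -> {for s, continuous df}.
Proof.
move=> s0; have [_ /continuous_within_itvcyP[h _]] := fC1.
by apply: h; rewrite in_itv/= s0.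
Qed.

(** The two-sided derivative is available only at positive points, so the mean value argument runs
    on intervals away from 0; the endpoint 0 is reached through [|f a| <= a] for small [a], which
    follows from the limit of [f s / s]. *)
Lemma C1_nonneg_lipschitz (M : R) : 0 < M -> f 0 = 0 ->
  f s / s @[s --> 0^'+] --> (0 : R) ->
  exists2 K, 0 <= K & forall a b, 0 <= a <= M -> 0 <= b <= M ->
    `|f a - f b| <= K * `|a - b|.
Proof.
move=> M0 f0 flim.
have cn : {within `[0, M], continuous (fun s => `|df s|)}.
  have cd : {within `[0, M], continuous df}.
    apply: continuous_subspaceW fC1.2 => x /=; rewrite !in_itv/= andbT.
    by case/andP.
  by move=> x; apply: (continuous_comp (cd x)); exact: norm_continuous.
have [c _ kc] := EVT_max (ltW M0) cn.
set K := `|df c|; have K0 : 0 <= K by rewrite /K.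
have pos a b : 0 < a -> a <= b -> b <= M -> `|f b - f a| <= K * (b - a).
  move=> a0 ab bM.
  have dl (t : R) : is_derive t 1 (fun t => K * t) K.
    apply: is_derive_eq; rewrite /GRing.scale/=; ring.
  have dfE (t : R) : a < t < b -> is_derive t 1 f (df t).
    by move=> tab; apply: C1_nonneg_is_derive; lra.
  have := derive_norm_le ab dfE (fun t _ => dl t); rewrite -mulrBr; apply.
  - move=> t tab; apply: (is_derive_continuous (d := df t)).
    by apply: C1_nonneg_is_derive; lra.
  - by move=> t _; exact: is_derive_continuous (dl t).
  - by move=> t tab; apply: kc; rewrite in_itv/=; lra.
have zero b : 0 < b <= M -> `|f b| <= K * b.
  move=> /andP[b0 bM]; apply/ler_addgt0Pr => e e0.
  have /cvgrPdist_le/(_ 1 ltr01)[r /= r0 rP] := flim.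
  pose a := Num.min (r / 2) (Num.min b e).
  have a0 : 0 < a by rewrite !lt_min b0 e0 andbT divr_gt0.
  have ab : a <= b by rewrite !ge_min lexx !orbT.
  have ae : a <= e by rewrite !ge_min lexx !orbT.
  have ar : a <= r / 2 by rewrite ge_min lexx.
  have := rP a; rewrite /= !sub0r !normrN (gtr0_norm a0) => /(_ _ a0) fa.
  have {}fa : `|f a| <= a.
    have ar' : a < r by lra.
    by have := fa ar'; rewrite normrM normfV (gtr0_norm a0) ler_pdivrMr// mul1r.
  have -> : f b = (f b - f a) + f a by ring.
  apply: (le_trans (ler_normD _ _)); apply: lerD; last exact: le_trans fa ae.
  by apply: le_trans (pos a b a0 ab bM) _; rewrite ler_wpM2l//; lra.
exists K => // a b aM bM.
wlog ab : a b aM bM / a <= b.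
  move=> H; have [|/ltW] := leP a b; first exact: H.
  by rewrite distrC (distrC a); exact: H.
rewrite distrC (distrC a) (ger0_norm (x := b - a)) ?subr_ge0//.
have [a0|a0] := leP a 0.
  have -> : a = 0 by apply/eqP; rewrite eq_le a0; case/andP: aM.
  rewrite f0 !subr0; have [b0|b0] := leP b 0; last by apply: zero; lra.
  have -> : b = 0 by apply/eqP; rewrite eq_le b0; case/andP: bM.
  by rewrite f0 normr0 mulr0.
by apply: pos => //; lra.
Qed.

Hypothesis f_nondecreasing : forall s t : R, 0 <= s -> s <= t -> f s <= f t.
Hypothesis f0 : f 0 = 0.
Hypothesis f_lim0 : f s / s @[s --> 0^'+] --> (0 : R).

(* [um] is the largest fixed point of [f] below [u0]. Extending [s - f s] by 0
   below [um] makes [h] nonnegative on the whole of [s <= u0], so that solutions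
   staying below [u0] are automatically increasing. *)
Lemma truncated_nonlinearity (u0 lam : R) : 0 < u0 -> f u0 = u0 ->
  1 < lam -> lam < df u0 ->
  exists h L um del, [/\
    [/\ 0 < L, 0 <= um, um < u0 & 0 < del],
    forall a b, `|h a - h b| <= L * `|a - b|,
    [/\ forall s, s <= u0 -> 0 <= h s, forall s, um < s < u0 -> 0 < h s &
        forall s, um <= s -> h s <= s],
    forall s, `|s - u0| < del -> exists2 D, is_derive s 1 h D & D < 1 - lam &
    [/\ h um = 0, h u0 = 0 & forall s, um <= s <= 2 * u0 -> h s = s - f s]].
Proof.
move=> u00 fu0 lam1 lamu.
pose M := 2 * u0; have M0 : 0 < M by rewrite /M; lra.
have [K K0 fK] := C1_nonneg_lipschitz M0 f0 f_lim0.
pose phi s := s - f (Num.min s M).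
pose L := K + 1; have L0 : 0 < L by rewrite /L; lra.
have phiM s : s <= M -> phi s = s - f s by move=> sM; rewrite /phi min_l.
have minM s : 0 <= s -> 0 <= Num.min s M <= M.
  by move=> s0; rewrite le_min s0 ge_min lexx orbT ltW.
have phi_lip a b : 0 <= a -> 0 <= b -> `|phi a - phi b| <= L * `|a - b|.
  move=> a0 b0; rewrite /phi.
  have -> : a - f (Num.min a M) - (b - f (Num.min b M)) =
    (a - b) - (f (Num.min a M) - f (Num.min b M)) by ring.
  apply: (le_trans (ler_normB _ _)); rewrite /L mulrDl mul1r addrC lerD2r.
  apply: le_trans (fK _ _ (minM a a0) (minM b b0)) _.
  by rewrite ler_wpM2l// dist_min_le.
have cdf := C1_nonneg_continuous u00.
have [del del0 [delu dfdel]] : exists2 del, 0 < del &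
    del <= u0 /\ forall s, `|s - u0| < del -> lam < df s.
  have e0 : 0 < df u0 - lam by lra.
  have /cvgrPdist_lt/(_ _ e0)[r /= r0 rP] := cdf.
  exists (Num.min r u0); first by rewrite lt_min r0.
  split; first by rewrite ge_min lexx orbT.
  move=> s; rewrite lt_min => /andP[sr _]; have := rP s.
  by rewrite /= distrC => /(_ sr) h; have := ler_norm (df u0 - df s); lra.
have dphi s : `|s - u0| < del -> is_derive s 1 phi (1 - df s).
  move=> sd; have := sd; rewrite ltr_norml => /andP[s1 s2].
  have s0 : 0 < s by lra.
  have sM : s < M by rewrite /M; lra.
  have h1 := C1_nonneg_is_derive s0.
  have h2 : is_derive s 1 (fun t => t - f t) (1 - df s).
    exact: (is_deriveB (is_derive_id s (1 : R)) h1).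
  apply: (near_eq_is_derive _ h2); near=> t; rewrite phiM//.
  by apply: ltW; near: t; exact: lt_nbhsl.
have phiu0 : phi u0 = 0 by rewrite phiM ?fu0 ?subrr// /M; lra.
have phipos s : u0 - del < s < u0 -> 0 < phi s.
  move=> /andP[s1 s2].
  have near_u0 t : s <= t <= u0 -> `|t - u0| < del.
    by move=> tr; rewrite ler0_norm; lra.
  have [|t tr|c cs] := @MVT_pointwise _ phi (fun t => 1 - df t) s u0 s2.
  - by move=> t tr; apply: dphi; apply: near_u0; lra.
  - by apply: is_derive_continuous (dphi t _); apply: near_u0.
  - have cd : lam < df c by apply: dfdel; apply: near_u0; lra.
    rewrite phiu0 sub0r => e; rewrite -oppr_lt0 e pmulr_llt0; lra.
(* Stopping at [b < u0] keeps the zero [u0] of [phi] out of [Z] and misses nothing below it, as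
   [phi > 0] on the interval from [u0 - del] to [u0]. *)
pose b := u0 - del / 2.
pose Z := [set s | 0 <= s <= b /\ phi s <= 0].
have Z0 : Z 0.
  by split; [rewrite lexx /b/=; lra|rewrite phiM ?f0 ?subrr// ltW].
have ubZ : ubound Z b by move=> s [/andP[]].
have hsZ : has_sup Z by split; [exists 0|exists b].
pose um := sup Z.
have umb : um <= b by apply: ge_sup; [exists 0|].
have um0 : 0 <= um by apply: ub_le_sup; [exists b|].
have phium_le : phi um <= 0.
  rewrite leNgt; apply/negP => pu.
  have [|s [/andP[s0 sb] ps] su] := @sup_adherent _ Z (phi um / L) _ hsZ.
    by rewrite divr_gt0.
  rewrite -/um in su.
  have sum : s <= um by apply: ub_le_sup; [exists b|split=> //; rewrite s0].
  have := phi_lip um s um0 s0; rewrite (ger0_norm (x := um - s)) ?subr_ge0//.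
  have : L * (um - s) < phi um by rewrite mulrC -ltr_pdivlMr//; lra.
  by have := ler_norm (phi um - phi s); lra.
have phium_pos s : um < s < u0 -> 0 < phi s.
  move=> /andP[us su]; have [sb|bs] := leP s b; last first.
    by apply: phipos; rewrite su andbT; move: bs; rewrite /b; lra.
  have s0 : 0 <= s by lra.
  rewrite ltNge; apply/negP => ps; move: us; rewrite ltNge; apply/negP/negPn.
  by apply: ub_le_sup; [exists b|split=> //; rewrite s0].
have umu : um < u0 by apply: le_lt_trans umb _; rewrite /b; lra.
(* If [phi um < 0], the Lipschitz bound would keep [phi] negative slightly to the right of [um],
   against [phium_pos]. *)
have phium : phi um = 0.
  apply/eqP; rewrite eq_le phium_le/= leNgt; apply/negP => pn.
  pose s := um + Num.min (- phi um / (2 * L)) ((u0 - um) / 2).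
  have m0 : 0 < Num.min (- phi um / (2 * L)) ((u0 - um) / 2).
    rewrite lt_min !divr_gt0 ?mulr_gt0//; lra.
  have m1 : Num.min (- phi um / (2 * L)) ((u0 - um) / 2) <= (u0 - um) / 2.
    by rewrite ge_min lexx orbT.
  have m2 : Num.min (- phi um / (2 * L)) ((u0 - um) / 2) <= - phi um / (2 * L).
    by rewrite ge_min lexx.
  have ps : 0 < phi s by apply: phium_pos; rewrite /s; lra.
  have s0 : 0 <= s by rewrite /s; lra.
  have := phi_lip s um s0 um0; have su : s - um = Num.min (- phi um / (2 * L)) ((u0 - um) / 2).
    by rewrite /s; ring.
  rewrite su (gtr0_norm m0) => h1.
  have h2 : L * Num.min (- phi um / (2 * L)) ((u0 - um) / 2) <= - phi um / 2.
    apply: (@le_trans _ _ (L * (- phi um / (2 * L)))); first by rewrite ler_wpM2l// ltW.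
    by rewrite le_eqVlt; apply/orP; left; apply/eqP; field; rewrite gt_eqF.
  by have := ler_norm (phi s - phi um); lra.
pose h s := phi (Num.max s um).
have hE s : um <= s -> h s = phi s by move=> us; rewrite /h max_l.
have max0 s : 0 <= Num.max s um by rewrite le_max um0 orbT.
(* At distance less than [u0 - um] from [u0] one is above [um], so [h] coincides locally with [phi]
   and inherits its derivative. *)
exists h, L, um, (Num.min del (u0 - um)); split.
- by split=> //; rewrite lt_min del0 subr_gt0.
- move=> a c; apply: le_trans (phi_lip _ _ (max0 a) (max0 c)) _.
  by rewrite ler_wpM2l ?dist_max_le// ltW.
- split=> [s su|s us|s us].
  + have [us|us] := leP s um; first by rewrite /h max_r// phium.
    rewrite (hE _ (ltW us)); move: su; rewrite le_eqVlt => /predU1P[->|su].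
      by rewrite phiu0.
    by apply/ltW/phium_pos; rewrite us.
  + by rewrite hE ?phium_pos//; lra.
  + rewrite (hE _ us) /phi gerBl -f0 f_nondecreasing//.
    by case/andP: (minM s (le_trans um0 us)).
- move=> s; rewrite lt_min => /andP[sd su].
  exists (1 - df s); last by have := dfdel s sd; lra.
  apply: (near_eq_is_derive _ (dphi s sd)); near=> t; rewrite hE//.
  apply: ltW; near: t; apply: lt_nbhsr.
  by move: su; rewrite ltr_norml => /andP[]; lra.
- split=> [||s /andP[us sM]].
  + by rewrite hE.
  + by rewrite (hE _ (ltW umu)).
  + by rewrite (hE _ us) phiM.
Unshelve. all: by end_near. Qed.

End Nonlinearity.

(** * Shooting *)

Section Shooting.
Context {R : realType}.

Lemma first_zero (w : R -> R) (r : R) : continuous w -> 0 < w 0 -> 0 <= r ->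
  w r <= 0 -> exists r1, [/\ 0 < r1, r1 <= r, w r1 = 0 &
    forall s, 0 <= s < r1 -> 0 < w s].
Proof.
move=> cw w0 r0 wr.
pose Z := [set s | 0 <= s <= r /\ w s <= 0].
have Zr : Z r by split; rewrite ?r0//=.
have lbZ : lbound Z 0 by move=> s [/andP[]].
have hZ : has_inf Z by split; [exists r|exists 0].
pose r1 := inf Z.
have r1_ge0 : 0 <= r1 by apply: lb_le_inf; [exists r|].
have r1r : r1 <= r by apply: ge_inf => //; exists 0.
have pos s : 0 <= s < r1 -> 0 < w s.
  move=> /andP[s0 sr]; rewrite ltNge; apply/negP => ws.
  have Zs : Z s by split=> //; rewrite s0/=; exact: le_trans (ltW sr) r1r.
  have : r1 <= s by apply: ge_inf => //; exists 0.
  by rewrite leNgt sr.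
have w1 : w r1 = 0.
  apply/eqP; rewrite eq_le; apply/andP; split; rewrite leNgt; apply/negP => h.
  - have /cvgrPdist_lt/(_ _ h)[e /= e0 eP] := cw r1.
    have [z Zz zr] := inf_adherent e0 hZ.
    have rz : r1 <= z by apply: ge_inf => //; exists 0.
    have := eP z; rewrite /= ler0_norm; last by rewrite subr_le0.
    rewrite -/r1 in zr; have [_ wz] := Zz.
    have zr' : - (r1 - z) < e by lra.
    by move=> /(_ zr') h'; have := ler_norm (w r1 - w z); lra.
  - have r1p : 0 < r1.
      rewrite lt_neqAle r1_ge0 andbT; apply/eqP => e.
      by move: h; rewrite -e; lra.
    have h' : 0 < - w r1 by lra.
    have /cvgrPdist_lt/(_ _ h')[e /= e0 eP] := cw r1.
    pose m := Num.min (e / 2) (r1 / 2).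
    have m0 : 0 < m by rewrite lt_min !divr_gt0.
    have me : m <= e / 2 by rewrite ge_min lexx.
    have mr : m <= r1 / 2 by rewrite ge_min lexx orbT.
    have ps : 0 < w (r1 - m) by apply: pos; lra.
    have := eP (r1 - m); rewrite /= opprB addrCA subrr addr0 gtr0_norm//.
    have m_e : m < e by lra.
    move=> /(_ m_e); rewrite distrC => h''.
    by have := ler_norm (w (r1 - m) - w r1); lra.
exists r1; split=> //; rewrite lt_neqAle r1_ge0 andbT; apply/eqP => e.
have w00 : w 0 = w r1 by rewrite -e.
by move: w0; rewrite w00 w1 ltxx.
Qed.

Variables (N : nat) (h : R -> R) (L um u0 del kap : R) (psi : R -> R).
Hypothesis N2 : (2 <= N)%N.
Hypothesis L0 : 0 < L.
Hypothesis um0 : 0 <= um.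
Hypothesis umu : um < u0.
Hypothesis del0 : 0 < del.
Hypothesis hL : forall a b, `|h a - h b| <= L * `|a - b|.
Hypothesis h_ge0 : forall s, s <= u0 -> 0 <= h s.
Hypothesis h_gt0 : forall s, um < s < u0 -> 0 < h s.
Hypothesis h_le : forall s, um <= s -> h s <= s.
Hypothesis hum : h um = 0.
Hypothesis hu0 : h u0 = 0.
Hypothesis kap0 : 0 < kap.
Hypothesis hder : forall s, `|s - u0| < del ->
  exists2 D : R, is_derive s 1 h D & D < - kap.
Hypothesis cpsi : continuous psi.
Hypothesis epsi : forall r : R, 0 <= r <= 1 -> psi r = 1 - kap * green N psi r.
Hypothesis psi1 : rmean N psi 1 = 0.

Let N0 : (0 < N)%N. Proof. exact: leq_trans N2. Qed.

Let NR0 : (0 : R) < N%:R. Proof. by rewrite ltr0n. Qed.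

Let c_le (x : R) : 0 <= x -> x / N%:R <= x.
Proof. by move=> x0; rewrite ler_pdivrMr// ler_peMr// ler1n. Qed.

Let ch : continuous h.
Proof.
move=> x; apply/cvgrPdist_le => e e0; exists (e / L) => /=; first by rewrite divr_gt0.
move=> y; rewrite /ball_/= ltr_pdivlMr// => xy.
by apply: le_trans (hL x y) _; rewrite mulrC ltW.
Qed.

Let rmean0 (k : R -> R) : rmean N k 0 = k 0 / N%:R.
Proof. by rewrite /rmean eqxx. Qed.

Lemma rmean_gt0 (k : R -> R) (r : R) : continuous k -> 0 <= r ->
  (forall s : R, 0 <= s <= r -> 0 < k s) -> 0 < rmean N k r.
Proof.
move=> ck r0 kp; have [c cr kc] := EVT_min r0 (continuous_subspaceT ck).
apply: (@lt_le_trans _ _ (k c / N%:R)).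
  by rewrite divr_gt0// kp//; move: cr; rewrite in_itv.
by apply: rmean_ge_cst => // s sr; apply: kc; rewrite in_itv.
Qed.

Section trajectory.
Variables (d : R) (k : R -> R).
Hypothesis ck : continuous k.
(** Monotonicity of the trajectory is read on [w], the quotient [V' / r]; at 0 its value is
    [k 0 / N], while [V'] vanishes. *)
Let w := rmean N k.
Let V r := d + green N k r.
Hypothesis kV : forall r : R, 0 <= r <= 1 -> k r = h (V r).

Let dV (r : R) : is_derive r 1 V (r * w r).
Proof.
have hg := is_derive_green N0 r ck.
by apply: (is_derive_eq (is_deriveD (is_derive_cst d r (1 : R)) hg)); rewrite add0r.
Qed.

Let cV : continuous V.
Proof. by move=> r; exact: is_derive_continuous (dV r). Qed.

Lemma trajectory0 : V 0 = d.
Proof. by rewrite /V green0 addr0. Qed.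

Lemma trajectory_le (a b : R) : 0 <= a -> a <= b ->
  (forall s : R, 0 <= s < b -> 0 <= w s) -> V a <= V b.
Proof.
move=> a0 ab wp; apply: (derive_ge0_le ab (fun x _ => dV x)).
  by move=> x _; exact: cV.
by move=> x xab; rewrite mulr_ge0 ?wp; lra.
Qed.

(* Compares [V] with the linearization [psi] at [u0] on the interval where
   [psi' < 0], through the Wronskian [shell psi * h V - shell k * psi]. *)
Lemma trajectory_oscillates : um < d < u0 ->
  (forall r : R, 0 <= r <= 1 -> `|V r - u0| < del) ->
  ~ (forall r : R, 0 <= r <= 1 -> 0 <= w r).
Proof.
move=> dr Vd w_ge0.
pose wp := rmean N psi.
(* [psi] obeys its equation on [[0, 1]] only; [Ps] is the right-hand side, differentiable
   everywhere. *)
pose Ps (r : R) : R := 1 - kap * green N psi r.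
have cwp : continuous wp by exact: rmean_continuous.
have cw : continuous w by exact: rmean_continuous.
have psi0 : psi 0 = 1 by rewrite epsi ?lexx ?ler01// green0 mulr0 subr0.
have wp0 : 0 < wp 0 by rewrite /wp rmean0 psi0 divr_gt0.
have [||r1 [r1p r1le wr1 wpos]] := first_zero (r := 1) cwp wp0.
- exact: ler01.
- by rewrite /wp psi1.
have dPs (r : R) : is_derive r 1 Ps (- (kap * (r * wp r))).
  have hg := is_deriveZ kap (is_derive_green N0 r cpsi).
  apply: (is_derive_eq (is_deriveB (is_derive_cst (1 : R) r (1 : R)) hg)).
  by rewrite sub0r.
have cPs : continuous Ps by move=> r; exact: is_derive_continuous (dPs r).
(* Otherwise [psi], nonincreasing on [[0, r1]], would be at least [Ps r1 > 0] there, and its mean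
   [wp r1] could not vanish. *)
have Ps1 : Ps r1 <= 0.
  rewrite leNgt; apply/negP => Pp.
  have : Ps r1 / N%:R <= wp r1.
    apply: rmean_ge_cst => //; first exact: ltW.
    move=> t /andP[t0 t1]; rewrite epsi; last lra.
    rewrite -/(Ps t) -lerN2.
    apply: (@derive_ge0_le _ (fun r => - Ps r) (fun r => kap * (r * wp r)) t r1 t1).
    - by move=> x _; have := is_deriveN (dPs x); rewrite opprK.
    - by move=> x _; apply: cvgN; exact: cPs.
    - move=> x xr; apply: mulr_ge0; first exact: ltW.
      by apply: mulr_ge0; [lra|apply/ltW/wpos; lra].
  by rewrite wr1 leNgt divr_gt0.
(* In [W'] the terms containing [h (V r) * psi r] cancel, since [k = h V]; what is left has the sign
   of [wp * w], because [h' < - kap] at the values of [V]. *)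
pose W (r : R) : R := shell N k r * Ps r - shell N psi r * h (V r).
pose D (r : R) : R := 'D_1 h (V r).
have DP (r : R) : 0 <= r <= 1 -> is_derive (V r) 1 h (D r) /\ D r < - kap.
  by move=> r01; have [D' h1 h2] := hder (Vd r r01); rewrite /D derive_val; split.
have dW (r : R) : 0 < r < r1 ->
    is_derive r 1 W (r ^+ N.+1 * (wp r * w r) * (- kap - D r)).
  move=> /andP[r0 rr].
  have r01 : 0 <= r <= 1 by lra.
  have hk := is_derive_shell N ck (ltW r0).
  have hp := is_derive_shell N cpsi (ltW r0).
  have hh := @is_derive1_comp _ h V r _ _ (DP r r01).1 (dV r).
  apply: (is_derive_eq (is_deriveB (is_deriveM hk (dPs r)) (is_deriveM hp hh))).
  rewrite /GRing.scale/= (kV r01) (epsi r01) -/(Ps r).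
  rewrite (shell_rmean N0 _ (ltW r0)) (shell_rmean N0 _ (ltW r0)) -/w -/wp.
  have -> : r ^+ N.+1 = r ^+ N * r by rewrite exprSr.
  by ring.
have cW r : 0 <= r <= r1 -> {for r, continuous W}.
  move=> /andP[r0 rr].
  have hk := is_derive_continuous (is_derive_shell N ck r0).
  have hp := is_derive_continuous (is_derive_shell N cpsi r0).
  have hh : {for r, continuous (h \o V)}.
    by apply: continuous_comp; [exact: cV|exact: ch].
  by apply: cvgB; apply: cvgM => //; exact: cPs.
have W0 : W 0 = 0 by rewrite /W !shell_rmean// expr0n eqn0Ngt N0 !mul0r subrr.
have w0 : 0 < w 0.
  rewrite /w rmean0 kV ?lexx ?ler01// divr_gt0//.
  by rewrite trajectory0; exact: h_gt0.
have /cvgrPdist_lt/(_ _ w0)[e /= e0 eP] := cw 0.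
pose s := Num.min (e / 2) r1.
have s0 : 0 < s by rewrite lt_min r1p divr_gt0.
have sr : s <= r1 by rewrite ge_min lexx orbT.
have se : s <= e / 2 by rewrite ge_min lexx.
have ws t : 0 <= t <= s -> 0 < w t.
  move=> ts; have te : `|0 - t| < e by rewrite sub0r normrN ger0_norm; lra.
  by have := eP t te; have := ler_norm (w 0 - w t); lra.
have Ws : 0 < W s.
  rewrite -W0; apply: (@derive_gt0_lt _ W _ 0 s s0).
  - by move=> x xs; apply: dW; lra.
  - by move=> x xs; apply: cW; lra.
  - move=> x xs; have x01 : 0 <= x <= 1 by lra.
    apply: mulr_gt0; last by rewrite subr_gt0; exact: (DP x x01).2.
    apply: mulr_gt0; first by apply: exprn_gt0; lra.
    by apply: mulr_gt0; [apply: wpos|apply: ws]; lra.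
have WW : W s <= W r1.
  apply: (@derive_ge0_le _ W _ s r1 sr).
  - by move=> x xs; apply: dW; lra.
  - by move=> x xs; apply: cW; lra.
  - move=> x xs; have x01 : 0 <= x <= 1 by lra.
    apply: mulr_ge0; last by rewrite subr_ge0; exact: ltW (DP x x01).2.
    apply: mulr_ge0; first by apply: exprn_ge0; lra.
    by apply: mulr_ge0; [apply/ltW/wpos|apply: w_ge0]; lra.
(* As [wp r1 = 0], only [shell N k r1 * Ps r1] remains, whose factors are nonnegative and
   nonpositive; yet [W] has grown from 0. *)
have : W r1 <= 0.
  rewrite /W !shell_rmean ?(ltW r1p)// -/w -/wp wr1 mulr0 mul0r subr0.
  rewrite mulr_ge0_le0// mulr_ge0 ?exprn_ge0 ?(ltW r1p)//.
  by apply: w_ge0; lra.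
lra.
Qed.

(* At an interior first zero of [V'] also [V'' = 0], so that [V] is there equal
   to a zero of [h]; this contradicts the uniqueness for the Cauchy problem. *)
Lemma no_interior_critical_point (r0 : R) : 0 < r0 -> r0 < 1 -> w r0 = 0 ->
  (forall s : R, 0 <= s < r0 -> 0 < w s) -> (forall s : R, 0 <= s <= 1 -> 0 <= w s) ->
  False.
Proof.
move=> r0p r01 wr0 wpos w_ge0.
have cw : continuous w by exact: rmean_continuous.
have dw (r : R) : 0 < r -> is_derive r 1 w ((k r - N%:R * w r) / r).
  exact: is_derive_rmean.
(* [r0] is an interior minimum of [w], so [w' = (k - N * w) / r] vanishes there. *)
have kr0 : k r0 = 0.
  have h1 := @derive1_at_min _ w 0 1 r0 ler01.
  have h2 : is_derive r0 1 w 0.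
    apply: h1.
    - by move=> t; rewrite in_itv/= => /andP[t0 _]; have [] := dw t t0.
    - by rewrite in_itv/= r0p.
    - by move=> t; rewrite in_itv/= wr0 => /andP[t0 t1]; apply: w_ge0; lra.
  have e1 := @derive_val _ _ _ _ _ _ _ h2.
  have e2 := @derive_val _ _ _ _ _ _ _ (dw r0 r0p).
  move: e2; rewrite e1 wr0 mulr0 subr0 => /esym/eqP.
  by rewrite mulf_eq0 invr_eq0 (gt_eqF r0p) orbF => /eqP.
have hr0 : h (V r0) = 0 by rewrite -kV//; lra.
pose q := (r0 / 2) ^+ N.
have q0 : 0 < q by rewrite exprn_gt0// divr_gt0.
(* Backward uniqueness on a window of length [tau]. Let [m] be the maximum of [w] there, reached at
   [c]. Then [|V s - V r0| <= m * tau], so [|k s| <= L * m * tau] between [c] and [r0], and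
   integrating the flux gives [c ^+ N * m <= L * m * tau ^+ 2]. Since [c >= r0 / 2], the left side
   is at least [q * m]; since [tau * L <= q] and [tau <= 1 / 2], the right side is at most
   [q * m / 2]. This is absurd for [m > 0]. *)
pose tau := Num.min (r0 / 2) (q / (L + 1)).
have L1 : 0 < L + 1 by rewrite addr_gt0.
have t0 : 0 < tau by rewrite lt_min !divr_gt0.
have t1 : tau <= r0 / 2 by rewrite ge_min lexx.
have t2 : tau * (L + 1) <= q.
  by rewrite -ler_pdivlMr// ge_min lexx orbT.
have ab : r0 - tau <= r0 by lra.
have [c cr wc] := EVT_max ab (continuous_subspaceT cw).
rewrite in_itv/= in cr; have /andP[c1 c2] := cr.
set m := w c.
have wm s : r0 - tau <= s <= r0 -> w s <= m by move=> sr; apply: wc; rewrite in_itv.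
have m0 : 0 < m.
  apply: (@lt_le_trans _ _ (w (r0 - tau))); first by apply: wpos; lra.
  by apply: wm; lra.
have kbound s : c <= s <= r0 -> `|k s| <= L * (m * tau).
  move=> /andP[s1 s2]; have s01 : 0 <= s <= 1 by lra.
  rewrite (kV s01) -[h (V s)]subr0 -hr0; apply: le_trans (hL _ _) _.
  rewrite ler_wpM2l ?(ltW L0)// distrC.
  have dm (t : R) : is_derive t 1 (fun x => m * x) m.
    by apply: is_derive_eq; rewrite /GRing.scale/=; ring.
  apply: (@le_trans _ _ (m * r0 - m * s)).
    apply: (derive_norm_le s2 (fun x _ => dV x) (fun x _ => dm x)).
    - by move=> x _; exact: cV.
    - by move=> x _; exact: is_derive_continuous (dm x).
    - move=> x xs; have wx : 0 <= w x by apply: w_ge0; lra.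
      rewrite ger0_norm; last by apply: mulr_ge0 => //; lra.
      have : w x <= m by apply: wm; lra.
      by apply: le_trans; apply: ler_piMl => //; lra.
  by rewrite -mulrBr ler_wpM2l ?(ltW m0)//; lra.
have c0 : 0 <= c by lra.
have sb : `|shell N k r0 - shell N k c| <= L * (m * tau) * r0 - L * (m * tau) * c.
  have dm (t : R) : is_derive t 1 (fun x => L * (m * tau) * x) (L * (m * tau)).
    by apply: is_derive_eq; rewrite /GRing.scale/=; ring.
  apply: (derive_norm_le c2 (df := fun x => x ^+ N.-1 * k x) _ (fun x _ => dm x)).
  - by move=> x xr; apply: is_derive_shell => //; lra.
  - move=> x xr; have x0 : 0 <= x by lra.
    exact: is_derive_continuous (is_derive_shell N ck x0).
  - by move=> x _; exact: is_derive_continuous (dm x).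
  - move=> x xr; rewrite normrM normrX ger0_norm; last lra.
    have : `|k x| <= L * (m * tau) by apply: kbound; lra.
    apply: le_trans; apply: ler_piMl => //.
    by apply: exprn_ile1; lra.
move: sb; rewrite !shell_rmean ?(ltW r0p)// -/w wr0 mulr0 sub0r normrN.
rewrite -mulrBr -/m ger0_norm; last by rewrite mulr_ge0 ?exprn_ge0 ?(ltW m0).
have cq : q <= c ^+ N by rewrite lerXn2r ?nnegrE//; lra.
have e1 : L * (m * tau) * (r0 - c) <= L * (m * tau) * tau.
  rewrite ler_wpM2l ?mulr_ge0 ?(ltW m0) ?(ltW t0) ?(ltW L0)//; lra.
have e2 : q * m <= c ^+ N * m by rewrite ler_wpM2r ?(ltW m0).
have e3 : L * (m * tau) * tau <= m * (q * tau).
  have -> : L * (m * tau) * tau = m * (tau * L * tau) by ring.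
  rewrite ler_wpM2l ?(ltW m0)// ler_wpM2r ?(ltW t0)//.
  by apply: le_trans t2; rewrite ler_wpM2l ?(ltW t0)//; lra.
have e4 : m * (q * tau) <= m * (q * (1 / 2)).
  by rewrite ler_wpM2l ?(ltW m0)// ler_wpM2l ?(ltW q0)//; lra.
have e5 : 0 < q * m by rewrite mulr_gt0.
have e6 : m * (q * (1 / 2)) = q * m / 2 by field.
lra.
Qed.

(** [V 1 - d = xi * w xi] for some [xi] between 0 and 1, and [h V <= V <= V 1] bounds the mean
    [w xi] by [V 1 / N], at most [V 1 / 2]. *)
Lemma trajectory_le_double : um <= d -> 0 < d ->
  (forall s : R, 0 <= s < 1 -> 0 < w s) -> forall r, 0 <= r <= 1 -> d <= V r <= 2 * d.
Proof.
move=> umd d0 wpos.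
have mono (a b : R) : 0 <= a -> a <= b -> b <= 1 -> V a <= V b.
  by move=> a0 ab b1; apply: trajectory_le => // s sb; apply/ltW/wpos; lra.
have dle (r : R) : 0 <= r <= 1 -> d <= V r.
  by move=> r01; rewrite -trajectory0; apply: mono; lra.
have V1 : V 1 <= 2 * d.
  have [xi xr] := MVT_pointwise (@ltr01 R) (fun x _ => dV x) (fun x _ => @cV x).
  rewrite trajectory0 subr0 mulr1 => e.
  have wxi : w xi <= V 1 / N%:R.
    apply: rmean_le_cst => //; first lra.
    move=> t txi; have t01 : 0 <= t <= 1 by lra.
    rewrite (kV t01); apply: (@le_trans _ _ (V t)).
      by apply: h_le; apply: le_trans umd (dle t t01).
    by apply: mono; lra.
  have V1N : V 1 / N%:R <= V 1 / 2.
    rewrite ler_wpM2l//; first by have := dle 1; rewrite ler01 lexx => /(_ isT); lra.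
    by rewrite lef_pV2 ?posrE// (ler_nat R 2 N).
  have w0 : 0 < w xi by apply: wpos; lra.
  have : xi * w xi <= w xi by apply: ler_piMl; lra.
  lra.
by move=> r r01; rewrite dle//=; apply: le_trans V1; apply: mono; lra.
Qed.

End trajectory.

(** [k d] is [h] along the solution [U d], so that differences of means cost one more factor [L]
    than differences of solutions; a single constant covers both, uniformly on [[0, 1]]. *)
Lemma uniform_dependence : exists C (k : R -> R -> R), [/\ 1 <= C,
  forall d, continuous (k d),
  forall d (r : R), 0 <= r <= 1 -> k d r = h (d + green N (k d) r),
  forall d (r : R), 0 <= r <= 1 -> h d = 0 -> d + green N (k d) r = d &
  forall d e (r : R), 0 <= r <= 1 ->
    `|d + green N (k d) r - (e + green N (k e) r)| <= C * `|d - e| /\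
    `|rmean N (k d) r - rmean N (k e) r| <= C * `|d - e|].
Proof.
have [||U [cU eU lU zU]] := @ivp R N N0 (fun _ => h) L L0.
- by move=> u cu; exact: continuous_compr.
- by move=> _; exact: hL.
pose k d s := h (U d s).
have ck d : continuous (k d) by exact: continuous_compr.
have E1 : 1 <= expR L by rewrite -expR0 ler_expR ltW.
exists (2 * expR L * (L + 1)), k; split=> //.
- rewrite -[leLHS]mulr1; apply: ler_pM => //; first lra.
  by have := L0; lra.
- by move=> d r r01; rewrite {1}/k (eU d r r01).
- move=> d r r01 hd; rewrite -[LHS](eU d r r01); apply: zU => _; exact: hd.
- move=> d e r r01.
  have l1 (s : R) : 0 <= s <= 1 -> `|U d s - U e s| <= 2 * expR L * `|d - e|.
    exact: lU.
  have E0 : 0 <= 2 * expR L * `|d - e| by rewrite mulr_ge0//; lra.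
  have EL : 0 <= L * (2 * expR L * `|d - e|) by rewrite mulr_ge0// ltW.
  have -> : 2 * expR L * (L + 1) * `|d - e| =
    L * (2 * expR L * `|d - e|) + 2 * expR L * `|d - e| by ring.
  split.
    rewrite -[d + _](eU d r r01) -[e + _](eU e r r01).
    by apply: le_trans (l1 r r01) _; rewrite lerDr.
  rewrite -rmeanB//.
  apply: (@le_trans _ _ (L * (2 * expR L * `|d - e|))); last by rewrite lerDl.
  apply: le_trans (c_le EL); apply: rmean_norm_le => //.
  + by apply: continuous_sub.
  + by move/andP: r01 => [].
  + move=> t tr; apply: le_trans (hL _ _) _.
    by rewrite ler_wpM2l ?(ltW L0)//; apply: l1; lra.
Qed.

Theorem shooting : exists d (k : R -> R), [/\ continuous k, um < d,
  forall r : R, 0 <= r <= 1 -> k r = h (d + green N k r) /\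
    d <= d + green N k r <= 2 * u0,
  forall r : R, 0 <= r < 1 -> 0 < rmean N k r & rmean N k 1 = 0].
Proof.
have [C [k [C1 ck kE const lip]]] := uniform_dependence.
have C0 : 0 < C by lra.
have cw d : continuous (rmean N (k d)) by exact: rmean_continuous.
(* Positivity is asked on the closed interval, 0 included, so that it is preserved by small changes
   of [d]. *)
pose P := [set d | um < d < u0 /\ forall r : R, 0 <= r <= 1 -> 0 < rmean N (k d) r].
have lipV d e (r : R) : 0 <= r <= 1 ->
  `|d + green N (k d) r - (e + green N (k e) r)| <= C * `|d - e|.
  by move=> r01; have [] := lip d e r r01.
have lipw d e (r : R) : 0 <= r <= 1 ->
  `|rmean N (k d) r - rmean N (k e) r| <= C * `|d - e|.
  by move=> r01; have [] := lip d e r r01.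
have small (e : R) : 0 < e -> exists2 x : R, 0 < x & forall y : R, `|y| <= x -> C * `|y| < e.
  move=> e0; exists (e / (2 * C)); first by rewrite divr_gt0// mulr_gt0.
  move=> y ye; apply: (@le_lt_trans _ _ (C * (e / (2 * C)))).
    by rewrite ler_wpM2l// ltW.
  have -> : C * (e / (2 * C)) = e / 2 by field; rewrite gt_eqF.
  lra.
(* For [d] close to [um] the trajectory is close to the constant solution [um], hence below [u0].
   There [h >= 0], so it is nondecreasing, stays above [um], and [h] is in fact positive along
   it. *)
have P_neq0 : P !=set0.
  have um1 : 0 < u0 - um by rewrite subr_gt0.
  have [x x0 xP] := small _ um1.
  pose y := Num.min x ((u0 - um) / 2).
  have y0 : 0 < y by rewrite lt_min x0/=; lra.
  have yx : y <= x by rewrite ge_min lexx.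
  have yu : y <= (u0 - um) / 2 by rewrite ge_min lexx orbT.
  exists (um + y); split; first lra.
  have Vu (r : R) : 0 <= r <= 1 -> um + y + green N (k (um + y)) r < u0.
    move=> r01; have := lipV (um + y) um r r01.
    have -> : um + y - um = y by ring.
    rewrite (const um r r01 hum) => h1.
    have h2 : C * `|y| < u0 - um by apply: xP; rewrite gtr0_norm.
    by have := le_lt_trans (le_trans (ler_norm _) h1) h2; lra.
  have k0 (r : R) : 0 <= r <= 1 -> 0 <= k (um + y) r.
    by move=> r01; rewrite kE//; apply/h_ge0/ltW/Vu.
  have w0 (r : R) : 0 <= r <= 1 -> 0 <= rmean N (k (um + y)) r.
    move=> r01; rewrite -[leLHS](mul0r (N%:R^-1 : R)); apply: rmean_ge_cst => //.
      by case/andP: r01.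
    by move=> t tr; apply: k0; lra.
  move=> r r01; apply: rmean_gt0 => //; first by case/andP: r01.
  move=> s sr; have s01 : 0 <= s <= 1 by lra.
  rewrite kE//; apply: h_gt0; rewrite Vu// andbT.
  apply: (@lt_le_trans _ _ (um + y)); first by rewrite ltrDl.
  have s0 : 0 <= s by lra.
  have := trajectory_le (um + y) (ck (um + y)) (lexx 0) s0.
  by rewrite trajectory0; apply => t ts; apply: w0; lra.
have [x x0 xP] := small _ del0.
(* For [d] close to [u0] the trajectory is close to the constant solution [u0] and stays where
   [h' < - kap], so that [trajectory_oscillates] applies. *)
have ubP : ubound P (u0 - x).
  move=> d [du wd]; rewrite leNgt; apply/negP => xd.
  apply: (trajectory_oscillates (ck d) (kE d) du) => r r01.
    have := lipV d u0 r r01; rewrite (const u0 r r01 hu0).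
    move=> /le_lt_trans; apply; apply: xP; rewrite ler0_norm; lra.
  exact/ltW/wd.
have hP : has_sup P by split=> //; exists (u0 - x).
pose d := sup P.
have du : d <= u0 - x by apply: ge_sup.
have dm : um < d.
  have [e eP] := P_neq0; apply: (@lt_le_trans _ _ e).
    by case: eP => /andP[].
  by apply: ub_le_sup => //; exists (u0 - x).
have w_ge0 (r : R) : 0 <= r <= 1 -> 0 <= rmean N (k d) r.
  move=> r01; rewrite leNgt; apply/negP => wn.
  have wn' : 0 < - rmean N (k d) r by lra.
  have [y y0 yP] := small _ wn'.
  have [e Pe ed] := sup_adherent y0 hP; rewrite -/d in ed.
  have ed' : e <= d by apply: ub_le_sup => //; exists (u0 - x).
  have := lipw e d r r01; have ney : `|e - d| <= y by rewrite ler0_norm; lra.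
  have := yP _ ney; have [_ /(_ r r01) we] := Pe.
  by have := ler_norm (rmean N (k e) r - rmean N (k d) r); lra.
(* Otherwise the positive minimum of [w] over [[0, 1]] would let a slightly larger datum belong to
   [P]; [z <= x / 2] keeps that datum below [u0]. *)
have [r [r01 wr]] : exists r : R, 0 <= r <= 1 /\ rmean N (k d) r <= 0.
  apply: contrapT => nex.
  have wpos (r : R) : 0 <= r <= 1 -> 0 < rmean N (k d) r.
    by move=> r01; rewrite ltNge; apply/negP => wr; apply: nex; exists r.
  have [c cr cmin] := EVT_min (@ler01 R) (continuous_subspaceT (cw d)).
  rewrite in_itv/= in cr.
  have [y y0 yP] := small _ (wpos c cr).
  pose z := Num.min y (x / 2).
  have z0 : 0 < z by rewrite lt_min y0/=; lra.
  have zy : z <= y by rewrite ge_min lexx.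
  have zx : z <= x / 2 by rewrite ge_min lexx orbT.
  have : P (d + z).
    split=> [|r r01]; first lra.
    have := lipw d (d + z) r r01.
    have -> : d - (d + z) = - z by ring.
    rewrite normrN => h1; have h2 : C * `|z| < rmean N (k d) c.
      by apply: yP; rewrite gtr0_norm.
    have h3 : rmean N (k d) c <= rmean N (k d) r by apply: cmin; rewrite in_itv.
    by have := ler_norm (rmean N (k d) r - rmean N (k (d + z)) r); lra.
  move=> Pz; have : d + z <= d by apply: ub_le_sup => //; exists (u0 - x).
  lra.
have w0 : 0 < rmean N (k d) 0.
  rewrite rmean0 kE ?lexx ?ler01// divr_gt0// trajectory0; apply: h_gt0; lra.
have r0 : 0 <= r by case/andP: r01.
have [r1 [r1p r1r wr1 wpos]] := first_zero (cw d) w0 r0 wr.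
have r1E : r1 = 1.
  have [//|r1n] := eqVneq r1 1.
  have r11 : r1 < 1 by rewrite lt_neqAle r1n/=; lra.
  by have := no_interior_critical_point (ck d) (kE d) r1p r11 wr1 wpos w_ge0.
rewrite r1E in wr1 wpos.
exists d, (k d); split=> // s s01; split; first exact: kE.
have d0 : 0 < d by exact: le_lt_trans um0 dm.
have /andP[h1 h2] := trajectory_le_double (ck d) (kE d) (ltW dm) d0 wpos s01.
by rewrite h1/=; lra.
Qed.

End Shooting.

(** * Radial solutions on the ball *)

Section RadialSolution.
Context {R : realType} (N : nat).
Local Notation E := 'rV[R]_N.
Local Notation B := (uball N : set E).
Local Notation S := (usphere N : set E).
Local Notation leb := (lebesgue_rV N : {measure set E -> \bar R}).
Local Notation sigma := (sphere_measure N : {measure set E -> \bar R}).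

Lemma continuous_ball_square_integrable (q : E -> R) : continuous q ->
  square_integrable leb B q.
Proof.
move=> cq; split; first exact: continuous_ball_measurable.
apply: (continuous_ball_integrable (q := fun x => q x ^+ 2)).
exact: continuous_compr cq (@exprn_continuous R 2).
Qed.

Lemma continuous_sphere_square_integrable (q : E -> R) : continuous q ->
  square_integrable sigma S q.
Proof.
move=> cq; split; first exact: continuous_sphere_measurable.
apply: (continuous_sphere_integrable (q := fun x => q x ^+ 2)).
exact: continuous_compr cq (@exprn_continuous R 2).
Qed.

Lemma C1_H1 (q : E -> R) (g : 'I_N -> E -> R) : C1 q ->
  (forall i, partial i q = g i) -> H1_with_grad q g.
Proof.
move=> cq gE; split.
  exact: continuous_ball_square_integrable (C1_continuous cq).
move=> i; rewrite -gE; split; last exact: weak_partial_C1.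
exact: continuous_ball_square_integrable (continuous_partial cq).
Qed.

Lemma C1_is_trace (q : E -> R) (g : 'I_N -> E -> R) : C1 q ->
  (forall i, partial i q = g i) -> is_trace q g q.
Proof.
move=> cq gE; split.
  exact: continuous_sphere_square_integrable (C1_continuous cq).
have zero (T : measurableType _) (mu : {measure set T -> \bar R}) (D : set T)
    (a b : T -> R) : a = b ->
    (\int[mu]_(x in D) ((a x - b x) ^+ 2)%:E)%E @[k --> \oo] --> 0%E.
  move=> ->; rewrite (_ : integral _ _ _ = 0%E); first exact: cvg_cst.
  by apply: integral0_eq => x _; rewrite subrr expr0n.
exists (fun=> q); split=> //.
- exact: zero.
- by move=> i; apply: zero; rewrite gE.
- exact: zero.
Qed.

Lemma ae_exists_box (a b : 'I_N -> R) (P : E -> Prop) : (forall i, a i < b i) ->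
  {ae leb, forall x, P x} -> exists x : E, (forall i, a i < x ord0 i < b i) /\ P x.
Proof.
move=> ab [A [mA A0 PA]]; apply: contrapT => nex.
pose I (i : 'I_N) := [set` `]a i, b i[%R].
pose X := [set x : E | forall i, I i (x ord0 i)].
have mX : measurable X by apply: (@measurable_coord_set _ _ I) => i; exact: measurable_itv.
have XA : X `<=` A.
  move=> x Xx; apply: PA => /= Px; apply: nex; by exists x; split.
have : (leb X <= leb A)%E by apply: le_measure; rewrite ?inE.
have -> : leb X = (\prod_(i < N) lebesgue_measure (I i))%E.
  by apply: lebesgue_rV_box => i; exact: measurable_itv.
rewrite A0.
rewrite leNgt => /negP; apply.
elim/big_ind: _ => // [x y|i _]; first exact: mule_gt0.
by rewrite lebesgue_measure_itv/= lte_fin ab -EFinB lte_fin subr_gt0.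
Qed.

(** Monotonicity is pointwise but constancy only almost everywhere, so the two points to compare are
    sought in two boxes of positive measure, one near the origin and one farther along the first
    axis. *)
Lemma radially_increasing_not_constant (u : E -> R) : (2 <= N)%N ->
  radially_increasing u -> ~ ae_constant u.
Proof.
move=> N2 ui [c uc].
have N0 : (0 < N)%N by exact: leq_trans N2.
pose i0 := Ordinal N0.
(* Chosen so that [N * z ^+ 2 = z / 2 <= 1 / 8], whence [|x|^2 <= 3 / 16 < 1 / 4 < |y|^2 <= 11 / 16
   < 1]. *)
pose z : R := (2 * N%:R)^-1.
have NR2 : 2 <= N%:R :> R by rewrite (ler_nat R 2 N).
have NR0 : 0 < N%:R :> R by rewrite ltr0n.
have z0 : 0 < z by rewrite invr_gt0 mulr_gt0.
have z1 : z <= 1 / 4.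
  by rewrite /z div1r lef_pV2 ?posrE ?mulr_gt0//; lra.
have Nz : N%:R * z ^+ 2 <= 1 / 8.
  have -> : N%:R * z ^+ 2 = z / 2 by rewrite /z; field; rewrite gt_eqF.
  lra.
have sumz (x : E) (b : R) : 0 <= b -> x ord0 i0 ^+ 2 <= b ->
    (forall i, i != i0 -> x ord0 i ^+ 2 <= z ^+ 2) -> sqnorm x <= b + N%:R * z ^+ 2.
  move=> b0 xb xz; rewrite /sqnorm (bigD1 i0)//=; apply: lerD => //.
  apply: (@le_trans _ _ (\sum_(i < N) z ^+ 2)).
    rewrite [leRHS](bigD1 i0)//= -[leLHS]add0r; apply: lerD; first exact: sqr_ge0.
    exact: ler_sum.
  by rewrite sumr_const card_ord mulr_natl.
have sqle (t b : R) : 0 < t < b -> t ^+ 2 <= b ^+ 2.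
  by move=> tb; rewrite lerXn2r ?nnegrE; lra.
have [x [xb ux]] := ae_exists_box (fun=> z0) uc.
have [|y [yb uy]] := @ae_exists_box (fun i => if i == i0 then 1 / 2 else 0)
  (fun i => if i == i0 then 3 / 4 else z) _ _ uc.
  by move=> i; case: ifP => // _; lra.
have sx : sqnorm x <= 1 / 16 + N%:R * z ^+ 2.
  apply: sumz; [lra| |by move=> i _; exact: sqle].
  apply: (@le_trans _ _ (z ^+ 2)); first exact: sqle.
  have -> : 1 / 16 = (1 / 4) ^+ 2 :> R by field.
  by rewrite lerXn2r ?nnegrE; lra.
have sy : sqnorm y <= 9 / 16 + N%:R * z ^+ 2.
  apply: sumz; first lra.
    have -> : 9 / 16 = (3 / 4) ^+ 2 :> R by field.
    by apply: sqle; have := yb i0; rewrite eqxx; lra.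
  by move=> i ii0; apply: sqle; have := yb i; rewrite (negbTE ii0).
have Bx : B x by apply/uball_sqnorm; lra.
have By : B y by apply/uball_sqnorm; lra.
have xy : enorm x < enorm y.
  rewrite -(ltr_pXn2r (n := 2))// ?nnegrE ?enorm_ge0// !sqr_enorm.
  have : (1 / 2) ^+ 2 < sqnorm y.
    have h2 : (0 : R) <= 1 / 2 by lra.
    rewrite -sqr_enorm ltr_pXn2r ?nnegrE ?enorm_ge0//.
    apply: lt_le_trans (coord_le_enorm y i0); apply: lt_le_trans (ler_norm _).
    by have := yb i0; rewrite eqxx => /andP[].
  have -> : (1 / 2) ^+ 2 = 1 / 4 :> R by field.
  lra.
by have := ui x y Bx By xy; rewrite (ux Bx) (uy By) ltxx.
Qed.

Hypothesis N0 : (0 < N)%N.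
Variables (k : R -> R) (d : R).
Hypothesis ck : continuous k.

(** The solution is classical: its continuous derivatives are weak ones, and the gradient is its own
    trace, with a constant approximating sequence; on the sphere it is [x_i * w 1 = 0]. *)
Lemma radial_fun_solution (F : R -> R) : rmean N k 1 = 0 ->
  (forall r, 0 <= r < 1 -> - k r + (d + green N k r) = F (d + green N k r)) ->
  neumann_solution F (radial_fun k d : E -> R).
Proof.
move=> w1 eqk.
have [cu gu] := @radial_fun_C1 R N N0 k ck d.
have hess (i : 'I_N) : C1 (radial_grad k i : E -> R) /\
    forall j, partial j (radial_grad k i : E -> R) = radial_hess k i j.
  exact: radial_grad_C1.
exists (radial_grad k), (radial_hess k); split.
- split; first exact: C1_H1.
  by move=> i; have [ci gi] := hess i; exact: C1_H1.
- apply: aeW => x Bx; rewrite radial_laplacian//; apply: eqk.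
  by rewrite enorm_ge0.
- exists (radial_grad k); split.
    by move=> i; have [ci gi] := hess i; exact: C1_is_trace.
  apply: aeW => x Sx.
  rewrite (eq_bigr (fun=> 0)) ?big1// => i _.
  by rewrite /radial_grad Sx w1 mulr0 mul0r.
Qed.

Lemma radial_fun_radial : radial (radial_fun k d : E -> R).
Proof. by move=> x y _ _ xy; rewrite /radial_fun xy. Qed.

Lemma radial_fun_increasing : (forall r, 0 <= r < 1 -> 0 < rmean N k r) ->
  radially_increasing (radial_fun k d : E -> R).
Proof.
move=> wpos x y Bx By xy; rewrite /radial_fun ltrD2l.
have dg (r : R) : is_derive r 1 (green N k) (r * rmean N k r).
  exact: is_derive_green.
apply: (derive_gt0_lt xy (fun r _ => dg r)).
  by move=> r _; exact: is_derive_continuous (dg r).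
move=> r /andP[xr ry]; have r0 : 0 < r by exact: le_lt_trans (enorm_ge0 x) xr.
by rewrite mulr_gt0// wpos// ltW//=; exact: lt_trans ry By.
Qed.

End RadialSolution.

Theorem theorem1p3 (R : realType) (N : nat) (hN : (2 <= N)%N)
  (f df : R -> R)
  (fC1 : C1_nonneg f df)
  (f_nondecreasing : forall s t : R, 0 <= s -> s <= t -> f s <= f t)
  (f0 : f 0 = 0)
  (df0 : df 0 = 0)
  (f_lim0 : f s / s @[s --> 0^'+] --> (0 : R))
  (f_liminf : (1 < limf_einf (fun s : R => (f s / s)%:E) (+oo)%R)%E)
  (lam2 : R) (hlam2 : second_radial_eigenvalue N lam2)
  (u0 : R) (u0_gt0 : 0 < u0) (fu0 : f u0 = u0) (dfu0 : lam2 < df u0) :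
  exists u : 'rV[R]_N -> R,
    [/\ neumann_solution f u,
        forall x, uball N x -> 0 < u x,
        ~ ae_constant u,
        radial u &
        radially_increasing u].
Proof.
have N0 : (0 < N)%N by exact: leq_trans hN.
have [lam1 eig _] := hlam2.
have [h [L [um [del [[L0 um0 umu del0] hL [h_ge0 h_gt0 h_le] hder [hum hu0 hf]]]]]] :=
  truncated_nonlinearity fC1 f_nondecreasing f0 f_lim0 u0_gt0 fu0 lam1 dfu0.
have [psi [cpsi epsi psi1]] := radial_eigenvalue_ode N0 lam1 eig.
have kap0 : 0 < lam2 - 1 by rewrite subr_gt0.
have hder' s : `|s - u0| < del ->
    exists2 D : R, is_derive s 1 h D & D < - (lam2 - 1).
  by rewrite opprB; exact: hder.
have [d [k [ck umd kE wpos w1]]] := shooting hN L0 um0 umu del0 hL h_ge0 h_gt0 h_le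
  hum hu0 kap0 hder' cpsi epsi psi1.
have Vd (r : R) : 0 <= r < 1 ->
    k r = h (d + green N k r) /\ d <= d + green N k r <= 2 * u0.
  by move=> /andP[r0 r1]; apply: kE; rewrite r0 ltW.
have incr := radial_fun_increasing N0 d ck wpos.
exists (radial_fun k d); split.
- apply: (radial_fun_solution N0 ck w1) => r r01.
  have [-> /andP[dV Vu]] := Vd r r01.
  (* [um < d <= V <= 2 * u0] is the range in which neither truncation is active. *)
  rewrite hf; first ring.
  by rewrite Vu andbT; apply: le_trans dV; exact: ltW.
- move=> x Bx; have [|_ /andP[dV _]] := Vd (enorm x).
    by rewrite enorm_ge0.
  by apply: lt_le_trans dV; exact: le_lt_trans um0 umd.
- exact: radially_increasing_not_constant hN incr.
- exact: radial_fun_radial.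
- exact: incr.
Qed.
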